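(* There is $s_0>0$ such that the following holds for every $s\ge s_0$ and $T>0$. For each $\beta\in(0,1)$ let $(\eta,\Phi)=(\eta^{\mathrm{Euler}},\Phi)$ be a regular solution of the Euler system on the time interval $[0,T/\beta]$, with surface trace $\psi=\Phi|_{z=1+\beta\eta}$, such that $(\eta,\nabla\psi)\in H^s(\mathbb{R}^2)\times H^s(\mathbb{R}^2)$, with norms bounded uniformly in $t\in[0,T/\beta]$ and $\beta\in(0,1)$. Assume that there is $h_{min}>0$ (independent of $\beta$ and $t$) such that $1+\beta\eta(t,X)\ge h_{min}$ for all $X\in\mathbb{R}^2$. Then there is a constant $C$ independent of $\beta$ such that, for $0<t<T/\beta$, $$\left|\Phi_x-P^{series}_x\right|_{L^\infty(\Omega_t)}\le C\beta^2,\qquad \left|\Phi_y-P^{series}_y\right|_{L^\infty(\Omega_t)}\le C\beta^2,\qquad \left|\Phi_z-P^{series}_z\right|_{L^\infty(\Omega_t)}\le C\beta^2 .$$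
   Context: Notation: $X=(x,y)\in\mathbb{R}^2$, $\nabla=(\partial_x,\partial_y)^T$, $\Delta=\partial_x^2+\partial_y^2$; $H^s=H^s(\mathbb{R}^2)$ is the usual Sobolev space (for $\nabla\psi$, componentwise). All variables are non-dimensional and the nonlinearity parameter $\alpha$ equals the shallowness parameter $\beta$ (Stokes number $\alpha/\beta=1$). Fluid domain: $\Omega_t=\{(X,z)\in\mathbb{R}^3:\ 0\le z\le 1+\beta\eta(t,X)\}$. Euler system for the surface elevation $\eta(t,X)$ and velocity potential $\Phi(t,X,z)$: $$\beta\Delta\Phi+\Phi_{zz}=0\ \text{ for } 0<z<1+\beta\eta,\qquad \Phi_z=0\ \text{ at } z=0,$$ $$\Phi_t+\tfrac{\beta}{2}\left(\Phi_x^2+\Phi_y^2+\tfrac1\beta\Phi_z^2\right)+\eta=0,\qquad \eta_t+\beta(\eta_x\Phi_x+\eta_y\Phi_y)-\tfrac1\beta\Phi_z=0\quad\text{on } z=1+\beta\eta .$$ ''Regular solution'' means a solution smooth enough for all expressions to make classical sense. Truncated series: $P^{series}=f-\beta\frac{z^2}{2}\Delta f+\beta^2\frac{z^4}{24}\Delta^2 f$, where $f=\psi+\frac{\beta}{2}\Delta\psi+\frac{5\beta^2}{24}\Delta^2\psi+\beta^2\eta\,\Delta\psi$.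
   Formalization: The formal statement also assumes that for each β and each 0<t<T/β the velocity ∇Φ is bounded on Ω_t (bound may depend on β and t); without this, the surface data do not determine Φ and the norms can be infinite. The conclusion itself forces this boundedness. *)

(* Defs.v *)
From HB Require Import structures.
From mathcomp Require Import all_boot all_order all_algebra.
From mathcomp Require Import all_classical all_reals all_analysis.

Set Implicit Arguments.
Unset Strict Implicit.
Unset Printing Implicit Defensive.

Import Order.TTheory GRing.Theory Num.Theory.
Import numFieldNormedType.Exports.

Local Open Scope classical_set_scope.
Local Open Scope ring_scope.

(* A point X = (x, y) of the plane, a pair (t, X), a point (X, z) of space, and
   a point ((t, X), z) of space-time. *)
Notation plane R := (R * R)%type.
Notation tplane R := (R * (R * R))%type.
Notation space3 R := ((R * R) * R)%type.
Notation spacetime R := ((R * (R * R)) * R)%type.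

Section Derivatives.
Context {R : realType} {V : normedModType R}.

(* The derivative of F along v on D, up to the boundary of D: the value at p is
   the limit at p of the classical derivative taken at points interior to D.
   Only meaningful when the limit exists, which is part of [C1_closed]; at an
   interior point it is then the classical derivative. *)
Definition derivc (D : set V) (v : V) (F : V -> R) (p : V) : R :=
  lim ('D_v F q @[q --> within D° (nbhs p)]).

(* F is of class C^1 on the closed domain D: its first derivatives exist in the
   interior of D and extend continuously to D.  Since the neighbourhoods of an
   interior point are not punctured, the limits below also give the continuity
   of the derivatives in the interior. *)
Definition C1_closed (D : set V) (F : V -> R) : Prop :=
  {within D, continuous F} /\
  forall v : V,
    (forall p, D° p -> derivable F p v) /\
    (forall p, D p -> cvg ('D_v F q @[q --> within D° (nbhs p)])).

End Derivatives.

Section Euler.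
Context {R : realType}.

Definition ux : plane R := (1, 0).
Definition uy : plane R := (0, 1).

Definition sx : space3 R := (ux, 0).
Definition sy : space3 R := (uy, 0).
Definition sz : space3 R := (0, 1).

Definition st (v : space3 R) : spacetime R := ((0, v.1), v.2).

Definition slab (tau : R) : set (tplane R) := [set q | 0 <= q.1 <= tau].

Definition fluid (b tau : R) (eta : tplane R -> R) : set (spacetime R) :=
  [set p | slab tau p.1 /\ 0 <= p.2 <= 1 + b * eta p.1].

Definition Omega (b : R) (eta : tplane R -> R) (t : R) : set (space3 R) :=
  [set q | 0 <= q.2 <= 1 + b * eta (t, q.1)].

Definition surface (b : R) (eta : tplane R -> R) (q : tplane R) : spacetime R :=
  (q, 1 + b * eta q).

Definition trace (b : R) (eta : tplane R -> R) (Phi : spacetime R -> R)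
    (t : R) (X : plane R) : R := Phi (surface b eta (t, X)).

(* Phi_x, Phi_y, Phi_z, for v = sx, sy, sz, and Phi_t, up to the boundary. *)
Definition dPhi (b tau : R) (eta : tplane R -> R) (Phi : spacetime R -> R)
    (v : space3 R) : spacetime R -> R := derivc (fluid b tau eta) (st v) Phi.
Definition dtPhi (b tau : R) (eta : tplane R -> R) (Phi : spacetime R -> R) :
    spacetime R -> R := derivc (fluid b tau eta) ((1, 0), 0) Phi.

(* Regular solutions on the time interval [0, tau].  Only the derivatives
   occurring in the system are required to exist: eta and Phi are C^1 up to the
   boundary and Phi is C^2 in (X, z) in the interior of the fluid domain. *)
Record euler_solution (b tau : R) (eta : tplane R -> R)
    (Phi : spacetime R -> R) : Prop := {
  eta_C1 : C1_closed (slab tau) eta ;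
  Phi_C1 : C1_closed (fluid b tau eta) Phi ;
  Phi_C2 : forall (v w : space3 R) p, (fluid b tau eta)° p ->
    derivable ('D_(st v) Phi) p (st w) /\
    {for p, continuous ('D_(st w) ('D_(st v) Phi))} ;
  euler_laplace : forall p, (fluid b tau eta)° p ->
    b * ('D_(st sx) ('D_(st sx) Phi) p + 'D_(st sy) ('D_(st sy) Phi) p)
      + 'D_(st sz) ('D_(st sz) Phi) p = 0 ;
  euler_bottom : forall q, slab tau q ->
    dPhi b tau eta Phi sz (q, 0) = 0 ;
  euler_bernoulli : forall q, slab tau q ->
    let p := surface b eta q in
    dtPhi b tau eta Phi p
      + b / 2 * (dPhi b tau eta Phi sx p ^+ 2 + dPhi b tau eta Phi sy p ^+ 2
                 + b^-1 * dPhi b tau eta Phi sz p ^+ 2)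
      + eta q = 0 ;
  euler_kinematic : forall q, slab tau q ->
    let p := surface b eta q in
    derivc (slab tau) (1, 0) eta q
      + b * (derivc (slab tau) (0, ux) eta q * dPhi b tau eta Phi sx p
             + derivc (slab tau) (0, uy) eta q * dPhi b tau eta Phi sy p)
      - b^-1 * dPhi b tau eta Phi sz p = 0
}.

(* The velocity is bounded on the fluid domain at each time of ]0, tau[, with a
   bound depending on everything.  This excludes the nonzero solutions H,
   growing exponentially or faster as |X| tends to infinity, of the elliptic
   problem b (H_xx + H_yy) + H_zz = 0, H_z = 0 at the bottom, H = 0 at the
   surface: without it the surface data do not determine Phi. *)
Definition bounded_velocity (b tau : R) (eta : tplane R -> R)
    (Phi : spacetime R -> R) : Prop :=
  forall t, 0 < t < tau -> exists B : R, forall q, Omega b eta t q ->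
    forall v, v \in [:: sx; sy; sz] ->
      `|dPhi b tau eta Phi v ((t, q.1), q.2)| <= B.

Definition lap (u : plane R -> R) : plane R -> R :=
  fun X => 'D_ux ('D_ux u) X + 'D_uy ('D_uy u) X.

Definition fseries (b : R) (eta psi : plane R -> R) : plane R -> R :=
  fun X => psi X + b / 2 * lap psi X + 5 * b ^+ 2 / 24 * lap (lap psi) X
           + b ^+ 2 * eta X * lap psi X.

Definition Pseries (b : R) (eta psi : plane R -> R) : space3 R -> R :=
  let f := fseries b eta psi in
  fun q => f q.1 - b * (q.2 ^+ 2 / 2) * lap f q.1
           + b ^+ 2 * (q.2 ^+ 4 / 24) * lap (lap f) q.1.

End Euler.

Section Sobolev.
Context {R : realType}.

Definition leb2 := ((@lebesgue_measure R) \x (@lebesgue_measure R))%E.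
Definition leb3 := (leb2 \x (@lebesgue_measure R))%E.

(* Real and imaginary parts of (2 pi)^-1 \int_(|X| <= n) u(X) e^(-i X.xi) dX. *)
Definition dot2 (X Y : plane R) : R := X.1 * Y.1 + X.2 * Y.2.
Definition disc (n : nat) : set (plane R) := [set X | dot2 X X <= n%:R ^+ 2].
Definition fourier_re (u : plane R -> R) (n : nat) (xi : plane R) : R :=
  (2 * pi)^-1 * \int[leb2]_(X in disc n) (u X * cos (dot2 X xi)).
Definition fourier_im (u : plane R -> R) (n : nat) (xi : plane R) : R :=
  - (2 * pi)^-1 * \int[leb2]_(X in disc n) (u X * sin (dot2 X xi)).

(* v + i w is the Fourier-Plancherel transform of the square integrable function
   u: the limit in L^2 of the Fourier transforms of the truncations of u. *)
Definition fourier_L2 (u v w : plane R -> R) : Prop :=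
  [/\ measurable_fun [set: plane R] v, measurable_fun [set: plane R] w &
      (fun n => \int[leb2]_xi
         ((v xi - fourier_re u n xi) ^+ 2
          + (w xi - fourier_im u n xi) ^+ 2)%:E)%E @ \oo --> 0%E].

(* u belongs to H^s(R^2), s >= 0, with norm at most M. *)
Definition sobolev_ball (s M : R) (u : plane R -> R) : Prop :=
  [/\ measurable_fun [set: plane R] u,
      (\int[leb2]_X (u X ^+ 2)%:E < +oo)%E &
      exists v w, fourier_L2 u v w /\
        (\int[leb2]_xi
           ((1 + dot2 xi xi) `^ s * (v xi ^+ 2 + w xi ^+ 2))%:E
         <= (M ^+ 2)%:E)%E].

Definition Linfty_norm (A : set (space3 R)) (g : space3 R -> R) : \bar R :=
  Lnorm leb3 +oo%E (fun q => (\1_A q * g q)%:E).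

End Sobolev.

(* Main.v *)
(* For fixed [b] and [t], the potential solves [b (F_xx + F_yy) + F_zz = 0] in
   the strip [0 <= z <= h = 1 + b eta], with [F_z = 0] at the bottom and trace
   [psi] at the surface.  The truncated series [P] satisfies the same equation up
   to [O(b^3)], the bottom condition exactly, and its trace differs from [psi] by
   [b^3] times a smooth function [E] of [X]; so the residual of the bounded
   function [G = F - P + b^3 E], which vanishes on the surface, is [O(b^3)].

   The gradient of [G] is bounded by doubling the variables rather
   than by elliptic regularity: explicit barriers control [G] near the surface,
   and the maximum principle applied to differences of [G] at two points on the
   same line gives [|G_z| <= C b^3] and [|G_x|, |G_y| <= C b^2].

   The constants only involve bounds on finitely many derivatives of [eta],
   [psi_x] and [psi_y], which follow from the Sobolev norms by Fourier inversion
   (Abel summation against [exp(-e(|xi_1| + |xi_2|))], whose transform is a product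
   of Poisson kernels).  Inversion needs continuity of the functions involved; for
   the derivatives of [psi] it is obtained from the chain rule at the surface,
   where [F] is only differentiable from one side. *)
Require Import Defs.
From HB Require Import structures.
From mathcomp Require Import all_boot all_order all_algebra.
From mathcomp Require Import all_classical all_reals all_analysis.
From mathcomp Require Import measurable_realfun ess_sup_inf ring lra.
Import Order.TTheory GRing.Theory Num.Theory.
Import numFieldNormedType.Exports.
Local Open Scope classical_set_scope.
Local Open Scope ring_scope.

(** * Directional derivatives *)

(** The obstacle is regularity at the surface: [Phi] is C^2 only in the interior, so the estimates
    rely on nothing but second derivative tests at minima. Doubling along one line keeps the other
    two coordinates common to both points. Applied to the difference of the two values, the doubled
    operator gives the residual at one point minus the residual at the other, at most twice the
    bound. The resulting slope has size m/a on a box of half-width a where |G| <= m. Near the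
    surface a has to shrink with the distance to it, and the barrier makes m shrink at the same
    rate.

    When the doubled direction is horizontal, its coefficient b is divided out. This costs one power
    of b, which is why a residual of order b^3 yields an error of order b^2.

    Only the gradient of psi is controlled, so psi, and with it F and P, may be unbounded; G is
    bounded because F and P each stay within bounded distance of psi. Uniformity in b and t comes
    from treating all pairs (b, t) as one indexed family whose constants are fixed before the
    index. *)

Section DirectionalDerivatives.
Context {R : realType}.

(** Along an affine map the two difference quotients are the same function of [k]. Directional
    derivatives therefore transfer with no differentiability of [F]; lines, time slices and
    permutations of coordinates are all instances. *)
Lemma quotient_affine {V W : normedModType R} (F : W -> R) (A : V -> W) v w p :
  (forall k : R, A (k *: v + p) = k *: w + A p) ->
  (fun k : R => k^-1 *: (((F \o A) \o shift p) (k *: v) - (F \o A) p)) =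
  (fun k : R => k^-1 *: ((F \o shift (A p)) (k *: w) - F (A p))).
Proof. by move=> Aaff; apply/funext => k /=; rewrite Aaff. Qed.

Lemma derive_affine {V W : normedModType R} (F : W -> R) (A : V -> W) v w p :
  (forall k : R, A (k *: v + p) = k *: w + A p) ->
  'D_v (F \o A) p = 'D_w F (A p).
Proof. by move=> Aaff; rewrite /derive (quotient_affine F _ _ _ _ Aaff). Qed.

Lemma derivable_affine {V W : normedModType R} (F : W -> R) (A : V -> W) v w p :
  (forall k : R, A (k *: v + p) = k *: w + A p) ->
  derivable F (A p) w -> derivable (F \o A) p v.
Proof. by move=> Aaff; rewrite /derivable (quotient_affine F _ _ _ _ Aaff). Qed.

Lemma lineD {V : normedModType R} (v p : V) (s k : R) :
  (k *: (1 : R) + s) *: v + p = k *: v + (s *: v + p).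
Proof. by rewrite [k *: 1]mulr1 scalerDl addrA. Qed.

Lemma derive_line {V : normedModType R} (F : V -> R) (v p : V) (s : R) :
  'D_1 (fun s : R => F (s *: v + p)) s = 'D_v F (s *: v + p).
Proof. by apply: (derive_affine F (fun s : R => s *: v + p)) => k; exact: lineD. Qed.

Lemma derivable_line {V : normedModType R} (F : V -> R) (v p : V) (s : R) :
  derivable F (s *: v + p) v -> derivable (fun s : R => F (s *: v + p)) s 1.
Proof.
by apply: (derivable_affine F (fun s : R => s *: v + p)) => k; exact: lineD.
Qed.

Lemma is_derive_line {V : normedModType R} (F : V -> R) (v p : V) (s : R) :
  derivable F (s *: v + p) v ->
  is_derive s 1 (fun s : R => F (s *: v + p)) ('D_v F (s *: v + p)).
Proof. by move=> dF; split; [exact: derivable_line|exact: derive_line]. Qed.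

Lemma line_cvg {V : normedModType R} (v p : V) : (s *: v + p) @[s --> (0:R)] --> p.
Proof.
rewrite -[X in _ --> X]add0r -(scale0r v).
by apply: cvgD; [apply: cvgZr_tmp; exact: cvg_id|exact: cvg_cst].
Qed.

Implicit Types (f g : R -> R) (a b c d : R).

(* Enough of a second order expansion at [0] for the second derivative test,
   without continuity of the second derivative. *)
Definition jet2 (f : R -> R) (a1 a2 : R) : Prop :=
  [/\ \forall s \near (0 : R), derivable f s 1, is_derive (0:R) (1:R) f a1 &
      is_derive (0:R) (1:R) ('D_1 f) a2].

Lemma jet2_eq f a1 a2 c1 c2 : jet2 f a1 a2 -> a1 = c1 -> a2 = c2 -> jet2 f c1 c2.
Proof. by move=> + <- <-. Qed.

Lemma jet2_near_derive f a1 a2 (df : R -> R) :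
  (\forall s \near (0:R), is_derive s (1:R) f (df s)) ->
  df 0 = a1 -> is_derive (0:R) (1:R) df a2 -> jet2 f a1 a2.
Proof.
move=> fdf <- ddf; split.
- by apply: filterS fdf => s [].
- exact: nbhs_singleton fdf.
- apply: near_eq_is_derive ddf.
  by apply: filterS fdf => s [_ ->].
Qed.

Lemma jet2_is_derive f a1 a2 : jet2 f a1 a2 ->
  \forall s \near (0:R), is_derive s (1:R) f ('D_1 f s).
Proof. by move=> [d _ _]; apply: filterS d => s /derivableP. Qed.

Lemma jet2_line {V : normedModType R} (F : V -> R) (v p : V) :
  (\forall q \near p, derivable F q v) -> derivable ('D_v F) p v ->
  jet2 (fun s : R => F (s *: v + p)) ('D_v F p) ('D_v ('D_v F) p).
Proof.
move=> nF dF; have lv := @line_cvg V v p.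
have H0 : 0 *: v + p = p by rewrite scale0r add0r.
have H s := derive_line F v p s.
apply: (jet2_near_derive _ _ _ (fun s : R => 'D_v F (s *: v + p))).
- near=> s; apply: is_derive_line; near: s.
  exact: (lv _ nF).
- by rewrite H0.
- rewrite -{2}H0; apply: is_derive_line.
  by rewrite H0.
Unshelve. all: by end_near. Qed.

Lemma jet2_affine (c d : R) : jet2 (fun s => s * d + c) d 0.
Proof.
apply: (jet2_near_derive (id * cst d + cst c) _ _ (cst d)) => //.
apply: (@nearW _ (nbhs (0:R))) => s; apply: is_derive_eq.
by rewrite scaler0 add0r addr0 [LHS]mulr1.
Qed.

Lemma jet2_cst (c : R) : jet2 (fun=> c) 0 0.
Proof.
apply: (jet2_near_derive (cst c) _ _ (cst 0)) => //.
by apply: (@nearW _ (nbhs (0:R))) => s; exact: is_derive_cst.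
Qed.

Lemma jet2D f g a1 a2 b1 b2 : jet2 f a1 a2 -> jet2 g b1 b2 ->
  jet2 (fun s => f s + g s) (a1 + b1) (a2 + b2).
Proof.
move=> jf jg; have nf := jet2_is_derive _ _ _ jf; have ng := jet2_is_derive _ _ _ jg.
case: jf jg => _ [_ f1] f2 [_ [_ g1] g2].
refine (jet2_near_derive (f + g) _ _ ('D_1 f + 'D_1 g) _ _ (is_deriveD f2 g2)).
- near=> s.
  have fs : is_derive s (1:R) f ('D_1 f s) by near: s.
  have gs : is_derive s (1:R) g ('D_1 g s) by near: s.
  exact: is_deriveD.
- by rewrite -f1 -g1.
Unshelve. all: by end_near. Qed.

Lemma jet2M f g a1 a2 b1 b2 : jet2 f a1 a2 -> jet2 g b1 b2 ->
  jet2 (fun s => f s * g s) (f 0 * b1 + g 0 * a1)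
    (f 0 * b2 + 2 * (a1 * b1) + g 0 * a2).
Proof.
move=> jf jg; have nf := jet2_is_derive _ _ _ jf; have ng := jet2_is_derive _ _ _ jg.
case: jf jg => _ [f1 e1] f2 [_ [g1 k1] g2].
have h1 := derivableP f1; have h2 := derivableP g1.
have H3 : is_derive (0:R) (1:R) (f * 'D_1 g + g * 'D_1 f)
    (f 0 * b2 + 2 * (a1 * b1) + g 0 * a2).
  have := is_deriveD (is_deriveM h1 g2) (is_deriveM h2 f2).
  move/is_derive_eq; apply; rewrite e1 k1 /GRing.scale /=; ring.
refine (jet2_near_derive (f * g) _ _ _ _ _ H3).
- near=> s.
  have fs : is_derive s (1:R) f ('D_1 f s) by near: s.
  have gs : is_derive s (1:R) g ('D_1 g s) by near: s.
  exact: is_deriveM.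
- by rewrite -e1 -k1.
Unshelve. all: by end_near. Qed.

Lemma jet2Z f (k a1 a2 : R) : jet2 f a1 a2 ->
  jet2 (fun s => k * f s) (k * a1) (k * a2).
Proof.
move=> jf; apply: jet2_eq (jet2M _ _ _ _ _ _ (jet2_cst k) jf) _ _; ring.
Qed.

Lemma jet2N f a1 a2 : jet2 f a1 a2 -> jet2 (fun s => - f s) (- a1) (- a2).
Proof.
move=> jf; have := jet2Z _ (-1) _ _ jf; rewrite !mulN1r.
by under eq_fun do rewrite mulN1r.
Qed.

Lemma jet2B f g a1 a2 b1 b2 : jet2 f a1 a2 -> jet2 g b1 b2 ->
  jet2 (fun s => f s - g s) (a1 - b1) (a2 - b2).
Proof. by move=> jf /jet2N; exact: jet2D. Qed.

Lemma jet2_expR f a1 a2 : jet2 f a1 a2 ->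
  jet2 (fun s => expR (f s)) (expR (f 0) * a1) (expR (f 0) * (a2 + a1 ^+ 2)).
Proof.
move=> jf; have nf := jet2_is_derive _ _ _ jf.
case: jf => _ [f1 e1] f2.
have h1 := derivableP f1.
have he s : is_derive s (1:R) f ('D_1 f s) ->
    is_derive s (1:R) (expR \o f) (((expR \o f) * 'D_1 f) s).
  by move=> fs; have := is_derive1_comp (is_derive_expR (f s)) fs.
have H3 : is_derive (0:R) (1:R) ((expR \o f) * 'D_1 f)
    (expR (f 0) * (a2 + a1 ^+ 2)).
  have := is_deriveM (he _ h1) f2.
  by move/is_derive_eq; apply; rewrite -e1 /GRing.scale /= !fctE; ring.
refine (jet2_near_derive (expR \o f) _ _ _ _ _ H3).
- by near=> s; apply: he; near: s.
- by rewrite -e1.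
Unshelve. all: by end_near. Qed.

Lemma jet2_min f a1 a2 : jet2 f a1 a2 -> (\forall s \near (0:R), f 0 <= f s) ->
  a1 = 0 /\ 0 <= a2.
Proof.
move=> [df [f1 e1] [f2 e2]] fmin.
have /nbhs_ballP[e /= e0 He] : \forall s \near (0:R), derivable f s 1 /\ f 0 <= f s.
  exact: filterI.
have He' (s : R) : s \in `]-e, e[%R -> derivable f s 1 /\ f 0 <= f s.
  by rewrite in_itv /= => se; apply: He; rewrite /ball /= sub0r normrN ltr_norml.
have d0 : 'D_1 f 0 = 0.
  suff : is_derive (0:R) (1:R) f 0 by case.
  apply: (@derive1_at_min _ f (- e) e).
  - by lra.
  - by move=> t /He'[].
  - by rewrite in_itv /=; lra.
  - by move=> t /He'[].
split; first by rewrite -e1.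
rewrite leNgt -e2; apply/negP => neg.
have : \forall k \near (0:R)^', k^-1 *: (('D_1 f \o shift 0) (k *: (1:R)) - 'D_1 f 0) < 0.
  have fq : (fun k : R => k^-1 *: (('D_1 f \o shift 0) (k *: (1:R)) - 'D_1 f 0)) @ 0^'
       --> 'D_1 ('D_1 f) 0 by exact: f2.
  exact: (cvgr_lt _ fq).
rewrite /= near_withinE => /nbhs_ballP[d /= dgt Hd].
(* Since the derivative vanishes at 0, a negative second derivative makes it negative just to the
   right; the mean value theorem then gives a value below [f 0]. *)
have negD (s : R) : 0 < s < d -> 'D_1 f s < 0.
  move=> /andP[s0 sd]; have := Hd s; rewrite /ball /= sub0r normrN gtr0_norm // => /(_ sd).
  rewrite gt_eqF // => /(_ isT); rewrite addr0 [_ *: 1]mulr1 d0 subr0.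
  by rewrite [_ *: _]mulrC pmulr_llt0 // invr_gt0.
have [r [r0 re rd]] : exists r : R, [/\ 0 < r, r < e & r < d].
  have m0 : 0 < Num.min e d by rewrite lt_min e0.
  have me : Num.min e d <= e by rewrite ge_min lexx.
  have md : Num.min e d <= d by rewrite ge_min lexx orbT.
  by exists (Num.min e d / 2); split; move: m0 me md; lra.
have [| |c cin Hc] := @MVT R f ('D_1 f) 0 r r0.
- move=> x; rewrite in_itv /= => /andP[x0 xr]; apply/derivableP.
  by apply: (He' x _).1; rewrite in_itv /=; apply/andP; split; lra.
- apply: derivable_within_continuous => x; rewrite in_itv /= => /andP[x0 xr].
  by apply: (He' x _).1; rewrite in_itv /=; apply/andP; split; lra.
have [_ frge] := He' r ltac:(rewrite in_itv /=; lra).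
have cr : 0 < c < d by move: cin; rewrite in_itv /=; lra.
have := negD c cr.
have : 0 <= 'D_1 f c * (r - 0) by rewrite -Hc; lra.
by rewrite subr0 pmulr_lge0 //; lra.
Qed.

End DirectionalDerivatives.

(** * A gradient bound in a box *)

Section BoxGradient.
Context {R : realType}.

(** The contradiction at an interior minimum of the doubled function: the four second order
    conditions, weighted [c1], [c1], [c2], [c3], add up to at most [- 2 * k * (c2 + c3)]. The values
    of [c1 * Kc] and [c1 * N'] are the ones that produce this cancellation. *)
Lemma box_arith {c1 c2 c3 k Kc N' N X1 X2 Y1 Y2 Z1 Z2 : R} :
  0 <= c1 * (2 * (k - k * Kc - N') - (X1 - 0)) ->
  0 <= c1 * (2 * (k - k * Kc - N') - (0 - X2)) ->
  0 <= c2 * (2 * k - (Y1 - Y2)) -> 0 <= c3 * (2 * k - (Z1 - Z2)) ->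
  - (c1 * X1 + c2 * Y1 + c3 * Z1) <= N -> c1 * X2 + c2 * Y2 + c3 * Z2 <= N ->
  c1 * Kc = c1 + c2 + c3 -> c1 * N' = N / 2 -> 0 < k -> 0 <= c2 -> 0 < c3 -> False.
Proof.
move=> h1 h2 h3 h4 L1 L2 cK cN k0 c20 c30.
have kk : k * (c1 * Kc) = k * c1 + k * c2 + k * c3 by rewrite cK; ring.
have kc2 : 0 <= k * c2 by rewrite mulr_ge0 // ltW.
have kc3 : 0 < k * c3 by rewrite mulr_gt0.
lra.
Qed.

Lemma continuous_pair {T U V : topologicalType} (f : T -> U) (g : T -> V) :
  continuous f -> continuous g -> continuous (fun x => (f x, g x)).
Proof. by move=> cf cg x; exact: cvg_pair (cf x) (cg x). Qed.

Lemma within_comp {T U : topologicalType} (K : set T) (Q : set U) (A : T -> U)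
    (G : U -> R) :
  {within Q, continuous G} -> continuous A -> (forall p, K p -> Q (A p)) ->
  {within K, continuous (G \o A)}.
Proof.
move=> /subspace_continuousP Gc Ac KQ; apply/subspace_continuousP => p Kp.
apply: (@cvg_comp _ _ _ A G _ (within Q (nbhs (A p)))); last exact/Gc/KQ.
move=> B HB; have H : nbhs p (A @^-1` [set y | Q y -> B y]) by exact: Ac.
by apply: filterS H => x /= Hx Kx; apply: Hx; exact: KQ.
Qed.

(** Excludes a minimum on a Neumann face. Only the limit of the derivative at the face is known, so
    the mean value theorem takes the place of a first order condition at the endpoint. *)
Lemma neumann_not_min (f df : R -> R) (l tau k : R) : 0 < tau ->
  {within `[l, l + tau], continuous f} ->
  (forall s, l < s < l + tau -> is_derive s (1:R) f (df s)) ->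
  df s @[s --> l^'+] --> k -> k < 0 -> exists2 s, l < s < l + tau & f s < f l.
Proof.
move=> tau0 fc fdf dfk k0.
have : \forall s \near l^'+, df s < 0 by exact: (cvgr_lt _ dfk).
rewrite near_withinE => /nbhs_ballP[e /= e0 He].
have [r [r0 re rd]] : exists r : R, [/\ 0 < r, r < e & r < tau].
  have m0 : 0 < Num.min e tau by rewrite lt_min e0.
  have me : Num.min e tau <= e by rewrite ge_min lexx.
  have md : Num.min e tau <= tau by rewrite ge_min lexx orbT.
  by exists (Num.min e tau / 2); split; move: m0 me md; lra.
have lr : l < l + r by lra.
have [| |c] := @MVT R f df l (l + r) lr.
- by move=> x; rewrite in_itv /= => /andP[? ?]; apply: fdf; lra.
- apply: continuous_subspaceW fc; apply: subset_itvl.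
  by rewrite bnd_simp; lra.
rewrite in_itv /= => /andP[lc cr] Hc.
exists (l + r); first by lra.
have dc : df c < 0.
  by apply: He => //; rewrite /ball /= distrC gtr0_norm; lra.
have : df c * (l + r - l) < 0 by rewrite pmulr_llt0 //; lra.
by rewrite -Hc; lra.
Qed.

Lemma jet2_quad (f : R -> R) (A B C : R) :
  (forall t, f t = A * t ^+ 2 + B * t + C) -> jet2 f B (2 * A).
Proof.
move=> fE; have -> : f = fun t => (A * ((t * 1 + 0) * (t * 1 + 0)) + (t * B + C)).
  by apply/funext => t; rewrite fE; ring.
have j := jet2_affine (0:R) 1.
by apply: jet2_eq (jet2D _ _ _ _ _ _ (jet2Z _ A _ _ (jet2M _ _ _ _ _ _ j j))
  (jet2_affine C B)) _ _; ring.
Qed.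

Lemma is_derive_quad (f : R -> R) (A B C s : R) :
  (forall t, f t = A * t ^+ 2 + B * t + C) -> is_derive s (1:R) f (2 * A * s + B).
Proof.
move=> fE; have -> : f = (cst A * (id * id) + cst B * id) + cst C.
  by apply/funext => t; rewrite fE !fctE /=; ring.
have i := is_derive_id s (1:R).
have h := is_deriveD (is_deriveD (is_deriveM (is_derive_cst A s (1:R)) (is_deriveM i i))
  (is_deriveM (is_derive_cst B s (1:R)) i)) (is_derive_cst C s (1:R)).
by apply: (is_derive_eq h); rewrite /GRing.scale /= /cst; ring.
Qed.

Lemma is_derive_along {V : normedModType R} (F : V -> R) (A : R -> V) (v : V) (y : R) :
  (forall k y, A (k + y) = k *: v + A y) -> derivable F (A y) v ->
  is_derive y (1:R) (fun y => F (A y)) ('D_v F (A y)).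
Proof.
move=> AD dF; have H (k : R) : A (k *: (1:R) + y) = k *: v + A y.
  by rewrite AD [k *: 1]mulr1.
by split; [exact: derivable_affine H dF|exact: derive_affine H].
Qed.

Lemma near0_norm (e : R) : 0 < e -> \forall t \near (0:R), `|t| < e.
Proof.
move=> e0; apply/nbhs_ballP; exists e => // t.
by rewrite /ball /= sub0r normrN.
Qed.

Lemma line_ux (t x y : R) : t *: ux + (x, y) = (t + x, y).
Proof. by rewrite /ux; congr (_, _); rewrite /= ?[_ *: _]mulr0 ?[_ *: _]mulr1 ?add0r. Qed.

Lemma line_uy (t x y : R) : t *: uy + (x, y) = (x, t + y).
Proof. by rewrite /uy; congr (_, _); rewrite /= ?[_ *: _]mulr0 ?[_ *: _]mulr1 ?add0r. Qed.

Lemma line_sx (t s u v : R) : t *: sx + ((s, u), v) = ((t + s, u), v).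
Proof.
rewrite /sx /ux; congr (_, _); last by rewrite /= [_ *: _]mulr0 add0r.
by congr (_, _); rewrite /= ?[_ *: _]mulr0 ?[_ *: _]mulr1 ?add0r.
Qed.

Lemma line_sy (t s u v : R) : t *: sy + ((s, u), v) = ((s, t + u), v).
Proof.
rewrite /sy /uy; congr (_, _); last by rewrite /= [_ *: _]mulr0 add0r.
by congr (_, _); rewrite /= ?[_ *: _]mulr0 ?[_ *: _]mulr1 ?add0r.
Qed.

Lemma line_sz (t s u v : R) : t *: sz + ((s, u), v) = ((s, u), t + v).
Proof.
rewrite /sz; congr (_, _); last by rewrite /= [_ *: _]mulr1.
by congr (_, _); rewrite /= ?[_ *: _]mulr0 ?[_ *: _]mulr1 ?add0r.
Qed.

Variables (G : space3 R -> R) (c1 c2 c3 m N a s0 u0 v0 l1 l3 : R).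
(** The lower ends [l1] and [l3] are free because the bottom of the strip may cut the box. After
    permutation the vertical coordinate is the third one for horizontal slopes and the first one for
    the vertical slope; the second coordinate is always horizontal. *)
Let Q : set (space3 R) :=
  [set q | [/\ l1 <= q.1.1 <= s0 + a, u0 - a <= q.1.2 <= u0 + a &
               l3 <= q.2 <= v0 + a]].
Let I : set (space3 R) :=
  [set q | [/\ l1 < q.1.1 < s0 + a, u0 - a < q.1.2 < u0 + a &
               l3 < q.2 < v0 + a]].
Hypothesis a0 : 0 < a.
Hypothesis c10 : 0 < c1.
Hypothesis c20 : 0 <= c2.
Hypothesis c30 : 0 < c3.
Hypothesis m0 : 0 < m.
Hypothesis N0 : 0 <= N.
Hypothesis l1P : s0 - a <= l1 < s0.
Hypothesis l3P : v0 - a <= l3 < v0.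
Hypothesis Gc : {within Q, continuous G}.
Hypothesis Gd : forall q, I q -> forall v, v \in [:: sx; sy; sz] ->
  derivable G q v /\ derivable ('D_v G) q v.
Hypothesis GL : forall q, I q ->
  `|c1 * 'D_sx ('D_sx G) q + c2 * 'D_sy ('D_sy G) q + c3 * 'D_sz ('D_sz G) q| <= N.
Hypothesis Gm : forall q, Q q -> `|G q| <= m.
(* A face of the box lies at distance [a] from the centre or carries a
   homogeneous Neumann condition. *)
Hypothesis neumann1 : l1 = s0 - a \/ (l3 = v0 - a /\
  forall u v, u0 - a < u < u0 + a -> l3 < v < v0 + a ->
    'D_sx G ((r, u), v) @[r --> l1^'+] --> (0:R)).
Hypothesis neumann3 : l3 = v0 - a \/ (l1 = s0 - a /\
  forall s u, l1 < s < s0 + a -> u0 - a < u < u0 + a ->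
    'D_sz G ((s, u), r) @[r --> l3^'+] --> (0:R)).

Let Kc := 1 + (c2 + c3) / c1.
Let k := 2 * m / a ^+ 2.
Let N' := N / (2 * c1).
(* [S] vanishes at the centre [s = r = s0], [u = u0], [v = v0] with slope
   [4 a (k Kc + N')] in [s], is nonnegative for [r = s] and dominates [2 m] on the
   outer faces.  The terms concave in [s - r] make it a supersolution of the
   doubled operator, hence [G (s, u, v) - G (r, u, v) <= S]; comparing slopes at
   the centre bounds ['D_sx G]. *)
Let S (s u v r : R) :=
  k * ((s - s0) ^+ 2 + (u - u0) ^+ 2 + (v - v0) ^+ 2 + (r - s0) ^+ 2
       + Kc * ((s - r) * (4 * a - (s - r))))
  + N' * ((s - r) * (4 * a - (s - r))).
Let W (s u v r : R) := S s u v r - (G ((s, u), v) - G ((r, u), v)).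

Let k0 : 0 < k. Proof. by rewrite /k divr_gt0 ?mulr_gt0 ?exprn_gt0. Qed.
Let Kc1 : 1 <= Kc.
Proof. by rewrite /Kc lerDl divr_ge0 // ?addr_ge0 // ltW. Qed.
Let N'0 : 0 <= N'. Proof. by rewrite /N' divr_ge0 // mulr_ge0 // ltW. Qed.
Let cK : c1 * Kc = c1 + c2 + c3.
Proof. by rewrite /Kc mulrDr mulr1 mulrCA divff ?mulr1 ?addrA // gt_eqF. Qed.
Let cN : c1 * N' = N / 2.
Proof. by rewrite /N'; field; rewrite gt_eqF. Qed.
Let ka : k * a ^+ 2 = 2 * m.
Proof. by rewrite /k divfK // gt_eqF // exprn_gt0. Qed.

Let near_box (p : space3 R) : I p -> \forall q \near p, I q.
Proof.
move=> [/andP[h1 h2] /andP[h3 h4] /andP[h5 h6]].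
have f1 : (fun q : space3 R => q.1.1) @ p --> p.1.1.
  by apply: (@cvg_comp _ _ _ fst fst); [exact: cvg_fst|exact: cvg_fst].
have f2 : (fun q : space3 R => q.1.2) @ p --> p.1.2.
  by apply: (@cvg_comp _ _ _ fst snd); [exact: cvg_fst|exact: cvg_snd].
have f3 : (fun q : space3 R => q.2) @ p --> p.2 by exact: cvg_snd.
have g1 := cvgr_gt _ f1 _ h1; have g2 := cvgr_lt _ f1 _ h2.
have g3 := cvgr_gt _ f2 _ h3; have g4 := cvgr_lt _ f2 _ h4.
have g5 := cvgr_gt _ f3 _ h5; have g6 := cvgr_lt _ f3 _ h6.
near=> q; split; apply/andP; split; near: q;
  [exact: g1|exact: g2|exact: g3|exact: g4|exact: g5|exact: g6].
Unshelve. all: by end_near. Qed.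

Let jetG (p : space3 R) v : I p -> v \in [:: sx; sy; sz] ->
  jet2 (fun t => G (t *: v + p)) ('D_v G p) ('D_v ('D_v G) p).
Proof.
move=> Ip vin; apply: jet2_line; last by have [] := Gd p Ip v vin.
by apply: filterS (near_box p Ip) => q Iq; have [] := Gd q Iq v vin.
Qed.

(** The half [r <= s] suffices, since on the diagonal the difference of the values of [G] vanishes
    and [S] is nonnegative. *)
Let K : set (space3 R * R) := [set p | Q p.1 /\ l1 <= p.2 <= p.1.1.1].

Let compactK : compact K.
Proof.
pose B := (((`[l1, s0 + a]%classic `*` `[u0 - a, u0 + a]%classic)
   `*` `[l3, v0 + a]%classic) `*` `[l1, s0 + a]%classic).
have cB : compact B.
  by do ![apply: compact_setX]; exact: segment_compact.
have -> : K = B `&` [set p | 0 <= p.1.1.1 - p.2].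
  apply/seteqP; split => -[[[s u] v] r]; rewrite /K /B /Q /= !in_itv /=.
    move=> [[/andP[-> s1] -> ->] /andP[-> rs]].
    by rewrite subr_ge0 rs s1 (le_trans rs s1).
  by move=> [[[[-> ->] ->] /andP[-> _]]]; rewrite subr_ge0.
apply: compact_closedI => //.
apply: (@closed_comp _ _ (fun p : space3 R * R => p.1.1.1 - p.2) [set x | 0 <= x]).
  move=> p _; apply: cvgB; last exact: cvg_snd.
  apply: (@cvg_comp _ _ _ fst (fun q : space3 R => q.1.1)); first exact: cvg_fst.
  by apply: (@cvg_comp _ _ _ fst fst); [exact: cvg_fst|exact: cvg_fst].
exact: closed_ge.
Qed.

Let WK (p : space3 R * R) := W p.1.1.1 p.1.1.2 p.1.2 p.2.

Let contWK : {within K, continuous WK}.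
Proof.
have cs : continuous (fun p : space3 R * R => p.1.1.1).
  move=> p; apply: (@cvg_comp _ _ _ fst (fun q : space3 R => q.1.1)); first exact: cvg_fst.
  by apply: (@cvg_comp _ _ _ fst fst); exact: cvg_fst.
have cu : continuous (fun p : space3 R * R => p.1.1.2).
  move=> p; apply: (@cvg_comp _ _ _ fst (fun q : space3 R => q.1.2)); first exact: cvg_fst.
  by apply: (@cvg_comp _ _ _ fst snd); [exact: cvg_fst|exact: cvg_snd].
have cv : continuous (fun p : space3 R * R => p.1.2).
  by move=> p; apply: (@cvg_comp _ _ _ fst snd); [exact: cvg_fst|exact: cvg_snd].
have cr : continuous (fun p : space3 R * R => p.2) by move=> p; exact: cvg_snd.
have c0 (c : R) p : (fun=> c) @ nbhs (p : space3 R * R) --> c by exact: cvg_cst.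
have sq (f : space3 R * R -> R) (c : R) p : continuous f ->
    (fun x => (f x - c) ^+ 2) @ nbhs p --> (f p - c) ^+ 2.
  by move=> cf; rewrite expr2; apply: cvgM; apply: cvgB => //; exact: cf.
have cW1 : continuous (fun p : space3 R * R => S p.1.1.1 p.1.1.2 p.1.2 p.2).
  move=> p; rewrite /S.
  have cd : (fun x : space3 R * R => (x.1.1.1 - x.2) * (4 * a - (x.1.1.1 - x.2))) @ nbhs p
     --> (p.1.1.1 - p.2) * (4 * a - (p.1.1.1 - p.2)).
    apply: cvgM; first by apply: cvgB; [exact: cs|exact: cr].
    by apply: cvgB; [exact: c0|apply: cvgB; [exact: cs|exact: cr]].
  apply: cvgD; last by apply: cvgM; [exact: c0|exact: cd].
  apply: cvgM; first exact: c0.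
  apply: cvgD; last by apply: cvgM; [exact: c0|exact: cd].
  by apply: cvgD; [apply: cvgD; [apply: cvgD|]|]; exact: sq.
have cG1 : {within K, continuous (G \o fst)}.
  apply: (@within_comp _ _ K Q fst G Gc); first by move=> p; exact: cvg_fst.
  by move=> p [].
have cG2 : {within K, continuous (G \o (fun p : space3 R * R => ((p.2, p.1.1.2), p.1.2)))}.
  apply: (@within_comp _ _ K Q (fun p : space3 R * R => ((p.2, p.1.1.2), p.1.2)) G Gc).
    exact: (continuous_pair _ _ (continuous_pair _ _ cr cu) cv).
  move=> [[[s u] v] r] [[/= /andP[h1 h2] h3 h4] /andP[h5 h6]]; split=> //=.
  by rewrite h5 (le_trans h6 h2).
have -> : WK = (fun p : space3 R * R => S p.1.1.1 p.1.1.2 p.1.2 p.2 -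
    ((G \o fst) p - (G \o (fun p : space3 R * R => ((p.2, p.1.1.2), p.1.2))) p)).
  by apply/funext => -[[[s u] v] r].
move=> p; apply: cvgB; first exact: (continuous_subspaceT cW1).
by apply: cvgB; [exact: cG1|exact: cG2].
Qed.

Let W_ge0 p : K p -> 0 <= WK p.
Proof.
move=> Kp; rewrite leNgt; apply/negP => Wp0.
have [[[[s u] v] r] /set_mem [Qp /andP[lr rs]] Wmin] :=
  compact_EVT_min (ex_intro _ p Kp) compactK contWK.
have Wmin' s' u' v' r' : K (((s', u'), v'), r') -> W s u v r <= W s' u' v' r'.
  by move=> /mem_set /Wmin.
have W0 : W s u v r < 0.
  by apply: le_lt_trans Wp0; apply: Wmin; exact: mem_set.
move: Wmin' W0 Qp lr rs => {Wmin} /= Wmin W0 [/= /andP[ls sa] /andP[lu ua] /andP[lv va]] lr rs.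
have sr : s0 - a <= r by case/andP: l1P => h _; exact: le_trans h lr.
have G1 : `|G ((s, u), v)| <= m by apply: Gm; split; rewrite /= ?ls ?lu ?lv.
have G2 : `|G ((r, u), v)| <= m.
  by apply: Gm; split; rewrite /= ?lr ?lu ?lv ?(le_trans rs sa).
have Psi : G ((s, u), v) - G ((r, u), v) <= 2 * m.
  by move: G1 G2; rewrite !ler_norml; lra.
have d0 : 0 <= (s - r) * (4 * a - (s - r)) by apply: mulr_ge0; lra.
(* Were the sum of squares at least [a ^+ 2], the quadratic part of [S] alone would be at least
   [k * a ^+ 2 = 2 * m]. So a negative minimum lies strictly inside every face at distance [a] from
   the centre. *)
have sum_lt : (s - s0) ^+ 2 + (u - u0) ^+ 2 + (v - v0) ^+ 2 + (r - s0) ^+ 2 < a ^+ 2.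
  rewrite ltNge; apply/negP => ge; move: W0; rewrite ltNge => /negP; apply.
  rewrite /W subr_ge0 (le_trans Psi) // -ka /S -[leLHS]addr0.
  apply: lerD; last exact: mulr_ge0.
  rewrite ler_pM2l // -[leLHS]addr0; apply: lerD => //.
  by rewrite mulr_ge0 // (le_trans _ Kc1).
have strict (x y : R) : (x - y) ^+ 2 < a ^+ 2 -> y - a < x < y + a.
  move=> h; have : `|x - y| < a.
    by rewrite -(@ltr_pXn2r _ 2) ?nnegrE // ?ltW // -normrX ger0_norm ?sqr_ge0.
  by rewrite ltr_norml; lra.
have [q1 q2 q3 q4] : [/\ 0 <= (s - s0) ^+ 2, 0 <= (u - u0) ^+ 2,
   0 <= (v - v0) ^+ 2 & 0 <= (r - s0) ^+ 2] by split; exact: sqr_ge0.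
have /strict/andP[_ sa'] : (s - s0) ^+ 2 < a ^+ 2 by lra.
have /strict/andP[lu' ua'] : (u - u0) ^+ 2 < a ^+ 2 by lra.
have /strict/andP[lv' va'] : (v - v0) ^+ 2 < a ^+ 2 by lra.
have /strict/andP[sr' _] : (r - s0) ^+ 2 < a ^+ 2 by lra.
have rs' : r < s.
  rewrite lt_neqAle rs andbT; apply/eqP => req; move: W0.
  rewrite /W req subrr subr0 ltNge => /negP; apply; rewrite /S !subrr mul0r !mulr0 !addr0.
  by apply: mulr_ge0; [exact: ltW|lra].
case/andP: l1P => l1a l1s; case/andP: l3P => l3a l3v.
(* On the third Neumann face the slope of [W] is that of [S], namely [2 * k * (l3 - v0)], which is
   negative. *)
have [vl3|lv3] := eqVneq v l3.
  case: neumann3 => [e|[e neu]]; first by move: lv'; rewrite vl3 e ltxx.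
  have Ir (x y : R) : s0 - a < x < s0 + a -> l3 < y < v0 + a -> I ((x, u), y).
    by move=> hx hy; split; rewrite /= ?e ?hx ?hy ?lu' ?ua'.
  have hs : s0 - a < s < s0 + a by lra.
  have hr : s0 - a < r < s0 + a by lra.
  have h : exists2 y, l3 < y < l3 + (v0 + a - l3) & W s u y r < W s u l3 r.
    apply: (@neumann_not_min (fun y => W s u y r)
      (fun y => (2 * k * y + k * (- 2 * v0)) - ('D_sz G ((s, u), y) - 'D_sz G ((r, u), y)))
      l3 (v0 + a - l3) ((2 * k * l3 + k * (- 2 * v0)) - (0 - 0))).
    - lra.
    - have := @within_comp _ _ `[l3, l3 + (v0 + a - l3)]%classic K
        (fun y => (((s, u), y), r)) WK contWK.
      apply.
        exact: (continuous_pair _ _ (continuous_pair _ _ (@cst_continuous _ _ (s, u))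
          (fun y => @cvg_id _ (nbhs y))) (@cst_continuous _ _ r)).
      move=> y /=; rewrite in_itv /= => /andP[y1 y2]; split=> /=; last by rewrite lr rs.
      by split; rewrite /= ?ls ?sa ?lu ?ua //; move: y1 y2; lra.
    - move=> y /andP[y1 y2]; have y3 : l3 < y < v0 + a by lra.
      apply: is_deriveB; last apply: is_deriveB.
      + apply: (@is_derive_quad _ _ _ (S s u 0 r)) => t; rewrite /S; ring.
      + have [dG _] := Gd _ (Ir _ _ hs y3) sz ltac:(by rewrite !inE eqxx !orbT).
        apply: (is_derive_along G (fun y => ((s, u), y)) sz y) => // kk yy.
        by rewrite line_sz.
      + have [dG _] := Gd _ (Ir _ _ hr y3) sz ltac:(by rewrite !inE eqxx !orbT).
        apply: (is_derive_along G (fun y => ((r, u), y)) sz y) => // kk yy.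
        by rewrite line_sz.
    - apply: cvgB; last by apply: cvgB; apply: neu; rewrite ?e // lu' ua'.
      apply: cvg_at_right_filter; apply: cvgD; last exact: cvg_cst.
      by apply: cvgM; [exact: cvg_cst|exact: cvg_id].
    - have h1 : 0 < k * (v0 - l3) by rewrite mulr_gt0 // subr_gt0.
      move: h1; lra.
  case: h => y y1; rewrite -vl3 ltNge => /negP; apply; apply: Wmin.
  by split; rewrite /= ?lr ?rs //; split; rewrite /= ?ls ?sa ?lu ?ua //; lra.
have {lv3} l3v' : l3 < v by rewrite lt_neqAle eq_sym lv3.
have hv : l3 < v < v0 + a by lra.
have hu : u0 - a < u < u0 + a by lra.
(* On the first Neumann face only [r] can lie, because [r < s]. The slope of [S] in [r] is negative
   there: [l1 < s0], and [s - r <= 2 * a] keeps the concave part decreasing in [r]. *)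
have [rl1|lr1] := eqVneq r l1.
  case: neumann1 => [e|[e neu]]; first by move: sr'; rewrite rl1 e ltxx.
  have Ir (x : R) : l1 < x < s0 + a -> I ((x, u), v) by move=> hx; split.
  have h : exists2 y, l1 < y < l1 + (s - l1) & W s u v y < W s u v l1.
    apply: (@neumann_not_min (fun y => W s u v y)
      (fun y => (2 * (k - k * Kc - N') * y + (k * (- 2 * s0) + (k * Kc + N') * (2 * s - 4 * a)))
         - (0 - 'D_sx G ((y, u), v)))
      l1 (s - l1) ((2 * (k - k * Kc - N') * l1 +
         (k * (- 2 * s0) + (k * Kc + N') * (2 * s - 4 * a))) - (0 - 0))).
    - lra.
    - have := @within_comp _ _ `[l1, l1 + (s - l1)]%classic K
        (fun y => (((s, u), v), y)) WK contWK.
      apply.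
        exact: (continuous_pair _ _ (@cst_continuous _ _ ((s, u), v))
          (fun y => @cvg_id _ (nbhs y))).
      move=> y /=; rewrite in_itv /= => /andP[y1 y2]; split=> /=; last first.
        by rewrite y1 /=; lra.
      by split => /=; rewrite ?ls ?lu ?lv.
    - move=> y /andP[y1 y2]; have y3 : l1 < y < s0 + a by lra.
      apply: is_deriveB; last apply: is_deriveB.
      + by apply: (@is_derive_quad _ _ _ (S s u v 0)) => t; rewrite /S; ring.
      + have [dG _] := Gd _ (Ir _ y3) sx ltac:(by rewrite !inE eqxx).
        apply: (is_derive_along G (fun y => ((y, u), v)) sx y) => // kk yy.
        by rewrite line_sx.
    - apply: cvgB; last by apply: cvgB; [exact: cvg_cst|exact: neu].
      apply: cvg_at_right_filter; apply: cvgD; last exact: cvg_cst.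
      by apply: cvgM; [exact: cvg_cst|exact: cvg_id].
    - have h1 : 0 < k * (s0 - l1) by rewrite mulr_gt0 // subr_gt0.
      have h2 : 0 <= (k * Kc + N') * (4 * a - 2 * (s - l1)).
        apply: mulr_ge0; last by lra.
        by rewrite addr_ge0 // mulr_ge0 ?ltW // (lt_le_trans _ Kc1).
      move: h1 h2; lra.
  case: h => y y1; rewrite -rl1 ltNge => /negP; apply; apply: Wmin.
  by split=> /=; [split => /=; rewrite ?ls ?lu ?lv|lra].
have {lr1} l1r : l1 < r by rewrite lt_neqAle eq_sym lr1.
have Iq : I ((s, u), v) by split => //=; lra.
have Ir : I ((r, u), v) by split => //=; lra.
have nr g : 0 < g -> \forall t \near (0:R), - g < t < g.
  by move=> /near0_norm; apply: filterS => t; rewrite ltr_norml.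
have js : jet2 (fun t => W (t + s) u v r)
    ((2 * k * (s - s0) + (k * Kc + N') * (4 * a - 2 * (s - r))) - ('D_sx G ((s, u), v) - 0))
    (2 * (k - k * Kc - N') - ('D_sx ('D_sx G) ((s, u), v) - 0)).
  apply: jet2B; first by apply: (jet2_quad _ _ _ (S s u v r)) => t; rewrite /S; ring.
  apply: jet2B; last exact: jet2_cst.
  have := jetG _ sx Iq ltac:(by rewrite !inE eqxx).
  by under eq_fun do rewrite line_sx.
have jr : jet2 (fun t => W s u v (t + r))
    ((2 * k * (r - s0) - (k * Kc + N') * (4 * a - 2 * (s - r))) - (0 - 'D_sx G ((r, u), v)))
    (2 * (k - k * Kc - N') - (0 - 'D_sx ('D_sx G) ((r, u), v))).
  apply: jet2B; first by apply: (jet2_quad _ _ _ (S s u v r)) => t; rewrite /S; ring.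
  apply: jet2B; first exact: jet2_cst.
  have := jetG _ sx Ir ltac:(by rewrite !inE eqxx).
  by under eq_fun do rewrite line_sx.
have ju : jet2 (fun t => W s (t + u) v r)
    ((2 * k * (u - u0)) - ('D_sy G ((s, u), v) - 'D_sy G ((r, u), v)))
    (2 * k - ('D_sy ('D_sy G) ((s, u), v) - 'D_sy ('D_sy G) ((r, u), v))).
  apply: jet2B; first by apply: (jet2_quad _ _ _ (S s u v r)) => t; rewrite /S; ring.
  apply: jet2B.
    have := jetG _ sy Iq ltac:(by rewrite !inE eqxx !orbT).
    by under eq_fun do rewrite line_sy.
  have := jetG _ sy Ir ltac:(by rewrite !inE eqxx !orbT).
  by under eq_fun do rewrite line_sy.
have jv : jet2 (fun t => W s u (t + v) r)
    ((2 * k * (v - v0)) - ('D_sz G ((s, u), v) - 'D_sz G ((r, u), v)))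
    (2 * k - ('D_sz ('D_sz G) ((s, u), v) - 'D_sz ('D_sz G) ((r, u), v))).
  apply: jet2B; first by apply: (jet2_quad _ _ _ (S s u v r)) => t; rewrite /S; ring.
  apply: jet2B.
    have := jetG _ sz Iq ltac:(by rewrite !inE eqxx !orbT).
    by under eq_fun do rewrite line_sz.
  have := jetG _ sz Ir ltac:(by rewrite !inE eqxx !orbT).
  by under eq_fun do rewrite line_sz.
have ms : \forall t \near (0:R), W (0 + s) u v r <= W (t + s) u v r.
  rewrite add0r; near=> t.
  have t1 : - (s0 + a - s) < t < s0 + a - s by near: t; apply: nr; rewrite subr_gt0.
  have t2 : - (s - r) < t < s - r by near: t; apply: nr; rewrite subr_gt0.
  apply: Wmin; split=> /=; first (split=> /=; rewrite ?lu ?lv //).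
    by move: t1 t2 l1r; lra.
  by rewrite lr /=; move: t2; lra.
have mr : \forall t \near (0:R), W s u v (0 + r) <= W s u v (t + r).
  rewrite add0r; near=> t.
  have t1 : - (r - l1) < t < r - l1 by near: t; apply: nr; rewrite subr_gt0.
  have t2 : - (s - r) < t < s - r by near: t; apply: nr; rewrite subr_gt0.
  apply: Wmin; split=> /=; first (split=> /=; rewrite ?ls ?lu ?lv //).
  by move: t1 t2; lra.
have mu : \forall t \near (0:R), W s (0 + u) v r <= W s (t + u) v r.
  rewrite add0r; near=> t.
  have t1 : - (u - (u0 - a)) < t < u - (u0 - a) by near: t; apply: nr; rewrite subr_gt0.
  have t2 : - (u0 + a - u) < t < u0 + a - u by near: t; apply: nr; rewrite subr_gt0.
  apply: Wmin; split=> /=; last by rewrite lr.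
  split=> /=; rewrite ?ls ?lv //.
  by move: t1 t2; lra.
have mv : \forall t \near (0:R), W s u (0 + v) r <= W s u (t + v) r.
  rewrite add0r; near=> t.
  have t1 : - (v - l3) < t < v - l3 by near: t; apply: nr; rewrite subr_gt0.
  have t2 : - (v0 + a - v) < t < v0 + a - v by near: t; apply: nr; rewrite subr_gt0.
  apply: Wmin; split=> /=; last by rewrite lr.
  split=> /=; rewrite ?ls ?lu //.
  by move: t1 t2; lra.
have [_ /(mulr_ge0 (ltW c10)) as_] := jet2_min _ _ _ js ms.
have [_ /(mulr_ge0 (ltW c10)) ar_] := jet2_min _ _ _ jr mr.
have [_ /(mulr_ge0 c20) au_] := jet2_min _ _ _ ju mu.
have [_ /(mulr_ge0 (ltW c30)) av_] := jet2_min _ _ _ jv mv.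
have /ler_normlP[L1 _] := GL _ Iq; have /ler_normlP[_ L2] := GL _ Ir.
exact: (box_arith as_ ar_ au_ av_ L1 L2 cK cN k0 c20 c30).
Unshelve. all: by end_near. Qed.

Lemma box_derive_le : 'D_sx G ((s0, u0), v0) <= 8 * m * (1 + (c2 + c3) / c1) / a + 2 * a * N / c1.
Proof.
case/andP: l1P => l1a l1s; case/andP: l3P => l3a l3v.
have I0 : I ((s0, u0), v0) by split => /=; move: a0 l1s l3v; lra.
have [dG _] := Gd _ I0 sx ltac:(by rewrite !inE eqxx).
have dG1 : derivable (fun y => G ((y, u0), v0)) s0 1.
  suff : is_derive s0 (1:R) (fun y => G ((y, u0), v0)) ('D_sx G ((s0, u0), v0)) by case.
  by apply: (is_derive_along G (fun y => ((y, u0), v0)) sx s0) => // kk yy; rewrite line_sx.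
have -> : 'D_sx G ((s0, u0), v0) = 'D_1 (fun y => G ((y, u0), v0)) s0.
  suff : is_derive s0 (1:R) (fun y => G ((y, u0), v0)) ('D_sx G ((s0, u0), v0)) by case.
  by apply: (is_derive_along G (fun y => ((y, u0), v0)) sx s0) => // kk yy; rewrite line_sx.
have q1 : (fun t : R => t^-1 *: (G ((t *: (1:R) + s0, u0), v0) - G ((s0, u0), v0))) @ 0^'+
    --> 'D_1 (fun y => G ((y, u0), v0)) s0.
  exact: (cvg_dnbhs_at_right dG1).
(* The left side is [S (t + s0) u0 v0 s0] divided by [t]. *)
have q2 : (fun t : R => t * (k * (1 - Kc) - N') + (k * Kc + N') * (4 * a)) @ (0:R)^'+
    --> 0 * (k * (1 - Kc) - N') + (k * Kc + N') * (4 * a).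
  apply: cvg_at_right_filter; apply: cvgD; last exact: cvg_cst.
  by apply: cvgM; [exact: cvg_id|exact: cvg_cst].
have -> : 8 * m * (1 + (c2 + c3) / c1) / a + 2 * a * N / c1
    = 0 * (k * (1 - Kc) - N') + (k * Kc + N') * (4 * a).
  rewrite /k /Kc /N'; field.
  by rewrite !gt_eqF.
apply: (ler_cvg_to q1 q2).
near=> t.
have t0 : 0 < t by near: t; exact: nbhs_right_gt.
have ta : t < a by near: t; exact: nbhs_right_lt.
have := W_ge0 ((((t + s0, u0), v0), s0)); rewrite /WK /W /S /= [t *: 1]mulr1 => h.
have : K (((t + s0, u0), v0), s0).
  by split; [split => /=; move: l1s l3v a0 t0 ta; lra|move=> /=; move: l1s t0; lra].
move=> /h; rewrite [_ *: _]mulrC ler_pdivrMr //; lra.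
Unshelve. all: by end_near. Qed.

End BoxGradient.

(** * A gradient bound in the strip *)

Section Strip.
Opaque derive derivable sx sy sz ux uy.
Context {R : realType}.
Implicit Types (h : plane R -> R) (G : space3 R -> R).

Definition strip h : set (space3 R) := [set q | 0 <= q.2 <= h q.1].
Definition inside h (q : space3 R) := 0 < q.2 < h q.1.

(** The bound in [ss_bounded] enters no estimate: its finiteness alone confines the comparison with
    the barrier to a bounded part of the strip. The bottom condition is a one-sided limit, as [G]
    need not be differentiable on the boundary. *)
Record strip_solution (b N : R) h G : Prop := {
  ss_cont : {within strip h, continuous G} ;
  ss_derivable : forall q, inside h q -> forall v, v \in [:: sx; sy; sz] ->
    derivable G q v /\ derivable ('D_v G) q v ;
  ss_lap : forall q, inside h q ->
    `|b * ('D_sx ('D_sx G) q + 'D_sy ('D_sy G) q) + 'D_sz ('D_sz G) q| <= N ;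
  ss_top : forall X, G (X, h X) = 0 ;
  ss_bottom : forall X, 'D_sz G (X, r) @[r --> (0:R)^'+] --> (0:R) ;
  ss_bounded : exists B, forall q, strip h q -> `|G q| <= B }.

(** [C0] controls the horizontal second derivatives of the barrier, [Hm] its smallest exponential,
    and [Lp] the size of a box that fits under the surface. *)
Record tame_depth (b C0 Hm Lp : R) h : Prop := {
  td_pos : forall X, 0 < h X <= Hm ;
  td_lip : forall X Y, `|h X - h Y| <= Lp * (`|X.1 - Y.1| + `|X.2 - Y.2|) ;
  td_Lp : 0 <= Lp ;
  td_derivable : forall X v, v \in [:: ux; uy] ->
    derivable h X v /\ derivable ('D_v h) X v ;
  td_lap : forall X, `|b * lap h X| <= C0 }.

Lemma cont_s : continuous (fun q : space3 R => q.1.1).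
Proof. by move=> p; apply: (@cvg_comp _ _ _ fst fst); exact: cvg_fst. Qed.

Lemma cont_u : continuous (fun q : space3 R => q.1.2).
Proof.
by move=> p; apply: (@cvg_comp _ _ _ fst snd); [exact: cvg_fst|exact: cvg_snd].
Qed.

Lemma cont_v : continuous (fun q : space3 R => q.2).
Proof. by move=> p; exact: cvg_snd. Qed.

Lemma cont_h h (Lp : R) : 0 <= Lp ->
  (forall X Y, `|h X - h Y| <= Lp * (`|X.1 - Y.1| + `|X.2 - Y.2|)) -> continuous h.
Proof.
move=> Lp0 hlip X; apply/cvgrPdist_le => e e0.
have L0 : 0 < Lp + 1 by rewrite ltr_wpDl.
have c1 : (fun Y : plane R => Y.1) @ X --> X.1 by exact: cvg_fst.
have c2 : (fun Y : plane R => Y.2) @ X --> X.2 by exact: cvg_snd.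
pose d := e / (2 * (Lp + 1)).
have d0 : 0 < d by rewrite divr_gt0 // mulr_gt0.
have dE : (Lp + 1) * (d + d) = e by rewrite /d; field; rewrite gt_eqF.
near=> Y.
have h1 : `|X.1 - Y.1| <= d by near: Y; move/cvgrPdist_le : c1; apply.
have h2 : `|X.2 - Y.2| <= d by near: Y; move/cvgrPdist_le : c2; apply.
rewrite (le_trans (hlip X Y)) // -dE ler_pM ?addr_ge0 //; first by rewrite lerDl.
exact: lerD.
Unshelve. all: by end_near. Qed.

Lemma near_inside h : continuous h ->
  forall p, inside h p -> \forall q \near p, inside h q.
Proof.
move=> hc p /andP[p1 p2].
have c1 := cvgr_gt _ (@cont_v p) _ p1.
have c2 : (fun q : space3 R => h q.1 - q.2) @ p --> h p.1 - p.2.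
  apply: cvgB; last exact: cont_v.
  by apply: (@cvg_comp _ _ _ fst h); [exact: cvg_fst|exact: hc].
rewrite -subr_gt0 in p2; have c3 := cvgr_gt _ c2 _ p2.
near=> q; apply/andP; split; first by near: q; exact: c1.
by rewrite -subr_gt0; near: q; exact: c3.
Unshelve. all: by end_near. Qed.

Lemma derivable_opp_iff {V : normedModType R} (F : V -> R) p v :
  derivable F p v -> derivable (fun q => - F q) p v /\
  'D_v (fun q => - F q) p = - 'D_v F p.
Proof. by move=> dF; split; [exact: (derivableN dF)|exact: (deriveN dF)]. Qed.

Lemma derive_oppD2 h G : continuous h ->
  (forall q, inside h q -> forall v, v \in [:: sx; sy; sz] ->
    derivable G q v /\ derivable ('D_v G) q v) ->
  forall q, inside h q -> forall v, v \in [:: sx; sy; sz] ->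
  [/\ derivable (fun q => - G q) q v, derivable ('D_v (fun q => - G q)) q v,
    'D_v (fun q => - G q) q = - 'D_v G q &
    'D_v ('D_v (fun q => - G q)) q = - 'D_v ('D_v G) q].
Proof.
move=> hc Gd q Iq v vin; have [d1 d2] := Gd q Iq v vin.
have [e1 e2] := derivable_opp_iff _ _ _ d1.
have [e3 e4] := derivable_opp_iff _ _ _ d2.
have E : {near q, (fun q => - 'D_v G q) =1 'D_v (fun q => - G q)}.
  apply: filterS (near_inside h hc q Iq) => r Ir; have [d _] := Gd r Ir v vin.
  by have [_ ->] := derivable_opp_iff _ _ _ d.
split; [exact: e1|exact: near_eq_derivable E e3|exact: e2|].
by rewrite -(near_eq_derive _ E).
Qed.

Lemma opp_operator {b N a1 a2 a3 c1 c2 c3 : R} :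
  a1 = - c1 -> a2 = - c2 -> a3 = - c3 ->
  `|b * (c1 + c2) + c3| <= N -> `|b * (a1 + a2) + a3| <= N.
Proof. by move=> -> -> ->; rewrite -opprD mulrN -opprD normrN. Qed.

(** Turns the one-sided bounds from the minimum arguments into two-sided ones. *)
Lemma strip_solution_opp b N h G : continuous h -> (forall X, 0 < h X) ->
  strip_solution b N h G -> strip_solution b N h (fun q => - G q).
Proof.
move=> hc td_pos0 [Gc Gd GL Gt Gb [B GB]].
have dO := derive_oppD2 h G hc Gd; split.
- by move=> q; apply: cvgN; exact: Gc.
- by move=> q Iq v vin; have [f1 f2 _ _] := dO q Iq v vin; split; [exact: f1|exact: f2].
- move=> q Iq.
  have [_ _ _ f1] := dO q Iq sx ltac:(by rewrite !inE eqxx).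
  have [_ _ _ f2] := dO q Iq sy ltac:(by rewrite !inE eqxx ?orbT).
  have [_ _ _ f3] := dO q Iq sz ltac:(by rewrite !inE eqxx ?orbT).
  exact: (opp_operator f1 f2 f3 (GL q Iq)).
- by move=> X; rewrite Gt oppr0.
- move=> X; have h0 := td_pos0 X.
  have lim0 : - 'D_sz G (X, r) @[r --> (0:R)^'+] --> (0:R).
    by rewrite -[Y in _ --> Y]oppr0; exact: (cvgN (Gb X)).
  refine (cvg_trans (near_eq_cvg _) lim0).
  near=> r.
  have [|_ _ f _] := dO (X, r) _ sz ltac:(by rewrite !inE eqxx ?orbT).
  by apply/andP; split => /=; [near: r; exact: nbhs_right_gt|near: r; exact: nbhs_right_lt].
  by rewrite f.
- by exists B => q Sq; rewrite normrN; exact: GB.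
Unshelve. all: by end_near. Qed.

(** * Exponential barrier vanishing at the surface *)

Section Barrier.
Variables (b C0 Hm Lp N : R) (h : plane R -> R).
Hypothesis b01 : 0 < b < 1.
Hypothesis N0 : 0 < N.
Hypothesis C00 : 0 <= C0.
Hypothesis th : tame_depth b C0 Hm Lp h.

(** With this [lam], [lam * (lam - C0) >= 1]. The number [c] bounds the exponential of the barrier
    from below, and [A * c] is twice the residual bound: one [N] absorbs the residual, the other the
    penalty at infinity. *)
Let lam := C0 + 1.
Let c := expR (- (lam * Hm)).
Let A := 2 * N / c.

Let hc : continuous h. Proof. by case: th => _ /cont_h H /H. Qed.
Let lam1 : 1 <= lam. Proof. by rewrite lerDr. Qed.
Let lam0 : 0 < lam. Proof. exact: lt_le_trans lam1. Qed.
Let c0 : 0 < c. Proof. exact: expR_gt0. Qed.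
Let Ac : A * c = 2 * N. Proof. by rewrite /A divfK // gt_eqF. Qed.
Let A0 : 0 < A. Proof. by rewrite /A divr_gt0 // mulr_gt0. Qed.

(** With weights [b], [b], [1], the second order conditions sum to at most
    [- A * E * lam * (lam - C0) + 4 * eps + N], which is below [- 2 * N + N + N]. The squares of the
    slopes of [h] enter with a favourable sign. *)
Lemma barrier_arith {E eps hx hy hxx hyy G1 G2 G3 : R} :
  c <= E -> 0 < eps -> 4 * eps < N ->
  `|b * (hxx + hyy)| <= C0 -> `|b * (G1 + G2) + G3| <= N ->
  0 <= - (A * (E * (- lam * hxx + (- lam * hx) ^+ 2))) + 2 * eps - G1 ->
  0 <= - (A * (E * (- lam * hyy + (- lam * hy) ^+ 2))) + 2 * eps - G2 ->
  0 <= - (A * (E * (0 + lam ^+ 2))) - G3 -> False.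
Proof.
move=> cE e0 eN; rewrite !ler_norml => /andP[_ h1] /andP[g1 _] i1 i2 i3.
case/andP: b01 => b0 b1.
have j1 := mulr_ge0 (ltW b0) i1; have j2 := mulr_ge0 (ltW b0) i2.
have E0 : 0 < E := lt_le_trans c0 cE.
have AE0 : 0 < A * E by rewrite mulr_gt0.
have AE : 2 * N <= A * E by rewrite -Ac ler_pM2l.
have k1 : A * E * (lam * (b * (hxx + hyy))) <= A * E * (lam * C0).
  by rewrite ler_pM2l // ler_pM2l.
have k2 : A * E <= A * E * (lam * (lam - C0)).
  have l1 : 1 <= lam * (lam - C0) by rewrite {2}/lam addrAC subrr add0r mulr1.
  by rewrite ler_peMr // ltW.
have k3 : 0 <= A * E * (b * (lam * hx) ^+ 2 + b * (lam * hy) ^+ 2).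
  by apply: mulr_ge0; [exact: ltW|apply: addr_ge0; (apply: mulr_ge0; [exact: ltW|exact: sqr_ge0])].
have k4 : b * (4 * eps) <= 4 * eps by rewrite ler_piMl // ?(ltW b1) // mulr_ge0 // ltW.
have s : 0 <= - (A * E * (b * (lam * hx) ^+ 2 + b * (lam * hy) ^+ 2))
   + A * E * (lam * (b * (hxx + hyy))) - A * E * lam ^+ 2 + b * (4 * eps)
   - (b * (G1 + G2) + G3).
  by apply: le_trans (addr_ge0 (addr_ge0 j1 j2) i3) _; rewrite le_eqVlt; apply/orP; left; apply/eqP; ring.
have k5 : A * E * lam ^+ 2 = A * E * (lam * (lam - C0)) + A * E * (lam * C0) by ring.
lra.
Qed.

(* The horizontal second derivatives of [h] contribute at most [lam * C0] to the
   exponential, less than the [lam ^ 2] of the vertical direction. *)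
Let w (q : space3 R) := A * (1 - expR (- lam * (h q.1 - q.2))).

(** The strip is unbounded, so a minimum of [w - G] need not be attained; the penalty
    [eps * (x ^+ 2 + y ^+ 2)] forces one without spoiling the strict inequality of
    [barrier_arith]. *)
Lemma barrier_le G : strip_solution b N h G ->
  forall q, strip h q -> G q <= w q.
Proof.
case: th => hpos hlip Lp0 hd hlap [Gc Gd GL Gt Gb [B GB]] q0 Sq0.
rewrite leNgt; apply/negP; rewrite -subr_gt0 => neg.
have w0 q : strip h q -> 0 <= w q.
  move=> /andP[_ qh]; apply: mulr_ge0; first exact: ltW.
  by rewrite subr_ge0 -expR0 ler_expR mulNr oppr_le0 mulr_ge0 ?subr_ge0 // ltW.
pose g := G q0 - w q0.
pose n2 := q0.1.1 ^+ 2 + q0.1.2 ^+ 2.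
have n20 : 0 <= n2 by rewrite addr_ge0 // sqr_ge0.
(* Small enough for [q0] to remain a violation after adding the penalty. *)
have [eps [e0 eN eg]] : exists eps : R, [/\ 0 < eps, 4 * eps < N & eps * n2 < g].
  have n21 : 0 < n2 + 1 by rewrite ltr_wpDl.
  have m0 : 0 < Num.min (N / 4) (g / (n2 + 1)) by rewrite lt_min !divr_gt0.
  have m1 : Num.min (N / 4) (g / (n2 + 1)) <= N / 4 by rewrite ge_min lexx.
  have m2 : Num.min (N / 4) (g / (n2 + 1)) <= g / (n2 + 1) by rewrite ge_min lexx orbT.
  exists (Num.min (N / 4) (g / (n2 + 1)) / 2); split; [lra|lra|].
  apply: le_lt_trans (_ : g / (n2 + 1) / 2 * n2 < g).
    by apply: ler_wpM2r => //; lra.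
  have -> : g / (n2 + 1) / 2 * n2 = g * (n2 / (n2 + 1) / 2) by ring.
  rewrite gtr_pMr // ltr_pdivrMr // ltr_pdivrMr //; lra.
pose W (x y z : R) := w ((x, y), z) + eps * (x ^+ 2 + y ^+ 2) - G ((x, y), z).
pose WK (q : space3 R) := W q.1.1 q.1.2 q.2.
have W0 : WK q0 < 0.
  have -> : WK q0 = w q0 + eps * n2 - G q0 by rewrite /WK /W /n2; case: (q0) => [[]].
  by move: eg; rewrite /g; lra.
(* Outside the square of half-side [r] the penalty exceeds the bound [B] of [G], so the penalised
   function is nonnegative there; [q0] lies inside. *)
pose r := 1 + `|q0.1.1| + `|q0.1.2| + `|B| / eps.
have Be : 0 <= `|B| / eps by rewrite divr_ge0 // ltW.
have r1 : 1 <= r by rewrite /r; have := normr_ge0 q0.1.1; have := normr_ge0 q0.1.2; lra.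
have rB : `|B| <= eps * r ^+ 2.
  have -> : `|B| = eps * (`|B| / eps) by rewrite mulrC divfK // gt_eqF.
  rewrite ler_pM2l //; apply: (@le_trans _ _ r).
    by rewrite /r; have := normr_ge0 q0.1.1; have := normr_ge0 q0.1.2; lra.
  by rewrite expr2 ler_peMr // (le_trans _ r1).
pose K : set (space3 R) := strip h `&` [set q | -r <= q.1.1 <= r /\ - r <= q.1.2 <= r].
have KE q : K q <-> strip h q /\ (- r <= q.1.1 <= r /\ - r <= q.1.2 <= r) by [].
have Kq0 : K q0.
  by split=> //=; rewrite -!ler_norml /r; have := normr_ge0 q0.1.1; have := normr_ge0 q0.1.2; split; lra.
have cK : compact K.
  pose Bx := (`[- r, r]%classic `*` `[- r, r]%classic) `*` `[0, Hm]%classic.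
  have cB : compact Bx by do ![apply: compact_setX]; exact: segment_compact.
  have -> : K = Bx `&` [set q | 0 <= h q.1 - q.2].
    apply/seteqP; split => -[[x y] z]; rewrite /K /Bx /strip /= !in_itv /=.
      move=> [/andP[z0 zh] [-> ->]]; rewrite subr_ge0 zh z0 /=; split => //; split => //.
      by case/andP: (hpos (x, y)) => _; exact: le_trans.
    by move=> [[[-> ->] /andP[-> _]]]; rewrite subr_ge0.
  apply: compact_closedI => //.
  apply: (@closed_comp _ _ (fun q : space3 R => h q.1 - q.2) [set x | 0 <= x]).
    move=> p _; apply: cvgB; last exact: cont_v.
    by apply: (@cvg_comp _ _ _ fst h); [exact: cvg_fst|exact: hc].
  exact: closed_ge.
have cW : {within strip h, continuous WK}.
  have cw : continuous (fun q : space3 R => w q + eps * (q.1.1 ^+ 2 + q.1.2 ^+ 2)).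
    have sq (f : space3 R -> R) p : continuous f -> (fun x => (f x) ^+ 2) @ nbhs p --> (f p) ^+ 2.
      by move=> cf; rewrite expr2; apply: cvgM => //; exact: cf.
    move=> p; apply: cvgD.
      apply: cvgM; first exact: cvg_cst.
      apply: cvgB; first exact: cvg_cst.
      apply: (@cvg_comp _ _ _ (fun q : space3 R => - lam * (h q.1 - q.2)) expR); last exact: continuous_expR.
      apply: cvgM; first exact: cvg_cst.
      apply: cvgB; last exact: cont_v.
      by apply: (@cvg_comp _ _ _ fst h); [exact: cvg_fst|exact: hc].
    apply: cvgM; first exact: cvg_cst.
    by apply: cvgD; apply: sq; [exact: cont_s|exact: cont_u].
  have -> : WK = (fun q => w q + eps * (q.1.1 ^+ 2 + q.1.2 ^+ 2) - G q).
    by apply/funext => -[[x y] z].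
  by move=> p; apply: cvgB; [exact: (continuous_subspaceT cw)|exact: Gc].
have sK : K `<=` strip h by move=> q [].
have [[[x y] z] /set_mem [Sp [px py]] pmin] :=
  compact_EVT_min (ex_intro _ q0 Kq0) cK (continuous_subspaceW sK cW).
have Wmin x' y' z' : strip h ((x', y'), z') -> W x y z <= W x' y' z'.
  move=> S'; have Wp0 : W x y z < 0.
    by apply: le_lt_trans W0; apply: pmin; exact: mem_set.
  have [[h1 h2]|out] := pselect ((- r <= x' <= r) /\ (- r <= y' <= r)).
    by apply: (pmin ((x', y'), z')); exact: mem_set.
  apply: ltW; apply: lt_le_trans Wp0 _.
  have r2 : r ^+ 2 <= x' ^+ 2 + y' ^+ 2.
    rewrite leNgt; apply/negP => lt; apply: out.
    have sx' := sqr_ge0 x'; have sy' := sqr_ge0 y'.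
    have aux (a' : R) : a' ^+ 2 < r ^+ 2 -> - r <= a' <= r.
      move=> h'; rewrite -ler_norml; apply: ltW.
      rewrite -(@ltr_pXn2r _ 2) ?nnegrE //; last by rewrite (le_trans _ r1).
      by rewrite -normrX ger0_norm ?sqr_ge0.
    by split; apply: aux; lra.
  have := GB _ S'; have := w0 _ S'; rewrite /W ler_norml.
  have : eps * r ^+ 2 <= eps * (x' ^+ 2 + y' ^+ 2) by rewrite ler_pM2l.
  have := ler_norm B; lra.
have {}W0 : W x y z < 0 by apply: le_lt_trans W0; apply: pmin; exact: mem_set.
move: Sp => /andP[/= z0 zh].
have sq0 : 0 <= eps * (x ^+ 2 + y ^+ 2) by rewrite mulr_ge0 ?addr_ge0 ?sqr_ge0 ?ltW.
have {zh} zh : z < h (x, y).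
  rewrite lt_neqAle zh andbT; apply/eqP => zE; move: W0.
  rewrite /W zE Gt /w /= subrr mulr0 expR0 subrr mulr0 add0r subr0.
  by rewrite ltNge sq0.
have {z0} z0 : 0 < z.
  rewrite lt_neqAle z0 andbT eq_sym; apply/eqP => zE.
  have hp : 0 < h (x, y) by rewrite -zE.
  (* The barrier has vertical slope [- A * E * lam] at the bottom while that of [G] tends to zero,
     so the minimum is not on the bottom. *)
  have : exists2 y', 0 < y' < 0 + h (x, y) & W x y y' < W x y 0.
    apply: (@neumann_not_min _ (fun t => W x y t)
      (fun t => A * (0 - expR (- lam * (h (x, y) - t)) * (2 * 0 * t + lam)) + 0 -
         'D_sz G ((x, y), t)) 0 (h (x, y))
      (A * (0 - expR (- lam * (h (x, y) - 0)) * (2 * 0 * 0 + lam)) + 0 - 0)).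
    - exact: hp.
    - have := @within_comp _ _ _ `[0, 0 + h (x, y)]%classic (strip h)
        (fun t : R => (((x : R), (y : R)), t) : space3 R) WK cW.
      apply.
        exact: (continuous_pair _ _ (@cst_continuous _ _ (x, y))
          (fun y => @cvg_id _ (nbhs y))).
      by move=> t /=; rewrite in_itv /= add0r.
    - move=> t; rewrite add0r => Ht.
      have [dG _] := Gd ((x, y), t) Ht sz ltac:(by rewrite !inE eqxx ?orbT).
      have i1 := is_derive_along G (fun t => ((x, y), t)) sz t
        (fun k t => esym (line_sz k x y t)) dG.
      have i2 : is_derive t (1:R) (fun t => - lam * (h (x, y) - t)) (2 * 0 * t + lam).
        by apply: (@is_derive_quad _ _ _ _ (- lam * h (x, y))) => t'; ring.
      have i3 := @is_derive1_comp R expR (fun t : R => - lam * (h (x, y) - t)) t _ _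
        (is_derive_expR _) i2.
      have i4 := is_deriveZ A (is_deriveB (is_derive_cst (1:R) t (1:R)) i3).
      have i5 := is_deriveD i4 (is_derive_cst (eps * (x ^+ 2 + y ^+ 2)) t (1:R)).
      exact: (is_deriveB i5 i1).
    - apply: cvgB; last exact: Gb.
      apply: cvg_at_right_filter; apply: cvgD; last exact: cvg_cst.
      apply: cvgM; first exact: cvg_cst.
      apply: cvgB; first exact: cvg_cst.
      apply: cvgM.
        apply: (@cvg_comp _ _ _ (fun t => - lam * (h (x, y) - t)) expR); last exact: continuous_expR.
        apply: cvgM; first exact: cvg_cst.
        by apply: cvgB; [exact: cvg_cst|exact: cvg_id].
      apply: cvgD; last exact: cvg_cst.
      by apply: cvgM; [exact: cvg_cst|exact: cvg_id].
    - have E0 := expR_gt0 (- lam * (h (x, y) - 0)).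
      have : 0 < A * (expR (- lam * (h (x, y) - 0)) * lam) by do 2 rewrite mulr_gt0 //.
      by rewrite -oppr_lt0; congr (_ < _); ring.
  case=> y' y1; rewrite -zE ltNge => /negP; apply; apply: Wmin.
  by move: y1; rewrite /strip /= add0r => /andP[/ltW -> /ltW ->].
have Ip : inside h ((x, y), z) by rewrite /inside /= z0.
have nG v : v \in [:: sx; sy; sz] -> jet2 (fun t => G (t *: v + ((x, y), z)))
    ('D_v G ((x, y), z)) ('D_v ('D_v G) ((x, y), z)).
  move=> vin; apply: jet2_line; last by have [] := Gd _ Ip v vin.
  by apply: filterS (near_inside h hc _ Ip) => q Iq; have [] := Gd q Iq v vin.
have nh v : v \in [:: ux; uy] -> jet2 (fun t => h (t *: v + (x, y)))
    ('D_v h (x, y)) ('D_v ('D_v h) (x, y)).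
  move=> vin; apply: jet2_line; last by have [] := hd (x, y) v vin.
  by near=> q; have [] := hd q v vin.
pose E := expR (- lam * (h (x, y) - z)).
have cE : c <= E.
  rewrite /c /E ler_expR mulNr lerN2 ler_pM2l // lerBlDr.
  by case/andP: (hpos (x, y)) => _ hm; rewrite (le_trans hm) // lerDl ltW.
have jx : jet2 (fun t => W (t + x) y z)
   (- (A * (E * (- lam * 'D_ux h (x, y)))) + 2 * eps * x - 'D_sx G ((x, y), z))
   (- (A * (E * (- lam * 'D_ux ('D_ux h) (x, y) + (- lam * 'D_ux h (x, y)) ^+ 2))) + 2 * eps
     - 'D_sx ('D_sx G) ((x, y), z)).
  have := nG sx ltac:(by rewrite !inE eqxx); under eq_fun do rewrite line_sx.
  apply: jet2B; apply: jet2D; last first.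
    by apply: (jet2_quad _ eps (2 * eps * x) (eps * (x ^+ 2 + y ^+ 2))) => t; ring.
  have := nh ux ltac:(by rewrite !inE eqxx); under eq_fun do rewrite line_ux.
  move=> jh; have je := jet2Z _ A _ _ (jet2B _ _ _ _ _ _ (jet2_cst 1)
    (jet2_expR _ _ _ (jet2Z _ (- lam) _ _ (jet2B _ _ _ _ _ _ jh (jet2_cst z))))).
  by apply: jet2_eq je _ _; rewrite (add0r x) /E; ring.
have jy : jet2 (fun t => W x (t + y) z)
   (- (A * (E * (- lam * 'D_uy h (x, y)))) + 2 * eps * y - 'D_sy G ((x, y), z))
   (- (A * (E * (- lam * 'D_uy ('D_uy h) (x, y) + (- lam * 'D_uy h (x, y)) ^+ 2))) + 2 * eps
     - 'D_sy ('D_sy G) ((x, y), z)).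
  have := nG sy ltac:(by rewrite !inE eqxx ?orbT); under eq_fun do rewrite line_sy.
  apply: jet2B; apply: jet2D; last first.
    by apply: (jet2_quad _ eps (2 * eps * y) (eps * (x ^+ 2 + y ^+ 2))) => t; ring.
  have := nh uy ltac:(by rewrite !inE eqxx ?orbT); under eq_fun do rewrite line_uy.
  move=> jh; have je := jet2Z _ A _ _ (jet2B _ _ _ _ _ _ (jet2_cst 1)
    (jet2_expR _ _ _ (jet2Z _ (- lam) _ _ (jet2B _ _ _ _ _ _ jh (jet2_cst z))))).
  by apply: jet2_eq je _ _; rewrite (add0r y) /E; ring.
have jz : jet2 (fun t => W x y (t + z))
   (- (A * (E * lam)) - 'D_sz G ((x, y), z))
   (- (A * (E * (0 + lam ^+ 2))) - 'D_sz ('D_sz G) ((x, y), z)).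
  have := nG sz ltac:(by rewrite !inE eqxx ?orbT); under eq_fun do rewrite line_sz.
  apply: jet2B.
  have jl : jet2 (fun t => - lam * (h (x, y) - (t + z))) lam (2 * 0).
    by apply: (jet2_quad _ 0 lam (- lam * (h (x, y) - z))) => t; ring.
  have je := jet2D _ _ _ _ _ _ (jet2Z _ A _ _ (jet2B _ _ _ _ _ _ (jet2_cst 1)
    (jet2_expR _ _ _ jl))) (jet2_cst (eps * (x ^+ 2 + y ^+ 2))).
  by apply: jet2_eq je _ _; rewrite (add0r z) /E; ring.
have c1 : continuous (fun t : R => ((t + x, y), z) : space3 R).
  apply: (continuous_pair _ _ _ (@cst_continuous _ _ z)).
  apply: (continuous_pair _ _ _ (@cst_continuous _ _ y)).
  by move=> t; apply: cvgD; [exact: cvg_id|exact: cvg_cst].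
have c2 : continuous (fun t : R => ((x, t + y), z) : space3 R).
  apply: (continuous_pair _ _ _ (@cst_continuous _ _ z)).
  apply: (continuous_pair _ _ (@cst_continuous _ _ x)).
  by move=> t; apply: cvgD; [exact: cvg_id|exact: cvg_cst].
have c3 : continuous (fun t : R => ((x, y), t + z) : space3 R).
  apply: (continuous_pair _ _ (@cst_continuous _ _ (x, y))).
  by move=> t; apply: cvgD; [exact: cvg_id|exact: cvg_cst].
have near_strip (a : R -> space3 R) : continuous a -> a 0 = ((x, y), z) ->
    \forall t \near (0:R), strip h (a t).
  move=> ca a0; have := ca 0 (inside h); rewrite a0 => /(_ (near_inside h hc _ Ip)).
  by apply: filterS => t /andP[/ltW h1 /ltW h2]; apply/andP.
have mx : \forall t \near (0:R), W (0 + x) y z <= W (t + x) y z.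
  by rewrite add0r; apply: filterS (near_strip _ c1 _) => [t /Wmin //|]; rewrite add0r.
have my : \forall t \near (0:R), W x (0 + y) z <= W x (t + y) z.
  by rewrite add0r; apply: filterS (near_strip _ c2 _) => [t /Wmin //|]; rewrite add0r.
have mz : \forall t \near (0:R), W x y (0 + z) <= W x y (t + z).
  by rewrite add0r; apply: filterS (near_strip _ c3 _) => [t /Wmin //|]; rewrite add0r.
have [_ ax] := jet2_min _ _ _ jx mx.
have [_ ay] := jet2_min _ _ _ jy my.
have [_ az] := jet2_min _ _ _ jz mz.
exact: (barrier_arith cE e0 eN (hlap (x, y)) (GL _ Ip) ax ay az).
Unshelve. all: by end_near. Qed.

End Barrier.
End Strip.

(** * Slopes from boxes scaled by the distance to the surface *)

Section StripGradient.
Context {R : realType}.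
Variables (b C0 Hm Lp N : R) (h : plane R -> R).
Hypothesis b01 : 0 < b < 1.
Hypothesis N0 : 0 < N.
Hypothesis C00 : 0 <= C0.
Hypothesis th : tame_depth b C0 Hm Lp h.

Let hc : continuous h. Proof. by case: th => _ /cont_h H /H. Qed.
Let hpos X : 0 < h X. Proof. by case: th => /(_ X)/andP[]. Qed.
Let Lp0 : 0 <= Lp. Proof. by case: th. Qed.
Let b0 : 0 < b. Proof. by case/andP: b01. Qed.
Let Hm0 : 0 < Hm.
Proof. by case: th => /(_ (0, 0))/andP[h0 h1 _ _ _ _]; exact: lt_le_trans h1. Qed.

(** The slope [A * lam] of the barrier at the surface, per unit of [N]. *)
Definition barrier_slope (C0 Hm : R) := 2 * expR ((C0 + 1) * Hm) * (C0 + 1).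
Let cB := barrier_slope C0 Hm.
Let cB0 : 0 < cB.
Proof. by rewrite /cB /barrier_slope !mulr_gt0 ?expR_gt0 // ltr_wpDl. Qed.

Lemma strip_le G q : strip_solution b N h G -> strip h q ->
  `|G q| <= cB * N * (h q.1 - q.2).
Proof.
move=> sG Sq; have sG' := strip_solution_opp _ _ _ _ hc hpos sG.
have l1 := barrier_le _ _ _ _ _ _ b01 N0 C00 th _ sG _ Sq.
have l2 := barrier_le _ _ _ _ _ _ b01 N0 C00 th _ sG' _ Sq.
have l3 : 2 * N / expR (- ((C0 + 1) * Hm)) * (1 - expR (- (C0 + 1) * (h q.1 - q.2)))
    <= cB * N * (h q.1 - q.2).
  have -> : cB * N * (h q.1 - q.2) =
      2 * N / expR (- ((C0 + 1) * Hm)) * ((C0 + 1) * (h q.1 - q.2)).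
    by rewrite expRN invrK /cB /barrier_slope; ring.
  apply: ler_wpM2l; first by rewrite divr_ge0 ?mulr_ge0 ?expR_ge0 ?ltW.
  have := expR_ge1Dx (- (C0 + 1) * (h q.1 - q.2)); lra.
by rewrite ler_norml; apply/andP; split; lra.
Qed.

(** Comes from [box_derive_le] with [m] twice the barrier bound at the centre and a distance to the
    surface equal to [2 * (1 + 2 * Lp)] half-widths: this gives [32], times 3 for the sum of the
    coefficients. The second term uses that the half-width is at most [Hm]. *)
Definition gradient_constant (C0 Hm Lp : R) :=
  96 * barrier_slope C0 Hm * (1 + 2 * Lp) + 2 * Hm.

(** Over a box of this half-width, [h] varies by at most [2 * Lp] half-widths and [z] by one. The
    distance to the surface thus changes by at most half its central value: the box stays below the
    surface and the distance does not double. *)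
Let dN (p : space3 R) := (h p.1 - p.2) / (2 * (1 + 2 * Lp)).

Lemma box_inside x0 y0 z0 x y z : inside h ((x0, y0), z0) ->
  let a := dN ((x0, y0), z0) in let rho := h (x0, y0) - z0 in
  [/\ 0 < a, a <= Hm, 0 < rho &
  `|x - x0| <= a -> `|y - y0| <= a -> z <= z0 + a -> z0 - a <= z ->
  z < h (x, y) /\ h (x, y) - z <= 2 * rho].
Proof.
move=> /andP[z00 z0h] a rho; rewrite /= in z00 z0h; have [H1 H2 _ _ _] := th.
have L1 : 0 < 2 * (1 + 2 * Lp) by move: Lp0; lra.
have rho0 : 0 < rho by rewrite subr_gt0.
have a0 : 0 < a by rewrite /a /dN divr_gt0.
have aE : a * (1 + 2 * Lp) = rho / 2.
  by rewrite /a /dN /rho /=; field; apply/eqP => e; move: L1; rewrite e; lra.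
have aL : 0 <= a * Lp by rewrite mulr_ge0 // ltW.
split => //.
  have /andP[_ hm] := H1 (x0, y0).
  have : rho <= Hm by rewrite /rho; lra.
  lra.
move=> hx hy hz1 hz2; have := H2 (x, y) (x0, y0); rewrite /=.
have : Lp * (`|x - x0| + `|y - y0|) <= Lp * (a + a) by rewrite ler_wpM2l // lerD.
move=> l1 l2; have := le_trans l2 l1; rewrite ler_norml => /andP[l3 l4].
split; rewrite /rho; rewrite /rho in aE; lra.
Qed.

Lemma operator_eq {c1 c2 c3 x1 x2 x3 y1 y2 y3 M : R} :
  x1 = y1 -> x2 = y2 -> x3 = y3 ->
  `|c1 * y1 + c2 * y2 + c3 * y3| <= M -> `|c1 * x1 + c2 * x2 + c3 * x3| <= M.
Proof. by move=> -> -> ->. Qed.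

Lemma operator_xyz {x y z M : R} :
  `|b * (x + y) + z| <= M -> `|b * x + b * y + 1 * z| <= M.
Proof. by rewrite mulrDr mul1r. Qed.

Lemma operator_yxz {x y z M : R} :
  `|b * (x + y) + z| <= M -> `|b * y + b * x + 1 * z| <= M.
Proof. by rewrite mulrDr mul1r (addrC (b * x)). Qed.

Lemma operator_zxy {x y z M : R} :
  `|b * (x + y) + z| <= M -> `|1 * z + b * x + b * y| <= M.
Proof. by rewrite mulrDr mul1r -[z + _ + _]addrA [z + _]addrC. Qed.

(** The map [pi] permutes the coordinates so that the direction [e1] to be estimated becomes the
    first; one box lemma then serves all three partial derivatives. *)
Lemma strip_solution_box G (pi : space3 R -> space3 R) (e1 e2 e3 : space3 R)
    (c1 c2 c3 s0 u0 v0 l1 l3 : R) :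
  strip_solution b N h G -> continuous pi ->
  (forall k p, pi (k *: sx + p) = k *: e1 + pi p) ->
  (forall k p, pi (k *: sy + p) = k *: e2 + pi p) ->
  (forall k p, pi (k *: sz + p) = k *: e3 + pi p) ->
  e1 \in [:: sx; sy; sz] -> e2 \in [:: sx; sy; sz] -> e3 \in [:: sx; sy; sz] ->
  (forall q, inside h q ->
   `|c1 * 'D_e1 ('D_e1 G) q + c2 * 'D_e2 ('D_e2 G) q + c3 * 'D_e3 ('D_e3 G) q| <= N) ->
  0 < c1 -> 0 <= c2 -> 0 < c3 ->
  inside h (pi ((s0, u0), v0)) ->
  let a := dN (pi ((s0, u0), v0)) in
  let m := 2 * cB * N * (h (pi ((s0, u0), v0)).1 - (pi ((s0, u0), v0)).2) in
  s0 - a <= l1 < s0 -> v0 - a <= l3 < v0 ->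
  (forall s u v, l1 <= s <= s0 + a -> u0 - a <= u <= u0 + a -> l3 <= v <= v0 + a ->
    strip h (pi ((s, u), v)) /\
    h (pi ((s, u), v)).1 - (pi ((s, u), v)).2 <=
      2 * (h (pi ((s0, u0), v0)).1 - (pi ((s0, u0), v0)).2)) ->
  (forall s u v, l1 < s < s0 + a -> u0 - a < u < u0 + a -> l3 < v < v0 + a ->
    inside h (pi ((s, u), v))) ->
  l1 = s0 - a \/ (l3 = v0 - a /\
    forall u v, u0 - a < u < u0 + a -> l3 < v < v0 + a ->
    'D_e1 G (pi ((r, u), v)) @[r --> l1^'+] --> (0:R)) ->
  l3 = v0 - a \/ (l1 = s0 - a /\
    forall s u, l1 < s < s0 + a -> u0 - a < u < u0 + a ->
    'D_e3 G (pi ((s, u), r)) @[r --> l3^'+] --> (0:R)) ->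
  'D_e1 G (pi ((s0, u0), v0)) <= 8 * m * (1 + (c2 + c3) / c1) / a + 2 * a * N / c1.
Proof.
move=> sG pic p1 p2 p3 i1 i2 i3 GL c10 c20 c30 Ip a m l1P l3P boxS boxI n1 n3.
have [a0 _ r0 _] : [/\ 0 < a, a <= Hm,
  0 < h (pi ((s0, u0), v0)).1 - (pi ((s0, u0), v0)).2 & True].
  move: Ip; rewrite /a; case: (pi _) => [[x0 y0] z0] Ip.
  by have [q1 q2 q3 _] := box_inside x0 y0 z0 x0 y0 z0 Ip; split.
have m0 : 0 < m by rewrite /m; do 3 (apply: mulr_gt0 => //).
have D1 q : 'D_sx (G \o pi) q = 'D_e1 G (pi q).
  by apply: derive_affine => k; exact: p1.
have E1 : 'D_sx (G \o pi) = 'D_e1 G \o pi by apply/funext => q; exact: D1.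
have D2 q : 'D_sy (G \o pi) q = 'D_e2 G (pi q).
  by apply: derive_affine => k; exact: p2.
have E2 : 'D_sy (G \o pi) = 'D_e2 G \o pi by apply/funext => q; exact: D2.
have D3 q : 'D_sz (G \o pi) q = 'D_e3 G (pi q).
  by apply: derive_affine => k; exact: p3.
have E3 : 'D_sz (G \o pi) = 'D_e3 G \o pi by apply/funext => q; exact: D3.
have F1 q : 'D_sx ('D_sx (G \o pi)) q = 'D_e1 ('D_e1 G) (pi q).
  by rewrite E1; apply: derive_affine => k; exact: p1.
have F2 q : 'D_sy ('D_sy (G \o pi)) q = 'D_e2 ('D_e2 G) (pi q).
  by rewrite E2; apply: derive_affine => k; exact: p2.
have F3 q : 'D_sz ('D_sz (G \o pi)) q = 'D_e3 ('D_e3 G) (pi q).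
  by rewrite E3; apply: derive_affine => k; exact: p3.
have Gd := ss_derivable _ _ _ _ sG.
rewrite -D1.
apply: (box_derive_le (G \o pi) c1 c2 c3 m N a s0 u0 v0 l1 l3 a0 c10 c20 c30 m0 (ltW N0) l1P l3P).
- apply: (within_comp _ (strip h) pi G (ss_cont _ _ _ _ sG) pic) => -[[s u] v] [/= h1 h2 h3].
  by have [] := boxS s u v h1 h2 h3.
- move=> [[s u] v] [/= h1 h2 h3].
  have Iq := boxI _ _ _ h1 h2 h3.
  have dd e (v' : space3 R) : (forall k p, pi (k *: v' + p) = k *: e + pi p) ->
     'D_v' (G \o pi) = 'D_e G \o pi -> e \in [:: sx; sy; sz] ->
      derivable (G \o pi) ((s, u), v) v' /\ derivable ('D_v' (G \o pi)) ((s, u), v) v'.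
    move=> Hp HE ein; have [d1 d2] := Gd _ Iq e ein; split.
      exact: (derivable_affine G pi v' e _ (fun k => Hp k _) d1).
    by rewrite HE; exact: (derivable_affine ('D_e G) pi v' e _ (fun k => Hp k _) d2).
  move=> v'; rewrite !inE => /or3P[] /eqP ->; [exact: (dd e1)|exact: (dd e2)|exact: (dd e3)].
- move=> [[s u] v] [/= h1 h2 h3]; exact: (operator_eq (F1 _) (F2 _) (F3 _) (GL _ (boxI _ _ _ h1 h2 h3))).
- move=> [[s u] v] [/= h1 h2 h3].
  have [Sq le] := boxS s u v h1 h2 h3.
  rewrite (le_trans (strip_le _ _ sG Sq)) // /m.
  have -> : forall y, 2 * cB * N * y = cB * N * (2 * y) by move=> y; ring.
  by rewrite ler_wpM2l // mulr_ge0 ?ltW.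
- case: n1 => [->|[e n1]]; [by left|right; split; [by []|move=> u v hu hv]].
  have -> : (fun r => 'D_sx (G \o pi) ((r, u), v)) = (fun r => 'D_e1 G (pi ((r, u), v))).
    by apply/funext => r; exact: D1.
  exact: n1.
- case: n3 => [->|[e n3]]; [by left|right; split; [by []|move=> s u hs hu]].
  have -> : (fun r => 'D_sz (G \o pi) ((s, u), r)) = (fun r => 'D_e3 G (pi ((s, u), r))).
    by apply/funext => r; exact: D3.
  exact: n3.
Qed.

Let C1 := gradient_constant C0 Hm Lp.

Lemma box_value (c1 c2 c3 : R) (p : space3 R) : inside h p ->
  0 < c1 <= 1 -> 0 <= c2 -> 0 <= c3 -> c1 + c2 + c3 <= 3 ->
  8 * (2 * cB * N * (h p.1 - p.2)) * (1 + (c2 + c3) / c1) / dN p + 2 * dN p * N / c1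
    <= C1 * N / c1.
Proof.
case: p => [[x0 y0] z0] Ip /andP[c10 c11] c20 c30 csum.
have [a0 aH r0 _] := box_inside x0 y0 z0 x0 y0 z0 Ip.
have aE : dN ((x0, y0), z0) = (h (x0, y0) - z0) / (2 * (1 + 2 * Lp)) by [].
move: (dN _) a0 aH aE => a a0 aH aE; rewrite /=; set r := h (x0, y0) - z0 in aE r0 *.
have L0 : 0 < 1 + 2 * Lp by move: Lp0; lra.
have -> : 8 * (2 * cB * N * r) * (1 + (c2 + c3) / c1) / a + 2 * a * N / c1 =
   (32 * cB * (1 + 2 * Lp) * (c1 + c2 + c3) + 2 * a) * N / c1.
  have -> : r = a * (2 * (1 + 2 * Lp)) by rewrite aE divfK // mulf_neq0 // gt_eqF.
  by field; rewrite !gt_eqF.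
rewrite ler_pM2r ?invr_gt0 // ler_pM2r // /C1 /gradient_constant -/cB.
apply: lerD; last by rewrite ler_pM2l.
have -> : 96 * cB * (1 + 2 * Lp) = 32 * cB * (1 + 2 * Lp) * 3 by ring.
rewrite ler_pM2l //; apply: mulr_gt0 => //; exact: mulr_gt0.
Qed.

Lemma strip_derive_le G p : strip_solution b N h G -> inside h p ->
  [/\ 'D_sx G p <= C1 * N / b, 'D_sy G p <= C1 * N / b & 'D_sz G p <= C1 * N].
Proof.
move=> sG Ip; case: p Ip => [[x0 y0] z0] Ip.
have boxI x y z := box_inside x0 y0 z0 x y z Ip.
have [a0 aH r0 _] := boxI x0 y0 z0.
have {}boxI x y z : `|x - x0| <= dN (x0, y0, z0) -> `|y - y0| <= dN (x0, y0, z0) ->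
    z <= z0 + dN (x0, y0, z0) -> z0 - dN (x0, y0, z0) <= z ->
    z < h (x, y) /\ h (x, y) - z <= 2 * (h (x0, y0) - z0).
  by have [] := boxI x y z.
have [z00 z0h] : 0 < z0 /\ z0 < h (x0, y0) by case/andP: (Ip).
(* The box is cut at the bottom when it would cross it; the cut face carries the Neumann
   condition. *)
pose a := dN (x0, y0, z0); pose l : R := Num.max 0 (z0 - a).
have l0 : 0 <= l by rewrite le_max lexx.
have la : z0 - a <= l by rewrite le_max lexx orbT.
have lz : l < z0 by rewrite gt_max z00 /= gtrBl.
have lE : l = z0 - a \/ l = 0.
  by rewrite /l; case: (leP 0 (z0 - a)) => _; [left|right].
have ab (x y : R) : x - a <= y <= x + a -> `|y - x| <= a.
  by rewrite ler_norml; move=> /andP[? ?]; apply/andP; split; lra.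
have Sq x y z : x0 - a <= x <= x0 + a -> y0 - a <= y <= y0 + a ->
    l <= z <= z0 + a -> strip h ((x, y), z) /\ h (x, y) - z <= 2 * (h (x0, y0) - z0).
  move=> /ab hx /ab hy /andP[z1 z2].
  have [h1 h2] := boxI x y z hx hy z2 (le_trans la z1).
  by split => //; rewrite /strip /= (le_trans l0 z1) ltW.
have Iq x y z : x0 - a < x < x0 + a -> y0 - a < y < y0 + a ->
    l < z < z0 + a -> inside h ((x, y), z).
  move=> /andP[hx1 hx2] /andP[hy1 hy2] /andP[z1 z2].
  have hx : x0 - a <= x <= x0 + a by rewrite (ltW hx1) (ltW hx2).
  have hy : y0 - a <= y <= y0 + a by rewrite (ltW hy1) (ltW hy2).
  have [h1 h2] := boxI x y z (ab _ _ hx) (ab _ _ hy)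
     (ltW z2) (ltW (le_lt_trans la z1)).
  by rewrite /inside /= (le_lt_trans l0 z1).
have Gb := ss_bottom _ _ _ _ sG; have GL := ss_lap _ _ _ _ sG.
have m1 : sx \in [:: sx; sy; (sz : space3 R)] by rewrite !inE eqxx.
have m2 : sy \in [:: sx; sy; (sz : space3 R)] by rewrite !inE eqxx orbT.
have m3 : sz \in [:: sx; sy; (sz : space3 R)] by rewrite !inE eqxx !orbT.
have b1 : b <= 1 by case/andP: b01 => _ /ltW.
have x0a : x0 - a <= x0 - a < x0 by rewrite lexx gtrBl.
have y0a : y0 - a <= y0 - a < y0 by rewrite lexx gtrBl.
have z0l : z0 - a <= l < z0 by rewrite la lz.
split.
- have := @strip_solution_box G id sx sy sz b b 1 x0 y0 z0 (x0 - a) l sG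
   (fun p => @cvg_id _ (nbhs p)) (fun _ _ => erefl) (fun _ _ => erefl) (fun _ _ => erefl) m1 m2 m3.
  move=> /(_ _ b0 (ltW b0) ltr01 Ip x0a z0l) H.
  apply: le_trans (H _ _ _ _ _) (box_value b b 1 _ Ip _ _ _ _).
  + by move=> q Iq'; exact: (operator_xyz (GL _ Iq')).
  + by move=> s u v; exact: Sq.
  + by move=> s u v; exact: Iq.
  + by left.
  + case: lE => lE; [by left|right; split; [by []|move=> s u _ _]].
    by rewrite lE; exact: (Gb (s, u)).
  + by rewrite b0 b1.
  + exact: ltW.
  + exact: ler01.
  + lra.
- pose pi (q : space3 R) := ((q.1.2, q.1.1), q.2).
  have pic : continuous pi.
    exact: (continuous_pair _ _ (continuous_pair _ _ (@cont_u R) (@cont_s R)) (@cont_v R)).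
  have p1 k p : pi (k *: sx + p) = k *: sy + pi p.
    by case: p => [[s u] v]; rewrite line_sx line_sy.
  have p2 k p : pi (k *: sy + p) = k *: sx + pi p.
    by case: p => [[s u] v]; rewrite line_sx line_sy.
  have p3 k p : pi (k *: sz + p) = k *: sz + pi p.
    by case: p => [[s u] v]; rewrite !line_sz.
  have := @strip_solution_box G pi sy sx sz b b 1 y0 x0 z0 (y0 - a) l sG
    pic p1 p2 p3 m2 m1 m3.
  move=> /(_ _ b0 (ltW b0) ltr01 Ip y0a z0l) H.
  apply: le_trans (H _ _ _ _ _) (box_value b b 1 _ Ip _ _ _ _).
  + by move=> q Iq'; exact: (operator_yxz (GL _ Iq')).
  + by move=> s u v h1 h2 h3; exact: Sq.
  + by move=> s u v h1 h2 h3; exact: Iq.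
  + by left.
  + case: lE => lE; [by left|right; split; [by []|move=> s u _ _]].
    by rewrite lE; exact: (Gb (u, s)).
  + by rewrite b0 b1.
  + exact: ltW.
  + exact: ler01.
  + lra.
(* With the vertical direction first, the cut face is the lower end of the first coordinate, and the
   leading coefficient is 1 instead of [b]: no power of [b] is lost. *)
- pose pi (q : space3 R) := ((q.1.2, q.2), q.1.1).
  have pic : continuous pi.
    exact: (continuous_pair _ _ (continuous_pair _ _ (@cont_u R) (@cont_v R)) (@cont_s R)).
  have p1 k p : pi (k *: sx + p) = k *: sz + pi p.
    by case: p => [[s u] v]; rewrite line_sx line_sz.
  have p2 k p : pi (k *: sy + p) = k *: sx + pi p.
    by case: p => [[s u] v]; rewrite line_sx line_sy.
  have p3 k p : pi (k *: sz + p) = k *: sy + pi p.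
    by case: p => [[s u] v]; rewrite line_sz line_sy.
  have := @strip_solution_box G pi sz sx sy 1 b b z0 x0 y0 l (y0 - a) sG
    pic p1 p2 p3 m3 m1 m2.
  move=> /(_ _ ltr01 (ltW b0) b0 Ip z0l y0a) H.
  rewrite -[leRHS]divr1.
  apply: le_trans (H _ _ _ _ _) (box_value 1 b b _ Ip _ _ _ _).
  + by move=> q Iq'; exact: (operator_zxy (GL _ Iq')).
  + by move=> s u v h1 h2 h3; exact: Sq.
  + by move=> s u v h1 h2 h3; exact: Iq.
  + case: lE => lE; [by left|right; split; [by []|move=> u v _ _]].
    by rewrite lE; exact: (Gb (u, v)).
  + by left.
  + by rewrite ltr01 lexx.
  + exact: ltW.
  + exact: ltW.
  + lra.
Qed.

Theorem strip_gradient G p : strip_solution b N h G -> inside h p ->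
  [/\ `|'D_sx G p| <= C1 * N / b, `|'D_sy G p| <= C1 * N / b & `|'D_sz G p| <= C1 * N].
Proof.
move=> sG Ip; have [u1 u2 u3] := strip_derive_le _ _ sG Ip.
have [l1 l2 l3] := strip_derive_le _ _ (strip_solution_opp _ _ _ _ hc hpos sG) Ip.
have Gd := ss_derivable _ _ _ _ sG _ Ip.
have neg (v : space3 R) (M : R) : derivable G p v -> 'D_v G p <= M ->
    'D_v (fun q => - G q) p <= M -> `|'D_v G p| <= M.
  move=> d; have [_] := derivable_opp_iff _ _ _ d.
  by move: ('D_v G p) ('D_v _ p) => x y -> h1 h2; rewrite ler_norml h1 andbT lerNl.
have d1 : derivable G p sx by have [] := Gd sx ltac:(by rewrite !inE eqxx).
have d2 : derivable G p sy by have [] := Gd sy ltac:(by rewrite !inE eqxx orbT).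
have d3 : derivable G p sz by have [] := Gd sz ltac:(by rewrite !inE eqxx !orbT).
by split; [exact: (neg _ _ d1 u1 l1)|exact: (neg _ _ d2 u2 l2)|exact: (neg _ _ d3 u3 l3)].
Qed.

End StripGradient.

(** * Fourier inversion *)

Section RealIntegrals.
Context {R : realType}.
Notation mu := (@lebesgue_measure R).

(** Folding at 0 reduces to a half-line, where the fundamental theorem handles improper integrals of
    nonnegative functions. *)
Lemma integralT_split (g : R -> R) : continuous g -> (forall x, 0 <= g x) ->
  (\int[mu]_x (g x)%:E = \int[mu]_(x in `[0%R, +oo[) (g x + g (- x))%:E)%E.
Proof.
move=> cg g0.
have mg : measurable_fun [set: R] g by exact: continuous_measurable_fun.
have mgN : measurable_fun [set: R] (fun x => g (- x)).
  by apply: continuous_measurable_fun => x; apply: continuous_comp; [exact: oppr_continuous|exact: cg].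
have mpos : measurable (`[0, +oo[%classic : set R) by [].
rewrite -(setUv (`[0, +oo[%classic : set R)) ge0_integral_setU //=; last 4 first.
- exact: measurableC.
- by apply/measurable_EFinP; rewrite setUv.
- by move=> x _; rewrite lee_fin.
- exact/disj_setPCl.
rewrite setCitvr integral_itv_bndo_bndc; last exact/measurable_EFinP/measurable_funTS.
have H := @ge0_integration_by_substitutionNy R g 0; rewrite oppr0 in H.
rewrite H //; last exact: continuous_subspaceT.
rewrite -ge0_integralD //.
all: try by move=> x _; rewrite lee_fin.
all: try exact/measurable_EFinP/measurable_funTS.
by move=> x _; rewrite lee_fin /=.
Qed.

Lemma integralT_FTC (g F : R -> R) (l : R) : continuous g -> (forall x, 0 <= g x) ->
  continuous F -> (forall x : R, 0 < x -> is_derive x (1:R) F (g x + g (- x))) -> F x @[x --> +oo] --> l ->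
  (\int[mu]_x (g x)%:E = (l - F 0)%:E)%E.
Proof.
move=> cg g0 cF dF Fl; rewrite integralT_split //.
rewrite (@ge0_continuous_FTC2y _ (fun x => g x + g (- x)) F 0 l) //.
- by move=> x _; rewrite addr_ge0.
- apply: continuous_subspaceT => x; apply: cvgD; first exact: cg.
  by apply: continuous_comp; [exact: oppr_continuous|exact: cg].
- by move=> x x0; case: (dF x x0).
- by apply: cvg_at_right_filter; exact: cF.
- by move=> x; rewrite in_itv /= andbT => x0; rewrite derive1E; case: (dF x x0).
Qed.

Lemma ge0_integrableT (g : R -> R) (l : R) : continuous g -> (forall x, 0 <= g x) ->
  (\int[mu]_x (g x)%:E = l%:E)%E ->
  mu.-integrable [set: R] (EFin \o g) /\ \int[mu]_x g x = l.
Proof.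
move=> cg g0 E; split; last by rewrite /Rintegral E.
apply/integrableP; split.
  by apply/measurable_EFinP; exact: continuous_measurable_fun.
under eq_integral => x _ do rewrite /= ger0_norm ?g0 //.
by rewrite E ltry.
Qed.

Lemma cauchy_integral (e y : R) : 0 < e ->
  mu.-integrable [set: R] (EFin \o (fun x => 2 * e / (e ^+ 2 + (y - x) ^+ 2))) /\
  \int[mu]_x (2 * e / (e ^+ 2 + (y - x) ^+ 2)) = 2 * pi.
Proof.
move=> e0.
have den x : 0 < e ^+ 2 + (y - x) ^+ 2 by rewrite ltr_pwDl ?exprn_gt0 ?sqr_ge0.
have cg : continuous (fun x => 2 * e / (e ^+ 2 + (y - x) ^+ 2)).
  move=> x; apply: cvgM; first exact: cvg_cst.
  apply: cvgV; first by rewrite gt_eqF.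
  apply: cvgD; first exact: cvg_cst.
  rewrite expr2; under eq_fun do rewrite expr2.
  by apply: cvgM; apply: cvgB; (exact: cvg_cst || exact: cvg_id).
have g0 x : 0 <= 2 * e / (e ^+ 2 + (y - x) ^+ 2).
  by rewrite divr_ge0 ?mulr_ge0 // ltW.
apply: ge0_integrableT => //.
(* A primitive of the folded integrand; it vanishes at 0 because [atan] is odd. *)
pose F (x : R) := 2 * (atan ((x - y) / e) + atan ((x + y) / e)).
have -> : 2 * pi = 2 * pi - F 0.
  by rewrite /F sub0r add0r mulNr atanN addNr mulr0 subr0.
have lin (c x : R) : is_derive x (1:R) (fun x => (x + c) / e) e^-1.
  have E : (fun x => (x + c) / e) = e^-1 \*: (id + cst c) :> (R -> R).
    by apply/funext => z; rewrite /= [LHS]mulrC.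
  have := is_deriveZ e^-1 (is_deriveD (is_derive_id x (1:R)) (is_derive_cst c x (1:R))).
  by rewrite E; move/is_derive_eq; apply; rewrite addr0 /GRing.scale /= mulr1.
have da z : is_derive z (1:R) (@atan R) (1 + z ^+ 2)^-1.
  by split; [exact: derivable_atan|rewrite -derive1E derive1_atan].
have dF x : is_derive x (1:R) F
    (2 * e / (e ^+ 2 + (y - x) ^+ 2) + 2 * e / (e ^+ 2 + (y - - x) ^+ 2)).
  have h1 := @is_derive1_comp R (@atan R) (fun x => (x - y) / e) x _ _ (da _) (lin (- y) x).
  have h2 := @is_derive1_comp R (@atan R) (fun x => (x + y) / e) x _ _ (da _) (lin y x).
  have := is_deriveZ (2:R) (is_deriveD h1 h2).
  move/is_derive_eq; apply; rewrite /GRing.scale /=.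
  have inner t : (1 + (t / e) ^+ 2)^-1 * e^-1 = e / (e ^+ 2 + t ^+ 2).
    have d0 : 0 < e ^+ 2 + t ^+ 2 by rewrite ltr_pwDl ?exprn_gt0 ?sqr_ge0.
    by field; rewrite !gt_eqF.
  rewrite !inner -(sqrrN (x - y)) opprB opprK (addrC x); ring.
apply: integralT_FTC => //.
- by move=> x; apply: differentiable_continuous; apply/derivable1_diffP; case: (dF x).
- have at_oo c : atan ((x + c) / e) @[x --> +oo] --> pi / 2.
    apply: (@cvg_comp _ _ _ (fun x => (x + c) / e) (@atan R)); last exact: cvgy_atan.
    apply/cvgryPge => B; near=> x.
    rewrite ler_pdivlMr // -lerBlDr; near: x; apply: nbhs_pinfty_ge; exact: num_real.
  have -> : 2 * pi = 2 * (pi / 2 + pi / 2) :> R by field.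
  by apply: cvgM; [exact: cvg_cst|apply: cvgD; exact: at_oo].
Unshelve. all: by end_near. Qed.

(** Adding 1 to the cosine makes the integrand nonnegative, as [integralT_FTC] requires;
    [abel_cos_integral] subtracts the extra exponential again. *)
Lemma abel_integral (e a phi : R) : 0 < e ->
  mu.-integrable [set: R] (EFin \o (fun x => expR (- (e * `|x|)) * (1 + cos (a * x + phi)))) /\
  \int[mu]_x (expR (- (e * `|x|)) * (1 + cos (a * x + phi)))
    = 2 / e + cos phi * (2 * e / (e ^+ 2 + a ^+ 2)).
Proof.
move=> e0.
have d0 : 0 < e ^+ 2 + a ^+ 2 by rewrite ltr_pwDl ?exprn_gt0 ?sqr_ge0.
have cg : continuous (fun x => expR (- (e * `|x|)) * (1 + cos (a * x + phi))).
  move=> x; apply: cvgM.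
    apply: (@cvg_comp _ _ _ (fun x => - (e * `|x|)) expR); last exact: continuous_expR.
    apply: cvgN; apply: cvgM; first exact: cvg_cst.
    by apply: cvg_norm; exact: cvg_id.
  apply: cvgD; first exact: cvg_cst.
  apply: (@cvg_comp _ _ _ (fun x => a * x + phi) cos); last exact: continuous_cos.
  by apply: cvgD; [apply: cvgM; [exact: cvg_cst|exact: cvg_id]|exact: cvg_cst].
have g0 x : 0 <= expR (- (e * `|x|)) * (1 + cos (a * x + phi)).
  apply: mulr_ge0; first exact: expR_ge0.
  by have := cos_geN1 (a * x + phi); lra.
apply: ge0_integrableT => //.
pose c := 2 * cos phi / (e ^+ 2 + a ^+ 2).
(* Folding cancels the part of the cosine odd in [x], leaving [cos phi * cos (a * x)]; the second
   term is the classical primitive of the exponential times this cosine. *)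
pose F x := - (2 / e) * expR (- e * x) +
  c * (expR (- e * x) * (a * sin (a * x) - e * cos (a * x))).
have lin (k x : R) : is_derive x (1:R) (fun x => k * x) k.
  by have := is_deriveZ k (is_derive_id x (1:R)); rewrite /GRing.scale /= mulr1.
have dE x := @is_derive1_comp R expR (fun x => - e * x) x _ _ (is_derive_expR _) (lin (- e) x).
have dC x := @is_derive1_comp R cos (fun x => a * x) x _ _ (is_derive_cos _) (lin a x).
have dS x := @is_derive1_comp R sin (fun x => a * x) x _ _ (is_derive_sin _) (lin a x).
have dF x : is_derive x (1:R) F (expR (- e * x) * (2 + 2 * cos phi * cos (a * x))).
  have h := is_deriveD (is_deriveZ (- (2 / e)) (dE x))
    (is_deriveZ c (is_deriveM (dE x) (is_deriveB (is_deriveZ a (dS x)) (is_deriveZ e (dC x))))).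
  have sc (k z : R) : k *: z = k * z by [].
  apply: (is_derive_eq h); rewrite !fctE /= !sc /c.
  by field; rewrite !gt_eqF.
have -> : 2 / e + cos phi * (2 * e / (e ^+ 2 + a ^+ 2)) = 0 - F 0.
  rewrite /F !mulr0 expR0 sin0 cos0 /c; field.
  by rewrite !gt_eqF.
apply: integralT_FTC; [exact: cg|exact: g0|..].
- by move=> x; apply: differentiable_continuous; apply/derivable1_diffP; case: (dF x).
- move=> x x0; apply: (is_derive_eq (dF x)).
  rewrite normrN gtr0_norm // mulrN [a * x + phi]addrC [- (a * x) + phi]addrC cosD cosB -mulNr; ring.
- have E0 : expR (- e * x) @[x --> +oo] --> (0:R).
    have -> : (fun x => expR (- e * x)) = (fun x => expR (- x)) \o (fun x => e * x).
      by apply/funext => x /=; rewrite mulNr.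
    apply: (@cvg_comp _ _ _ (fun x => e * x) (fun x => expR (- x))); last exact: cvgr_expR.
    apply/cvgryPge => B; near=> x.
    rewrite -ler_pdivrMl //; near: x; apply: nbhs_pinfty_ge; exact: num_real.
  pose B := 2 / e + `|c| * (`|a| + e).
  apply: (@squeeze_cvgr _ _ _ _ (fun x => - (expR (- e * x) * B)) (fun x => expR (- e * x) * B)).
  + apply: nearW => x; rewrite -ler_norml /F.
    have -> : - (2 / e) * expR (- e * x) + c * (expR (- e * x) * (a * sin (a * x) - e * cos (a * x)))
      = expR (- e * x) * (- (2 / e) + c * (a * sin (a * x) - e * cos (a * x))) by ring.
    rewrite normrM ger0_norm ?expR_ge0 // ler_wpM2l ?expR_ge0 // (le_trans (ler_normD _ _)) //.
    rewrite normrN gtr0_norm ?divr_gt0 // lerD2l normrM ler_wpM2l // (le_trans (ler_normB _ _)) //.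
    rewrite !normrM (gtr0_norm e0) lerD //.
      by rewrite ler_piMr // sin_max.
    by rewrite ler_piMr ?cos_max // ltW.
  + by rewrite -oppr0 -(mul0r B); apply: cvgN; apply: cvgM; [exact: E0|exact: cvg_cst].
  + by rewrite -[X in _ --> X](mul0r B); apply: cvgM; [exact: E0|exact: cvg_cst].
Unshelve. all: by end_near. Qed.

Lemma abel_cos_integral (e a phi : R) : 0 < e ->
  mu.-integrable [set: R] (EFin \o (fun x => expR (- (e * `|x|)) * cos (a * x + phi))) /\
  \int[mu]_x (expR (- (e * `|x|)) * cos (a * x + phi))
    = cos phi * (2 * e / (e ^+ 2 + a ^+ 2)).
Proof.
move=> e0; have [i1 E1] := abel_integral e a phi e0.
have [i2 E2] := abel_integral e 0 0 e0.
have fE : (fun x => expR (- (e * `|x|)) * cos (a * x + phi)) =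
  (fun x => expR (- (e * `|x|)) * (1 + cos (a * x + phi)) -
            2^-1 * (expR (- (e * `|x|)) * (1 + cos (0 * x + 0)))).
  by apply/funext => x; rewrite mul0r addr0 cos0; field.
have i3 : mu.-integrable [set: R] (EFin \o (fun x => 2^-1 * (expR (- (e * `|x|)) * (1 + cos (0 * x + 0))))).
  by apply: eq_integrable (integrableZl _ 2^-1 i2).
rewrite fE; split; first by apply: eq_integrable (integrableB _ i1 i3).
rewrite RintegralB // RintegralZl // E1 E2 cos0 expr0n /= addr0.
have d0 : 0 < e ^+ 2 + a ^+ 2 by rewrite ltr_pwDl ?exprn_gt0 ?sqr_ge0.
by field; rewrite !gt_eqF.
Qed.

End RealIntegrals.

(** * Real-valued integrals and Fubini *)

Section L1.
Context {R : realType} {d} {T : measurableType d}.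
Variable m : {measure set T -> \bar R}.
Implicit Types f g : T -> R.

Definition L1 f := m.-integrable [set: T] (EFin \o f).
Local Notation I f := (Rintegral m [set: T] f).

Lemma L1_measurable f : L1 f -> measurable_fun [set: T] f.
Proof. by move=> /measurable_int/measurable_EFinP. Qed.

Lemma L1_le f g : measurable_fun [set: T] f -> L1 g ->
  (forall x, `|f x| <= g x) -> L1 f.
Proof.
move=> mf Lg fg; apply: (le_integrable measurableT _ _ Lg); first exact/measurable_EFinP.
by move=> x _; rewrite /= lee_fin (le_trans (fg x) (ler_norm _)).
Qed.

Lemma L1_norm f : L1 f -> L1 (fun x => `|f x|).
Proof. exact: integrable_norm. Qed.

Lemma I_le f g : L1 f -> L1 g -> (forall x, f x <= g x) -> I f <= I g.
Proof. by move=> Lf Lg fg; apply: le_Rintegral. Qed.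

Lemma I_norm_le f g : L1 f -> L1 g -> (forall x, `|f x| <= g x) -> `|I f| <= I g.
Proof.
move=> Lf Lg fg; rewrite (le_trans (le_normr_Rintegral _ Lf)) //.
by apply: I_le => //; exact: L1_norm.
Qed.

Lemma L1D f g : L1 f -> L1 g -> L1 (fun x => f x + g x).
Proof. by move=> Lf Lg; apply: eq_integrable (integrableD _ Lf Lg). Qed.

Lemma L1B f g : L1 f -> L1 g -> L1 (fun x => f x - g x).
Proof. by move=> Lf Lg; apply: eq_integrable (integrableB _ Lf Lg). Qed.

Lemma L1Z (k : R) f : L1 f -> L1 (fun x => k * f x).
Proof. by move=> Lf; apply: eq_integrable (integrableZl _ k Lf). Qed.

Lemma ID f g : L1 f -> L1 g -> I (fun x => f x + g x) = I f + I g.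
Proof. by move=> Lf Lg; exact: RintegralD. Qed.

Lemma IB f g : L1 f -> L1 g -> I (fun x => f x - g x) = I f - I g.
Proof. by move=> Lf Lg; exact: RintegralB. Qed.

Lemma IZ (k : R) f : L1 f -> I (fun x => k * f x) = k * I f.
Proof. by move=> Lf; exact: RintegralZl. Qed.

Lemma L1_fin f : L1 f -> (\int[m]_x (f x)%:E)%E = (I f)%:E.
Proof. by move=> Lf; rewrite /Rintegral fineK // integrable_fin_num. Qed.

Lemma L1_ge0 f : measurable_fun [set: T] f -> (forall x, 0 <= f x) ->
  (\int[m]_x (f x)%:E < +oo)%E -> L1 f.
Proof.
move=> mf f0 foo; apply/integrableP; split; first exact/measurable_EFinP.
by under eq_integral => x _ do rewrite /= ger0_norm ?f0 //.
Qed.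

Lemma I_le_of f (M : R) : L1 f -> (\int[m]_x (f x)%:E <= M%:E)%E -> I f <= M.
Proof. by move=> Lf; rewrite L1_fin // lee_fin. Qed.

End L1.
Arguments L1 {R d T}.

Section Product.
Context {R : realType} {d1 d2} {T1 : measurableType d1} {T2 : measurableType d2}.
Variables (m1 : {sigma_finite_measure set T1 -> \bar R})
  (m2 : {sigma_finite_measure set T2 -> \bar R}).

Lemma L1_prod (F : T1 * T2 -> R) f g : measurable_fun [set: T1 * T2] F ->
  L1 m1 f -> L1 m2 g -> (forall x y, `|F (x, y)| <= f x * g y) ->
  L1 (m1 \x m2)%E F.
Proof.
move=> mF Lf Lg H; apply/integrable12ltyP; first exact/measurable_EFinP.
have mF1 x : measurable_fun [set: T2] (fun y => `|F (x, y)|).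
  by apply: measurableT_comp => //; apply: measurableT_comp.
have Lg' := L1_norm _ _ Lg; have Lf' := L1_norm _ _ Lf.
have fg x : L1 m2 (fun y => `|f x| * `|g y|) by exact: L1Z.
apply: (@le_lt_trans _ _ (\int[m1]_x (`|f x| * Rintegral m2 setT (fun y => `|g y|))%:E)%E).
  apply: ge0_le_integral => //.
  - by move=> x _; apply: integral_ge0 => y _.
  - apply: (measurable_fun_fubini_tonelli_F (fun z => (`|F z|)%:E)).
      by apply/measurable_EFinP; apply: measurableT_comp.
    by move=> z; rewrite lee_fin.
  - apply/measurable_EFinP; apply: measurable_funM => //; exact: L1_measurable Lf'.
  - move=> x _; rewrite -IZ // -L1_fin //.
    apply: ge0_le_integral => //.
    + exact/measurable_EFinP.
    + by apply/measurable_EFinP; exact: L1_measurable (fg x).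
    + move=> y _; rewrite lee_fin -normrM.
      exact: le_trans (H x y) (ler_norm _).
have Lh : L1 m1 (fun x => `|f x| * Rintegral m2 setT (fun y => `|g y|)).
  have := L1Z _ (Rintegral m2 setT (fun y => `|g y|)) _ Lf'.
  by apply: eq_integrable => // x _ /=; rewrite mulrC.
by rewrite L1_fin // ltry.
Qed.

(** Integrability of every section, not of almost every one, makes all inner integrals finite, so
    that the exchange can be stated between real numbers. *)
Lemma I_fubini (F : T1 * T2 -> R) : L1 (m1 \x m2)%E F ->
  (forall x, L1 m2 (fun y => F (x, y))) ->
  L1 m1 (fun x => Rintegral m2 setT (fun y => F (x, y))) /\
  Rintegral m1 setT (fun x => Rintegral m2 setT (fun y => F (x, y))) =
    Rintegral (m1 \x m2)%E setT F.
Proof.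
move=> LF L2.
have E x : (\int[m2]_y (F (x, y))%:E)%E = (Rintegral m2 setT (fun y => F (x, y)))%:E.
  exact: L1_fin.
split.
  have := integrable_fubini_F LF.
  by apply: eq_integrable => // x _ /=; rewrite -E.
rewrite /Rintegral -(integral12_prod_meas1 LF); congr fine.
by apply: eq_integral => x _; rewrite -/(Rintegral m2 setT (fun y => F (x, y))) -E.
Qed.

Lemma I_fubini2 (F : T1 * T2 -> R) : L1 (m1 \x m2)%E F ->
  (forall y, L1 m1 (fun x => F (x, y))) ->
  Rintegral m2 setT (fun y => Rintegral m1 setT (fun x => F (x, y))) =
    Rintegral (m1 \x m2)%E setT F.
Proof.
move=> LF L2.
have E y : (\int[m1]_x (F (x, y))%:E)%E = (Rintegral m1 setT (fun x => F (x, y)))%:E.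
  exact: L1_fin.
rewrite /Rintegral -(integral21_prod_meas1 LF); congr fine.
by apply: eq_integral => y _; rewrite -/(Rintegral m1 setT (fun x => F (x, y))) -E.
Qed.

Lemma I_prod f g : L1 m1 f -> L1 m2 g ->
  L1 (m1 \x m2)%E (fun X => f X.1 * g X.2) /\
  Rintegral (m1 \x m2)%E setT (fun X => f X.1 * g X.2) =
  Rintegral m1 setT f * Rintegral m2 setT g.
Proof.
move=> Lf Lg; have Lf' := L1_norm _ _ Lf; have Lg' := L1_norm _ _ Lg.
have LF : L1 (m1 \x m2)%E (fun X => f X.1 * g X.2).
  apply: L1_prod Lf' Lg' _; last by move=> x y /=; rewrite normrM.
  apply: measurable_funM; apply: measurableT_comp => //.
    exact: L1_measurable Lf.
  exact: L1_measurable Lg.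
split => //; have [_ <-] := I_fubini _ LF (fun x => L1Z _ (f x) _ Lg).
rewrite -[RHS]mulrC -IZ //; apply: eq_Rintegral => x _ /=.
by rewrite IZ // mulrC.
Qed.

End Product.

(* The library's canonical sigma-finite structure on a product measure is
   shadowed by the one on products of subprobabilities. *)
Definition plane_measure {R : realType} :=
  ((@lebesgue_measure R) \x (@lebesgue_measure R))%E.

Section PlaneMeasure.
Context {R : realType}.
Local Notation pm := (@plane_measure R).

Let pm0 : pm set0 = 0%E. Proof. exact: measure0. Qed.
Let pm_ge0 A : (0 <= pm A)%E. Proof. exact: measure_ge0. Qed.
Let pm_sigma_additive : semi_sigma_additive pm.
Proof. exact: measure_semi_sigma_additive. Qed.

HB.instance Definition _ := isMeasure.Build _ _ _ pm pm0 pm_ge0 pm_sigma_additive.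

Let pm_sigma_finite : sigma_finite setT pm.
Proof.
have /sigma_finiteP[F [TF ndF Foo]] := sigma_finiteT (@lebesgue_measure R).
exists (fun n => F n `*` F n).
  rewrite -setXTT TF predeqE => -[x y]; split.
    move=> [/= [n _ Fnx] [k _ Fky]]; exists (maxn n k) => //; split.
    - by move: x Fnx; exact/subsetPset/ndF/leq_maxl.
    - by move: y Fky; exact/subsetPset/ndF/leq_maxr.
  by move=> [n _ []/= ? ?]; split; exists n.
move=> k; have [mF Fk] := Foo k; split; first exact: measurableX.
by rewrite [pm _]product_measure1E// lte_mul_pinfty// ge0_fin_numE.
Qed.

HB.instance Definition _ := Measure_isSigmaFinite.Build _ _ _ pm pm_sigma_finite.

End PlaneMeasure.

(** * Abel factors and Poisson kernels in the plane *)

Section Plane.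
Context {R : realType}.
Notation mu := (@lebesgue_measure R).
Notation l2 := plane_measure.
Local Notation I2 f := (Rintegral l2 [set: plane R] f).

Lemma measurable_x : measurable_fun [set: plane R] (fun X => X.1).
Proof. exact: measurable_fst. Qed.

Lemma measurable_y : measurable_fun [set: plane R] (fun X => X.2).
Proof. exact: measurable_snd. Qed.

Lemma measurable_cont (f : R -> R) (g : plane R -> R) : continuous f ->
  measurable_fun [set: plane R] g -> measurable_fun [set: plane R] (fun X => f (g X)).
Proof. by move=> cf mg; apply: measurableT_comp => //; exact: continuous_measurable_fun. Qed.

Definition abel (e : R) (X : plane R) := expR (- (e * `|X.1|)) * expR (- (e * `|X.2|)).

(** The transform of [abel e] at [Y - X], unnormalised: its total mass is [(2 * pi) ^+ 2]. The
    instance at [e = 1], centred at 0, also serves as a standard integrable majorant. *)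
Definition poisson (e : R) (Y X : plane R) :=
  2 * e / (e ^+ 2 + (Y.1 - X.1) ^+ 2) * (2 * e / (e ^+ 2 + (Y.2 - X.2) ^+ 2)).

Lemma cauchy_den (e t : R) : 0 < e -> 0 < e ^+ 2 + t ^+ 2.
Proof. by move=> e0; rewrite ltr_pwDl ?exprn_gt0 ?sqr_ge0. Qed.

Lemma poisson_ge0 (e : R) Y X : 0 < e -> 0 <= poisson e Y X.
Proof.
by move=> e0; apply: mulr_ge0; (apply: divr_ge0; [rewrite mulr_ge0 // ltW|exact/ltW/cauchy_den]).
Qed.

Lemma poisson_L1 (e : R) Y : 0 < e -> L1 l2 (poisson e Y) /\ I2 (poisson e Y) = (2 * pi) ^+ 2.
Proof.
move=> e0; have [i1 E1] := cauchy_integral e Y.1 e0.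
have [i2 E2] := cauchy_integral e Y.2 e0.
by have [i3 E3] := I_prod mu mu _ _ i1 i2; split => //; rewrite [LHS]E3 E1 E2 expr2.
Qed.

Lemma abel_ge0 e X : 0 <= abel e X. Proof. by rewrite mulr_ge0 ?expR_ge0. Qed.

Lemma abel_cos1 (e : R) : 0 < e -> L1 mu (fun x => expR (- (e * `|x|))).
Proof.
move=> e0; have [i1 _] := abel_cos_integral e 0 0 e0.
by apply: eq_integrable i1 => // x _ /=; rewrite mul0r addr0 cos0 mulr1.
Qed.

Lemma abel_L1 (e : R) : 0 < e -> L1 l2 (abel e).
Proof. by move=> e0; have [] := I_prod mu mu _ _ (abel_cos1 e e0) (abel_cos1 e e0). Qed.

Lemma measurable_dot (a : plane R) : measurable_fun [set: plane R] (fun X => dot2 a X).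
Proof.
by apply: measurable_funD; apply: measurable_funM.
Qed.

Lemma measurable_abel e : measurable_fun [set: plane R] (abel e).
Proof.
have ce : continuous (fun x : R => expR (- (e * `|x|))).
  move=> x; apply: (@cvg_comp _ _ _ (fun x => - (e * `|x|)) expR); last exact: continuous_expR.
  apply: cvgN; apply: cvgM; first exact: cvg_cst.
  by apply: cvg_norm; exact: cvg_id.
apply: measurable_funM; apply: (measurable_cont _ _ ce); [exact: measurable_x|exact: measurable_y].
Qed.

Lemma abel_cos_L1 (e : R) (a : plane R) : 0 < e -> L1 l2 (fun X => abel e X * cos (dot2 a X)).
Proof.
move=> e0; apply: L1_le (abel_L1 e e0) _.
  apply: measurable_funM; first exact: measurable_abel.
  by apply: (measurable_cont _ _ (@continuous_cos R)); exact: measurable_dot.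
by move=> X; rewrite normrM (ger0_norm (abel_ge0 _ _)) ler_piMr ?abel_ge0 ?cos_max.
Qed.

(** The inner integral sees [a.1 * x] as a phase, and returns it as a cosine for the outer one; the
    parameter [phi] of [abel_cos_integral] is there for this. *)
Lemma abel_fourier (e : R) (a : plane R) : 0 < e ->
  I2 (fun X => abel e X * cos (dot2 a X)) =
  2 * e / (e ^+ 2 + a.1 ^+ 2) * (2 * e / (e ^+ 2 + a.2 ^+ 2)).
Proof.
move=> e0; have LF := abel_cos_L1 e a e0.
have c2 x := abel_cos_integral e a.2 (a.1 * x) e0.
have E x y : abel e (x, y) * cos (dot2 a (x, y)) =
    expR (- (e * `|x|)) * (expR (- (e * `|y|)) * cos (a.2 * y + a.1 * x)).
  by rewrite /abel /dot2 /= addrC mulrA.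
have [|_ E0] := I_fubini mu mu _ LF.
  move=> x; have := L1Z _ (expR (- (e * `|x|))) _ (c2 x).1.
  by apply: eq_integrable => // y _ /=; rewrite E.
have [i1 E1] := abel_cos_integral e a.1 0 e0.
apply: (etrans (esym E0)).
transitivity (Rintegral mu setT (fun x => 2 * e / (e ^+ 2 + a.2 ^+ 2) *
    (expR (- (e * `|x|)) * cos (a.1 * x + 0)))).
  apply: eq_Rintegral => x _.
  under eq_Rintegral => y _ do rewrite E.
  by rewrite IZ ?(c2 x).2 ?addr0; [ring|exact: (c2 x).1].
by rewrite IZ // E1 cos0 mul1r mulrC.
Qed.

End Plane.

(** * Inversion at a point of continuity *)

Section Inversion.
Context {R : realType}.
Notation mu := (@lebesgue_measure R).
Notation l2 := plane_measure.
Local Notation I2 f := (Rintegral l2 [set: plane R] f).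
Variables (u v w : plane R -> R) (Y : plane R).
Hypothesis measu : measurable_fun [set: plane R] u.
Hypothesis u2 : (\int[leb2]_X (u X ^+ 2)%:E < +oo)%E.
Hypothesis Fu : fourier_L2 u v w.

Let mv : measurable_fun [set: plane R] v. Proof. by case: Fu. Qed.
Let mw : measurable_fun [set: plane R] w. Proof. by case: Fu. Qed.

Let Lu2 : L1 l2 (fun X => u X ^+ 2).
Proof.
apply: L1_ge0 => //; last by move=> X; exact: sqr_ge0.
exact: measurable_funX.
Qed.

Lemma measurable_disc n : measurable (disc n : set (plane R)).
Proof.
have m : measurable_fun [set: plane R] (fun X : plane R => dot2 X X).
  by apply: measurable_funD; apply: measurable_funM.
have := m measurableT _ (measurable_itv `]-oo, n%:R ^+ 2]%R).
rewrite setTI; congr measurable; apply/seteqP.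
Qed.

Definition cut n (X : plane R) : R := \1_(disc n) X * u X.

Lemma measurable_cut n : measurable_fun [set: plane R] (cut n).
Proof.
apply: measurable_funM; last exact: measu.
by apply: measurable_indic; exact: measurable_disc.
Qed.

(** On the disc [|u|] is at most [u ^+ 2 + 1], and the factor [(1 + n ^ 2) ^ 2 / 4] lifts the
    Poisson kernel above 1 there. *)
Lemma cut_L1 n : L1 l2 (cut n).
Proof.
have [LP _] := poisson_L1 1 0 (@ltr01 R).
have Lg := L1D _ _ _ Lu2 (L1Z _ ((1 + n%:R ^+ 2) ^+ 2 / 4) _ LP).
apply: (L1_le _ _ _ _ Lg) => [|X]; first exact: measurable_cut.
rewrite /cut normrM indicE ger0_norm //.
have p0 : 0 <= (1 + n%:R ^+ 2) ^+ 2 / 4 * poisson 1 0 X.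
  by rewrite mulr_ge0 ?poisson_ge0 // divr_ge0 // sqr_ge0.
have [|_] := boolP (X \in disc n); last by rewrite mul0r addr_ge0 ?sqr_ge0.
rewrite inE /disc /= mul1r => dX.
have [x2 y2] : X.1 ^+ 2 <= n%:R ^+ 2 /\ X.2 ^+ 2 <= n%:R ^+ 2.
  have := sqr_ge0 X.1; have := sqr_ge0 X.2; move: dX; rewrite /dot2 -!expr2; lra.
have h : 1 <= (1 + n%:R ^+ 2) ^+ 2 / 4 * poisson 1 0 X.
  have -> : (1 + n%:R ^+ 2) ^+ 2 / 4 * poisson 1 0 X =
     (1 + n%:R ^+ 2) ^+ 2 / ((1 + X.1 ^+ 2) * (1 + X.2 ^+ 2)).
    rewrite /poisson /= expr1n !sub0r !sqrrN; field.
    have := sqr_ge0 X.1; have := sqr_ge0 X.2 => a1 a2.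
    by apply/andP; split; apply: lt0r_neq0; lra.
  have := sqr_ge0 X.1; have := sqr_ge0 X.2 => a1 a2.
  rewrite ler_pdivlMr ?mulr_gt0 ?mul1r ?expr2 ?ler_pM //; lra.
have := sqr_ge0 (`|u X| - 1); rewrite sqrrB1 real_normK ?num_real //.
have := normr_ge0 (u X); lra.
Qed.

Lemma cut_f_L1 n (f : plane R -> R) : measurable_fun [set: plane R] f ->
  (forall X, `|f X| <= 1) -> L1 l2 (fun X => cut n X * f X).
Proof.
move=> mf f1; apply: (L1_le _ _ _ _ (L1_norm _ _ (cut_L1 n))).
  by apply: measurable_funM => //; exact: measurable_cut.
by move=> X; rewrite normrM ler_piMr.
Qed.

Lemma fourier_cut (f : R -> R) n xi :
  Rintegral leb2 (disc n) (fun X => u X * f (dot2 X xi)) =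
  I2 (fun X => cut n X * f (dot2 X xi)).
Proof.
rewrite Rintegral_mkcond; apply: eq_Rintegral => X _.
by rewrite patchE /cut indicE; case: ifPn => _; rewrite ?mul1r ?mul0r.
Qed.

Lemma abel_cut_L1 e n (f : plane R * plane R -> R) : 0 < e ->
  measurable_fun setT f -> (forall z, `|f z| <= 1) ->
  L1 (l2 \x l2)%E (fun z => abel e z.1 * (cut n z.2 * f z)).
Proof.
move=> e0 mf f1.
apply: (L1_prod l2 l2 _ _ _ _ (abel_L1 e e0) (L1_norm _ _ (cut_L1 n))).
  apply: measurable_funM.
    by apply: measurableT_comp; [exact: measurable_abel|exact: measurable_fst].
  apply: measurable_funM => //.
  by apply: measurableT_comp; [exact: measurable_cut|exact: measurable_snd].
move=> x y /=; rewrite normrM (ger0_norm (abel_ge0 _ _)) ler_wpM2l ?abel_ge0 //.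
by rewrite normrM ler_piMr.
Qed.

Lemma measurable_dotdot (g : plane R * plane R -> plane R) :
  measurable_fun setT g -> measurable_fun setT (fun z : plane R * plane R => dot2 (g z) z.1).
Proof.
move=> mg; apply: measurable_funD; apply: measurable_funM.
- exact: (measurableT_comp measurable_x mg).
- exact: (measurableT_comp measurable_x measurable_fst).
- exact: (measurableT_comp measurable_y mg).
- exact: (measurableT_comp measurable_y measurable_fst).
Qed.

(** Fubini yields measurability of a parametrised integral only for a jointly integrable function,
    so the integrand is damped in [xi] by [abel 1], and the result is divided by this positive
    factor. *)
Lemma measurable_trig (f : R -> R) n : continuous f -> (forall x, `|f x| <= 1) ->
  measurable_fun [set: plane R] (fun xi => I2 (fun X => cut n X * f (dot2 X xi))).
Proof.
move=> cf f1.
have LF := abel_cut_L1 1 n (fun z => f (dot2 z.2 z.1)) ltr01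
  (measurableT_comp (continuous_measurable_fun cf) (measurable_dotdot _ measurable_snd)) (fun z => f1 _).
have mf xi : measurable_fun [set: plane R] (fun X => f (dot2 X xi)).
  apply: (measurableT_comp (continuous_measurable_fun cf)).
  by apply: measurable_funD; apply: measurable_funM.
have [|LI _] := I_fubini l2 l2 _ LF.
  by move=> xi; exact: (L1Z _ (abel 1 xi) _ (cut_f_L1 n _ (mf xi) (fun X => f1 _))).
have mE := L1_measurable _ _ LI.
have -> : (fun xi => I2 (fun X => cut n X * f (dot2 X xi))) =
  (fun xi => (abel 1 xi)^-1 * I2 (fun X => abel 1 xi * (cut n X * f (dot2 X xi)))).
  apply/funext => xi; rewrite IZ; last exact: (cut_f_L1 n _ (mf xi) (fun X => f1 _)).
  by rewrite mulKf // mulf_neq0 // gt_eqF // expR_gt0.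
apply: measurable_funM => //.
have -> : (fun xi : plane R => (abel 1 xi)^-1) = (fun xi => expR (1 * `|xi.1|) * expR (1 * `|xi.2|)).
  by apply/funext => xi; rewrite /abel invfM !expRN !invrK.
have ce : continuous (fun x : R => expR (1 * `|x|)).
  move=> x; apply: (@cvg_comp _ _ _ (fun x => 1 * `|x|) expR); last exact: continuous_expR.
  apply: cvgM; first exact: cvg_cst.
  by apply: cvg_norm; exact: cvg_id.
by apply: measurable_funM; apply: (measurable_cont _ _ ce).
Qed.

Let fre n := fourier_re u n.
Let fim n := fourier_im u n.

Let freE n xi : fre n xi = (2 * pi)^-1 * I2 (fun X => cut n X * cos (dot2 X xi)).
Proof. by rewrite /fre /fourier_re fourier_cut. Qed.
Let fimE n xi : fim n xi = - (2 * pi)^-1 * I2 (fun X => cut n X * sin (dot2 X xi)).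
Proof. by rewrite /fim /fourier_im fourier_cut. Qed.

Let mfre n : measurable_fun [set: plane R] (fre n).
Proof.
rewrite (_ : fre n = fun xi => (2 * pi)^-1 * I2 (fun X => cut n X * cos (dot2 X xi))).
  by apply: measurable_funM => //; apply: measurable_trig; [exact: continuous_cos|exact: cos_max].
by apply/funext => xi; rewrite freE.
Qed.
Let mfim n : measurable_fun [set: plane R] (fim n).
Proof.
rewrite (_ : fim n = fun xi => - (2 * pi)^-1 * I2 (fun X => cut n X * sin (dot2 X xi))).
  by apply: measurable_funM => //; apply: measurable_trig; [exact: continuous_sin|exact: sin_max].
by apply/funext => xi; rewrite fimE.
Qed.

Let A n xi := fre n xi * cos (dot2 Y xi) - fim n xi * sin (dot2 Y xi).

(** [A n xi] is the real part of the truncated transform times exp(i Y.xi), that is, an integral of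
    [cut n X] against the cosine of [(Y - X).xi]. Integrating the Abel factor in [xi] first produces
    the Poisson kernel. *)
Lemma abel_fre e n : 0 < e -> L1 l2 (fun xi => abel e xi * A n xi) /\
  I2 (fun xi => abel e xi * A n xi) = (2 * pi)^-1 * I2 (fun X => cut n X * poisson e Y X).
Proof.
move=> e0.
pose F (z : plane R * plane R) :=
  abel e z.1 * (cut n z.2 * cos (dot2 (Y.1 - z.2.1, Y.2 - z.2.2) z.1)).
have mYX : measurable_fun setT (fun z : plane R * plane R => (Y.1 - z.2.1, Y.2 - z.2.2)).
  apply: measurable_fun_pair; apply: measurable_funB => //.
    exact: (measurableT_comp measurable_x measurable_snd).
  exact: (measurableT_comp measurable_y measurable_snd).
have LF : L1 (l2 \x l2)%E F.
  apply: abel_cut_L1 => // [|z]; last exact: cos_max.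
  by apply: (measurableT_comp (continuous_measurable_fun (@continuous_cos R))); exact: measurable_dotdot.
have mt (f : R -> R) xi : continuous f -> measurable_fun [set: plane R] (fun X => f (dot2 X xi)).
  move=> cf; apply: (measurableT_comp (continuous_measurable_fun cf)).
  by apply: measurable_funD; apply: measurable_funM.
have mcos xi : measurable_fun [set: plane R] (fun X : plane R => cos (dot2 (Y.1 - X.1, Y.2 - X.2) xi)).
  apply: (measurableT_comp (continuous_measurable_fun (@continuous_cos R))).
  by apply: measurable_funD; apply: measurable_funM => //; apply: measurable_funB.
have AE xi : I2 (fun X => F (xi, X)) = 2 * pi * (abel e xi * A n xi).
  rewrite /F /= IZ; last exact: (cut_f_L1 n _ (mcos xi) (fun X => cos_max _)).
  have -> : (fun X : plane R => cut n X * cos (dot2 (Y.1 - X.1, Y.2 - X.2) xi)) =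
    (fun X => cos (dot2 Y xi) * (cut n X * cos (dot2 X xi)) +
              sin (dot2 Y xi) * (cut n X * sin (dot2 X xi))).
    apply/funext => X.
    have -> : dot2 (Y.1 - X.1, Y.2 - X.2) xi = dot2 Y xi - dot2 X xi by rewrite /dot2 /=; ring.
    by rewrite cosB; ring.
  have Lc : L1 l2 (fun X => cut n X * cos (dot2 X xi)).
    by apply: cut_f_L1 => [|X]; [exact: (mt cos _ (@continuous_cos R))|exact: cos_max].
  have Ls : L1 l2 (fun X => cut n X * sin (dot2 X xi)).
    by apply: cut_f_L1 => [|X]; [exact: (mt sin _ (@continuous_sin R))|exact: sin_max].
  rewrite ID ?IZ //; try exact: L1Z.
  rewrite /A freE fimE; move: (@pi R) (pi_gt0 R) => p p0; field.
  by rewrite gt_eqF.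
have [|LI E1] := I_fubini l2 l2 _ LF.
  by move=> xi; exact: (L1Z _ (abel e xi) _ (cut_f_L1 n _ (mcos xi) (fun X => cos_max _))).
have LA : L1 l2 (fun xi => abel e xi * A n xi).
  have := L1Z _ (2 * pi)^-1 _ LI; apply: eq_integrable => // xi _ /=.
  by rewrite AE mulKf // mulf_neq0 // gt_eqF // pi_gt0.
split => //.
have E2 : I2 (fun xi => 2 * pi * (abel e xi * A n xi)) = I2 (fun X => cut n X * poisson e Y X).
  have -> : (fun xi => 2 * pi * (abel e xi * A n xi)) = (fun xi => I2 (fun X => F (xi, X))).
    by apply/funext => xi; rewrite AE.
  rewrite E1 -(I_fubini2 l2 l2 _ LF); last first.
    move=> X; have LX := L1Z _ (cut n X) _ (abel_L1 e e0).
    apply: (L1_le _ _ _ _ (L1_norm _ _ LX)) => [|xi].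
      rewrite /F /=; apply: measurable_funM; first exact: measurable_abel.
      apply: measurable_funM; first exact: measurable_cst.
      have mc := measurable_cont cos _ (@continuous_cos R) (measurable_dot (Y.1 - X.1, Y.2 - X.2)).
      exact: mc.
    rewrite /F /= mulrA normrM [cut n X * _]mulrC.
    by rewrite ler_piMr // cos_max.
  apply: eq_Rintegral => X _; rewrite /F /=.
  have -> : (fun xi => abel e xi * (cut n X * cos (dot2 (Y.1 - X.1, Y.2 - X.2) xi))) =
     (fun xi => cut n X * (abel e xi * cos (dot2 (Y.1 - X.1, Y.2 - X.2) xi))).
    by apply/funext => xi; rewrite mulrCA.
  rewrite IZ ?abel_fourier //; exact: abel_cos_L1.
rewrite -E2 IZ // mulKf //; apply: mulf_neq0 => //; exact: lt0r_neq0 (pi_gt0 R).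
Qed.

(** The real part of (a + i b) exp(i X.xi). *)
Definition phase (a b : plane R -> R) (X xi : plane R) :=
  a xi * cos (dot2 X xi) - b xi * sin (dot2 X xi).

Lemma measurable_phase a b X : measurable_fun [set: plane R] a ->
  measurable_fun [set: plane R] b -> measurable_fun [set: plane R] (phase a b X).
Proof.
move=> ma mb.
have mc := measurable_cont cos _ (@continuous_cos R) (measurable_dot X).
have ms := measurable_cont sin _ (@continuous_sin R) (measurable_dot X).
by apply: measurable_funB; apply: measurable_funM.
Qed.

Lemma phase_le a b X xi : `|phase a b X xi| <= `|a xi| + `|b xi|.
Proof.
rewrite (le_trans (ler_normB _ _)) // !normrM lerD // ler_piMr //;
  [exact: cos_max|exact: sin_max].
Qed.

Lemma abel_le1 (e : R) X : 0 <= e -> abel e X <= 1.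
Proof.
move=> e0; have h (t : R) : expR (- (e * `|t|)) <= 1.
  by rewrite -expR0 ler_expR oppr_le0 mulr_ge0.
by rewrite -[leRHS]mulr1 /abel ler_pM ?expR_ge0.
Qed.

Hypothesis Lvw : L1 l2 (fun xi => `|v xi| + `|w xi|).

Let Lphase X : L1 l2 (phase v w X).
Proof.
apply: (L1_le _ _ _ _ Lvw) => [|xi]; first exact: measurable_phase.
exact: phase_le.
Qed.

Let Label (e : R) X : 0 < e -> L1 l2 (fun xi => abel e xi * phase v w X xi).
Proof.
move=> e0; apply: (L1_le _ _ _ _ Lvw) => [|xi].
  by apply: measurable_funM; [exact: measurable_abel|exact: measurable_phase].
rewrite normrM (ger0_norm (abel_ge0 _ _)) (le_trans _ (phase_le _ _ X _)) //.
by rewrite ler_piMl ?abel_le1 // ltW.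
Qed.

Let sq n xi := (v xi - fre n xi) ^+ 2 + (w xi - fim n xi) ^+ 2.

Let msq n : measurable_fun [set: plane R] (sq n).
Proof.
by apply: measurable_funD; apply: measurable_funX; apply: measurable_funB.
Qed.

Let sq_cvg : (\forall n \near \oo, L1 l2 (sq n)) /\ I2 (sq n) @[n --> \oo] --> (0:R).
Proof.
have [_ _ H] := Fu; have {H} := (fine_cvgP _ _).1 H; move=> [Hf Hc]; split.
  near=> n; apply: L1_ge0 => // [|xi|].
  - exact: msq.
  - by rewrite addr_ge0 // sqr_ge0.
  - have : (\int[leb2]_xi ((v xi - fourier_re u n xi) ^+ 2 +
        (w xi - fourier_im u n xi) ^+ 2)%:E)%E \is a fin_num by near: n; exact: Hf.
    by rewrite ge0_fin_numE // integral_ge0 // => xi _; rewrite lee_fin addr_ge0 // sqr_ge0.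
exact: Hc.
Unshelve. all: by end_near. Qed.

(** Convergence in L^2 tested against the square integrable [abel e]; a weighted Young inequality
    plays the role of Cauchy-Schwarz. *)
Let abel_A_cvg (e : R) : 0 < e ->
  I2 (fun xi => abel e xi * A n xi) @[n --> \oo] --> I2 (fun xi => abel e xi * phase v w Y xi).
Proof.
move=> e0; have [nL cI] := sq_cvg.
have La2 : L1 l2 (fun xi => abel e xi ^+ 2).
  apply: (L1_le _ _ _ _ (abel_L1 e e0)) => [|xi].
    by apply: measurable_funX; exact: measurable_abel.
  by rewrite ger0_norm ?sqr_ge0 // expr2 ler_piMl ?abel_le1 ?abel_ge0 // ltW.
pose k2 := I2 (fun xi => abel e xi ^+ 2).
have k20 : 0 <= k2 by apply: Rintegral_ge0 => xi _; exact: sqr_ge0.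
apply/cvgrPdist_le => eta eta0.
(* The Young weight: [del * (k2 + 1)] is half of [eta], and the other half comes from
   [I2 (sq n) <= del * eta]. *)
pose del := eta / (2 * (k2 + 1)).
have del0 : 0 < del by rewrite divr_gt0 // mulr_gt0 // ltr_wpDl.
near=> n.
have Ln : L1 l2 (sq n) by near: n; exact: nL.
have In : I2 (sq n) <= del * eta.
  have : `|0 - I2 (sq n)| <= del * eta.
    by near: n; move/cvgrPdist_le : cI; apply; rewrite mulr_gt0.
  by rewrite sub0r normrN; exact: le_trans (ler_norm _).
have [LA _] := abel_fre e n e0.
rewrite -IB //; last exact: Label.
have Lb : L1 l2 (fun xi => (2 * del)^-1 * sq n xi + del * abel e xi ^+ 2).
  by apply: L1D; exact: L1Z.
apply: le_trans (I_norm_le _ _ _ _ Lb _) _.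
- by apply: L1B => //; exact: Label.
- move=> xi; rewrite -mulrBr normrM (ger0_norm (abel_ge0 _ _)).
  have -> : phase v w Y xi - A n xi = phase (fun z => v z - fre n z) (fun z => w z - fim n z) Y xi.
    by rewrite /phase /A; ring.
  apply: (@le_trans _ _ (abel e xi * (`|v xi - fre n xi| + `|w xi - fim n xi|))).
    by rewrite ler_wpM2l ?abel_ge0 // phase_le.
  rewrite /sq -[(v xi - _) ^+ 2]real_normK ?num_real // -[(w xi - _) ^+ 2]real_normK ?num_real //.
  move: (abel e xi) (`|v xi - _|) (`|w xi - _|) => k a b.
  have h (c : R) : k * c <= (2 * del)^-1 * c ^+ 2 + del / 2 * k ^+ 2.
    have -> : (2 * del)^-1 * c ^+ 2 + del / 2 * k ^+ 2 = (2 * del)^-1 * (c - del * k) ^+ 2 + k * c.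
      by field; rewrite gt_eqF.
    by rewrite lerDr mulr_ge0 ?sqr_ge0 // invr_ge0 ltW // mulr_gt0.
  have := h a; have := h b; lra.
rewrite ID ?IZ //; try exact: L1Z.
rewrite -/k2; apply: (@le_trans _ _ ((2 * del)^-1 * (del * eta) + del * (k2 + 1))).
  rewrite lerD // ler_wpM2l //; last by rewrite lerDl.
  - by rewrite invr_ge0 ltW // mulr_gt0.
  - by rewrite ltW.
rewrite /del le_eqVlt; apply/orP; left; apply/eqP; field.
by rewrite !gt_eqF // ltr_wpDl.
Unshelve. all: by end_near. Qed.

(** By Young the product is at most half of [u ^+ 2] plus half the squared kernel, and the kernel,
    being at most [4 / e ^+ 2], dominates its square up to a constant. *)
Let poisson_u (e : R) : 0 < e -> L1 l2 (fun X => u X * poisson e Y X).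
Proof.
move=> e0; have [LP _] := poisson_L1 e Y e0.
have c0 : 0 <= 2 / e ^+ 2 by rewrite divr_ge0 // sqr_ge0.
have Lb : L1 l2 (fun X => 2^-1 * u X ^+ 2 + 2 / e ^+ 2 * poisson e Y X).
  by apply: L1D; exact: L1Z.
apply: (L1_le _ _ _ _ Lb) => [|X].
  by apply: measurable_funM => //; exact: (L1_measurable _ _ LP).
have p0 := poisson_ge0 e Y X e0.
have cl (t : R) : 2 * e / (e ^+ 2 + t ^+ 2) <= 2 / e.
  rewrite ler_pdivrMr ?cauchy_den // mulrDr.
  have -> : 2 / e * e ^+ 2 = 2 * e by field; rewrite gt_eqF.
  by rewrite lerDl mulr_ge0 ?sqr_ge0 // divr_ge0 // ltW.
have cg (t : R) : 0 <= 2 * e / (e ^+ 2 + t ^+ 2).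
  by rewrite divr_ge0 ?mulr_ge0 ?(ltW (cauchy_den _ _ e0)) // ltW.
have pl : poisson e Y X <= 4 / e ^+ 2.
  have -> : 4 / e ^+ 2 = 2 / e * (2 / e) by field; rewrite gt_eqF.
  by rewrite ler_pM.
rewrite normrM (ger0_norm p0) -[u X ^+ 2]real_normK ?num_real //.
have p2 : poisson e Y X * poisson e Y X <= 4 / e ^+ 2 * poisson e Y X by rewrite ler_wpM2r.
have := sqr_ge0 (`|u X| - poisson e Y X); rewrite sqrrB; lra.
Qed.

Let cut_cvg (e : R) : 0 < e ->
  I2 (fun X => cut n X * poisson e Y X) @[n --> \oo] --> I2 (fun X => u X * poisson e Y X).
Proof.
move=> e0; have Lu := poisson_u e e0.
have Lc n : L1 l2 (fun X => cut n X * poisson e Y X).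
  apply: (L1_le _ _ _ _ (L1_norm _ _ Lu)) => [|X].
    apply: measurable_funM; first exact: measurable_cut.
    by have [/L1_measurable] := poisson_L1 e Y e0.
  rewrite /cut -mulrA normrM ler_piMl // indicE.
  by case: (X \in _); rewrite ?normr1 ?normr0.
have [] := @dominated_convergence _ _ _ l2 setT measurableT
  (fun n X => (cut n X * poisson e Y X)%:E) (fun X => (u X * poisson e Y X)%:E)
  (fun X => (`|u X * poisson e Y X|)%:E).
- by move=> n; apply/measurable_EFinP; exact: L1_measurable (Lc n).
- by apply/measurable_EFinP; exact: L1_measurable Lu.
- apply: aeW => X _; apply: cvg_EFin; first exact: nearW.
  apply: cvg_near_cst; near=> n; rewrite /= /cut indicE mem_set ?mul1r // /disc /=.
  have h : Num.sqrt (dot2 X X) <= n%:R by near: n; exact: nbhs_infty_ger.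
  have d0 : 0 <= dot2 X X by rewrite /dot2 -!expr2 addr_ge0 ?sqr_ge0.
  by rewrite -(sqr_sqrtr d0) ler_pXn2r // nnegrE ?sqrtr_ge0.
- exact: L1_norm Lu.
- apply: aeW => X n _; rewrite lee_fin /cut -mulrA normrM ler_piMl // indicE.
  by case: (X \in _); rewrite ?normr1 ?normr0.
move=> _ _ H; rewrite -[X in _ --> X]/(fine (I2 (fun X => u X * poisson e Y X))%:E) -L1_fin //.
apply: fine_cvg; rewrite fineK; last by rewrite L1_fin.
exact: H.
Unshelve. all: by end_near. Qed.

(** Both sides are limits, as the truncation is removed, of the two sides of [abel_fre]. *)
Lemma abel_inversion (e : R) : 0 < e ->
  I2 (fun xi => abel e xi * phase v w Y xi) = (2 * pi)^-1 * I2 (fun X => u X * poisson e Y X).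
Proof.
move=> e0; apply: (cvg_unique _ (abel_A_cvg e e0)) => //=.
have -> : (fun n => I2 (fun xi => abel e xi * A n xi)) =
   (fun n => (2 * pi)^-1 * I2 (fun X => cut n X * poisson e Y X)).
  by apply/funext => n; have [_ ->] := abel_fre e n e0.
by apply: cvgM; [exact: cvg_cst|exact: cut_cvg].
Qed.

Lemma le_limit_eps (x a c : R) : (forall e, 0 < e -> x <= a + e * c) -> x <= a.
Proof.
move=> H; apply/ler_addgt0Pr => e e0.
have c1 : 0 < `|c| + 1 by rewrite ltr_wpDl.
rewrite (le_trans (H _ (divr_gt0 e0 c1))) // lerD2l.
apply: (@le_trans _ _ (e / (`|c| + 1) * (`|c| + 1))); last by rewrite divfK // gt_eqF.
apply: ler_wpM2l; first by apply: divr_ge0; exact: ltW.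
have := ler_norm c; lra.
Qed.

(** If one coordinate is far, its factor is O(e) times the kernel at scale 1, while the other factor
    may still concentrate. Summing both possibilities gives a majorant that is e times a function of
    fixed mass. The first bound, uniform in [e], serves to linearise the square of the kernel. *)
Lemma poisson_far (e del : R) (X : plane R) : 0 < e -> 0 < del ->
  (del < `|Y.1 - X.1|) || (del < `|Y.2 - X.2|) ->
  poisson e Y X <= 4 / del ^+ 2 /\
  poisson e Y X <= e * (1 + (del ^+ 2)^-1) *
    (2 * 1 / (1 ^+ 2 + (Y.1 - X.1) ^+ 2) * (2 * e / (e ^+ 2 + (Y.2 - X.2) ^+ 2)) +
     2 * e / (e ^+ 2 + (Y.1 - X.1) ^+ 2) * (2 * 1 / (1 ^+ 2 + (Y.2 - X.2) ^+ 2))).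
Proof.
move=> e0 d0; rewrite /poisson; move: (Y.1 - X.1) (Y.2 - X.2) => s t far.
have q0 (k r : R) : 0 < k -> 0 <= 2 * k / (k ^+ 2 + r ^+ 2).
  by move=> k0; rewrite divr_ge0 ?mulr_ge0 ?(ltW (cauchy_den _ _ k0)) // ltW.
have cl (r : R) : 2 * e / (e ^+ 2 + r ^+ 2) <= 2 / e.
  rewrite ler_pdivrMr ?cauchy_den // mulrDr.
  have -> : 2 / e * e ^+ 2 = 2 * e by field; rewrite gt_eqF.
  by rewrite lerDl mulr_ge0 ?sqr_ge0 // divr_ge0 // ltW.
have d2 : 0 < del ^+ 2 by rewrite exprn_gt0.
have far1 (r : R) : del < `|r| -> 2 * e / (e ^+ 2 + r ^+ 2) <= 2 * e / del ^+ 2 /\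
    2 * e / (e ^+ 2 + r ^+ 2) <= e * (1 + (del ^+ 2)^-1) * (2 * 1 / (1 ^+ 2 + r ^+ 2)).
  move=> dr; have r2 : del ^+ 2 < r ^+ 2.
    by rewrite -[r ^+ 2]real_normK ?num_real // ltr_pXn2r // nnegrE ltW.
  have e20 : 0 < e ^+ 2 by rewrite exprn_gt0.
  split; first by rewrite ler_pM2l ?mulr_gt0 // lef_pV2 ?posrE //; lra.
  rewrite ler_pdivrMr ?cauchy_den // expr1n mulr1.
  have -> : e * (1 + (del ^+ 2)^-1) * (2 / (1 + r ^+ 2)) * (e ^+ 2 + r ^+ 2) =
    2 * e * ((1 + (del ^+ 2)^-1) * (e ^+ 2 + r ^+ 2) / (1 + r ^+ 2)) by ring.
  rewrite ler_peMr ?mulr_ge0 ?(ltW e0) // ler_pdivlMr ?mul1r; last by lra.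
  have h : 1 <= (del ^+ 2)^-1 * r ^+ 2 by rewrite mulrC ler_pdivlMr // mul1r ltW.
  have h2 : 0 <= (del ^+ 2)^-1 * e ^+ 2 by apply: mulr_ge0; [rewrite invr_ge0|]; exact: ltW.
  rewrite mulrDl mul1r mulrDr; lra.
have c4 : 4 / del ^+ 2 = 2 * e / del ^+ 2 * (2 / e).
  by field; rewrite !gt_eqF.
have f0 : 0 <= e * (1 + (del ^+ 2)^-1).
  by apply: mulr_ge0; [exact: ltW|rewrite addr_ge0 // invr_ge0 ltW].
case/orP : far => /far1[h1 h2]; split.
- by rewrite c4 ler_pM ?q0.
- rewrite mulrDr -[leLHS]addr0 lerD //; last by apply: mulr_ge0 => //; apply: mulr_ge0; exact: q0.
  by rewrite [leRHS]mulrA ler_wpM2r // q0.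
- by rewrite c4 mulrC ler_pM ?q0.
- rewrite mulrDr -[leLHS]add0r lerD //; first by apply: mulr_ge0 => //; apply: mulr_ge0; exact: q0.
  by rewrite [leRHS]mulrCA ler_wpM2l // q0.
Qed.

Lemma one_minus_abel (e : R) X : 0 < e -> `|1 - abel e X| <= e * (`|X.1| + `|X.2|).
Proof.
move=> e0; rewrite ger0_norm ?subr_ge0 ?abel_le1 ?(ltW e0) // /abel -expRD.
by have := expR_ge1Dx (- (e * `|X.1|) - e * `|X.2|); lra.
Qed.

Hypothesis uY : {for Y, continuous u}.
Hypothesis Lw : L1 l2 (fun xi => (`|xi.1| + `|xi.2|) * (`|v xi| + `|w xi|)).

Let far (e del : R) (X : plane R) := e * (1 + (del ^+ 2)^-1) *
    (2 * 1 / (1 ^+ 2 + (Y.1 - X.1) ^+ 2) * (2 * e / (e ^+ 2 + (Y.2 - X.2) ^+ 2)) +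
     2 * e / (e ^+ 2 + (Y.1 - X.1) ^+ 2) * (2 * 1 / (1 ^+ 2 + (Y.2 - X.2) ^+ 2))).

Let farI (e del : R) : 0 < e -> L1 l2 (far e del) /\
  I2 (far e del) = e * ((1 + (del ^+ 2)^-1) * (2 * (2 * pi) ^+ 2)).
Proof.
move=> e0; have [a1 b1] := cauchy_integral 1 Y.1 (@ltr01 R).
have [a2 b2] := cauchy_integral e Y.2 e0.
have [a3 b3] := cauchy_integral e Y.1 e0.
have [a4 b4] := cauchy_integral 1 Y.2 (@ltr01 R).
have [L1' E1] := I_prod mu mu _ _ a1 a2.
have [L2' E2] := I_prod mu mu _ _ a3 a4.
have LS := L1D l2 _ _ L1' L2'.
have ES := ID l2 _ _ L1' L2'.
split; first exact: (L1Z l2 (e * (1 + (del ^+ 2)^-1)) _ LS).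
rewrite [LHS](IZ l2 (e * (1 + (del ^+ 2)^-1)) _ LS) ES.
rewrite [X in _ * (X + _)]E1 [X in _ * (_ + X)]E2 b1 b2 b3 b4; ring.
Qed.

(** Near [Y] continuity gives [io]. Far away [u] is merely square integrable, so [|u|] times the
    kernel is split by Young: a small multiple [th] of [u ^+ 2] plus a multiple of the kernel
    squared, which is O(e) by [poisson_far]. *)
Let poisson_limit (io th : R) : 0 < io -> 0 < th -> exists c, forall e, 0 < e ->
  `|I2 (fun X => u X * poisson e Y X) - (2 * pi) ^+ 2 * u Y| <=
  io * (2 * pi) ^+ 2 + th * (2^-1 * I2 (fun X => u X ^+ 2)) + e * c.
Proof.
move=> io0 th0.
have [del d0 Hd] : exists2 del : R, 0 < del & forall X : plane R,
    `|Y.1 - X.1| <= del -> `|Y.2 - X.2| <= del -> `|u X - u Y| <= io.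
  have /cvgrPdist_le/(_ io io0)/nbhs_ballP[r /= r0 Hr] := uY.
  exists (r / 2); first by rewrite divr_gt0.
  move=> X h1 h2; rewrite distrC; apply: Hr; split; rewrite /ball /=; lra.
(* The factor [2 / (del ^+ 2 * th)] is the Young constant [(2 * th)^-1] times the bound
   [4 / del ^+ 2] of the far kernel; [|u Y|] accounts for the subtracted constant. *)
exists ((2 / (del ^+ 2 * th) + `|u Y|) * ((1 + (del ^+ 2)^-1) * (2 * (2 * pi) ^+ 2))) => e e0.
have [LP IP] := poisson_L1 e Y e0; have [LF IF] := farI e del e0.
have Lu := poisson_u e e0.
have LuY := L1Z _ (u Y) _ LP.
pose kk := 2 / (del ^+ 2 * th) + `|u Y|.
have La := L1Z l2 io _ LP; have Lc := L1Z l2 kk _ LF.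
have Lu2' := L1Z l2 2^-1 _ Lu2; have Lb1 := L1Z l2 th _ Lu2'.
have Lab := L1D l2 _ _ La Lb1; have Lb := L1D l2 _ _ Lab Lc.
have Eb : I2 (fun X => io * poisson e Y X + th * (2^-1 * u X ^+ 2) + kk * far e del X) =
  io * (2 * pi) ^+ 2 + th * (2^-1 * I2 (fun X => u X ^+ 2)) +
  e * (kk * ((1 + (del ^+ 2)^-1) * (2 * (2 * pi) ^+ 2))).
  rewrite (ID l2 _ _ Lab Lc) (ID l2 _ _ La Lb1) (IZ l2 io _ LP) (IZ l2 th _ Lu2').
  by rewrite (IZ l2 2^-1 _ Lu2) (IZ l2 kk _ LF) IP IF [X in _ + X]mulrCA.
rewrite -Eb.
have -> : (2 * pi) ^+ 2 * u Y = I2 (fun X => u Y * poisson e Y X) by rewrite IZ // IP mulrC.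
rewrite -IB //; apply: (I_norm_le _ _ _ (L1B _ _ _ Lu LuY) Lb).
move=> X; rewrite -mulrBl normrM; have P0 := poisson_ge0 e Y X e0.
rewrite (ger0_norm P0).
have th2 : 0 <= th * (2^-1 * u X ^+ 2) by apply: mulr_ge0; [exact: ltW|rewrite mulr_ge0 // sqr_ge0].
have q0 (k r : R) : 0 < k -> 0 <= 2 * k / (k ^+ 2 + r ^+ 2).
  by move=> k0; rewrite divr_ge0 ?mulr_ge0 ?(ltW (cauchy_den _ _ k0)) // ltW.
have F0 : 0 <= far e del X.
  apply: mulr_ge0; last by rewrite addr_ge0 // mulr_ge0 // q0.
  by apply: mulr_ge0; [exact: ltW|rewrite addr_ge0 // invr_ge0 sqr_ge0].
have c0 : 0 <= 2 / (del ^+ 2 * th) by apply: divr_ge0 => //; rewrite mulr_ge0 ?sqr_ge0 // ltW.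
have [/andP[n1 n2]|] := boolP ((`|Y.1 - X.1| <= del) && (`|Y.2 - X.2| <= del)).
  have := ler_wpM2r P0 (Hd X n1 n2).
  have : 0 <= kk * far e del X by rewrite mulr_ge0 // addr_ge0.
  lra.
rewrite negb_and -!ltNge => /(poisson_far e del X e0 d0)[h1 h2].
have t1 : `|u X - u Y| * poisson e Y X <= `|u X| * poisson e Y X + `|u Y| * poisson e Y X.
  by rewrite -mulrDl ler_wpM2r // ler_normB.
have t2 : `|u Y| * poisson e Y X <= `|u Y| * far e del X by rewrite ler_wpM2l.
have t3 : `|u X| * poisson e Y X <= th * (2^-1 * u X ^+ 2) + 2 / (del ^+ 2 * th) * far e del X.
  apply: (@le_trans _ _ (th * (2^-1 * u X ^+ 2) + 2 / (del ^+ 2 * th) * poisson e Y X)).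
    rewrite -[u X ^+ 2]real_normK ?num_real //.
    apply: (@le_trans _ _ (th * (2^-1 * `|u X| ^+ 2) + (2 * th)^-1 * (poisson e Y X * poisson e Y X))).
      have -> : th * (2^-1 * `|u X| ^+ 2) + (2 * th)^-1 * (poisson e Y X * poisson e Y X) =
        (2 * th)^-1 * (th * `|u X| - poisson e Y X) ^+ 2 + `|u X| * poisson e Y X.
        by field; rewrite gt_eqF.
      by rewrite lerDr mulr_ge0 ?sqr_ge0 // invr_ge0 mulr_ge0 // ltW.
    rewrite lerD2l.
    have -> : 2 / (del ^+ 2 * th) * poisson e Y X = (2 * th)^-1 * (4 / del ^+ 2 * poisson e Y X).
      by field; rewrite !gt_eqF.
    by rewrite ler_wpM2l ?invr_ge0 ?mulr_ge0 ?(ltW th0) // ler_wpM2r.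
  by rewrite lerD2l ler_wpM2l.
have io1 : 0 <= io * poisson e Y X by rewrite mulr_ge0 // ltW.
have Ek : kk * far e del X = 2 / (del ^+ 2 * th) * far e del X + `|u Y| * far e del X.
  by rewrite /kk mulrDl.
by rewrite Ek; move: t1 t2 t3 io1; lra.
Qed.

(** The first moment [Lw] makes the removal of the Abel factor quantitative, with error linear in
    [e] by [one_minus_abel]. *)
Theorem fourier_inversion : u Y = (2 * pi)^-1 * I2 (phase v w Y).
Proof.
have p0 : 0 < 2 * pi :> R by rewrite mulr_gt0 // pi_gt0.
suff D : `|2 * pi * I2 (phase v w Y) - (2 * pi) ^+ 2 * u Y| <= 0.
  move: D; rewrite normr_le0 subr_eq0 => /eqP E.
  apply: (mulfI (lt0r_neq0 p0)); apply: (mulfI (lt0r_neq0 p0)).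
  by rewrite mulrA -expr2 -E mulVKf // lt0r_neq0.
(* The parameter [e] is introduced last because the constant [c] depends on [io] and [th]. *)
apply: (@le_limit_eps _ _ ((2 * pi) ^+ 2)) => io io0; rewrite add0r.
apply: (@le_limit_eps _ _ (2^-1 * I2 (fun X => u X ^+ 2))) => th th0.
have [c Hc] := poisson_limit io th io0 th0.
apply: (@le_limit_eps _ _ (c + 2 * pi * I2 (fun xi => (`|xi.1| + `|xi.2|) * (`|v xi| + `|w xi|)))) => e e0.
have h1 := Hc e e0.
have E := abel_inversion e e0.
have h2 : `|I2 (phase v w Y) - I2 (fun xi => abel e xi * phase v w Y xi)| <=
    e * I2 (fun xi => (`|xi.1| + `|xi.2|) * (`|v xi| + `|w xi|)).
  have Le := L1Z _ e _ Lw.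
  rewrite -IB // ?[in leRHS](esym (IZ _ e _ Lw)) //; last exact: Label.
  apply: I_norm_le => // [|xi]; first by apply: L1B => //; exact: Label.
  rewrite -{1}[phase v w Y xi]mul1r -mulrBl normrM mulrA.
  by rewrite ler_pM // ?one_minus_abel // phase_le.
have E' : I2 (fun X => u X * poisson e Y X) = 2 * pi * I2 (fun xi => abel e xi * phase v w Y xi).
  by rewrite E mulVKf // lt0r_neq0.
rewrite E' in h1.
have -> : 2 * pi * I2 (phase v w Y) - (2 * pi) ^+ 2 * u Y =
   2 * pi * (I2 (phase v w Y) - I2 (fun xi => abel e xi * phase v w Y xi)) +
   (2 * pi * I2 (fun xi => abel e xi * phase v w Y xi) - (2 * pi) ^+ 2 * u Y) by ring.
rewrite (le_trans (ler_normD _ _)) // normrM (gtr0_norm p0).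
have h3 := ler_wpM2l (ltW p0) h2.
apply: le_trans (lerD h3 h1) _; rewrite le_eqVlt; apply/orP; left; apply/eqP; ring.
Qed.

End Inversion.

(** * From Sobolev norms to bounded derivatives *)

Section Calculus.
Context {R : realType}.

Lemma mvt (f df : R -> R) (a b : R) : (forall x, is_derive x (1:R) f (df x)) ->
  exists2 c, `|c - a| <= `|b - a| & f b - f a = df c * (b - a).
Proof.
move=> fdf.
have fc (x y : R) : {within `[x, y], continuous f}.
  apply: continuous_subspaceT => z; apply: differentiable_continuous.
  by apply/derivable1_diffP; case: (fdf z).
case: (ltgtP a b) => [ab|ba|<-].
- have [c /andP[ac cb] E] := MVT ab (fun x _ => fdf x) (fc a b).
  exists c => //; rewrite !ger0_norm ?subr_ge0 ?(ltW ab) //; last by have := ltW ac.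
  by rewrite lerD2r; have := ltW cb.
- have [c /andP[bc ca] E] := MVT ba (fun x _ => fdf x) (fc b a).
  exists c; last by rewrite -[LHS]opprB E -mulrN opprB.
  rewrite distrC [leRHS]distrC !ger0_norm ?subr_ge0 ?(ltW ba) //; last by have := ltW ca.
  by rewrite lerD2l lerN2; have := ltW bc.
- by exists a; rewrite // !subrr mulr0.
Qed.

(** A quadratic remainder survives integration in a parameter, so this criterion replaces
    differentiation under the integral sign in [synth_derive]. *)
Lemma is_derive_remainder {V : normedModType R} (f : V -> R) X v (d C : R) :
  (forall h : R, `|f (h *: v + X) - f X - h * d| <= C * h ^+ 2) -> is_derive X v f d.
Proof.
move=> H.
suff L : (k : R)^-1 *: ((f \o shift X) (k *: v) - f X) @[k --> (0:R)^'] --> d.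
  by split; [apply/cvg_ex; exists d|exact: cvg_lim].
apply/cvgrPdist_le => e e0.
have c0 : 0 < e / (`|C| + 1) by rewrite divr_gt0 // ltr_wpDl.
near=> k.
have k0 : k != 0 by near: k; exact: nbhs_dnbhs_neq.
have kn : `|k| <= e / (`|C| + 1).
  near: k; apply: dnbhs0_le => //.
have := H k; rewrite /= => Hk.
have -> : d - k^-1 *: (f (k *: v + X) - f X) = - (k^-1 * (f (k *: v + X) - f X - k * d)).
  by rewrite mulrBr mulKf // opprB.
rewrite normrN normrM normfV ler_pdivrMl ?normr_gt0 //.
apply: (le_trans Hk); rewrite -real_normK ?num_real // expr2 mulrA [leRHS]mulrC.
apply: ler_wpM2r => //; apply: (@le_trans _ _ (`|C| * `|k|)).
  by rewrite ler_wpM2r // ler_norm.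
apply: (@le_trans _ _ (`|C| * (e / (`|C| + 1)))); first exact: ler_wpM2l.
rewrite mulrA ler_pdivrMr ?ltr_wpDl // mulrC ler_wpM2l ?lerDl //; exact: ltW.
Unshelve. all: by end_near. Qed.

Lemma sin_lip (x y : R) : `|sin x - sin y| <= `|x - y|.
Proof.
have [c _ ->] := mvt sin cos y x (@is_derive_sin R).
by rewrite normrM ler_piMl // cos_max.
Qed.

Lemma cos_lip (x y : R) : `|cos x - cos y| <= `|x - y|.
Proof.
have [c _ ->] := mvt cos (fun x => - sin x) y x (@is_derive_cos R).
by rewrite normrM normrN ler_piMl // sin_max.
Qed.

Lemma wave_remainder (a b x h : R) :
  `|(a * cos (x + h) - b * sin (x + h)) - (a * cos x - b * sin x)
    - h * (- b * cos x - a * sin x)| <= (`|a| + `|b|) * h ^+ 2.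
Proof.
(* The wave minus its linear part at [x]: its derivative vanishes at [x] and is Lipschitz with
   constant [|a| + |b|]. *)
pose g t := (a * cos t - b * sin t) - (t - x) * (- b * cos x - a * sin x).
pose dg t := - b * (cos t - cos x) - a * (sin t - sin x).
have gdg (t : R) : is_derive t (1:R) g (dg t).
  have -> : g = ((cst a * cos - cst b * sin) - (id - cst x) * cst (- b * cos x - a * sin x)).
    by apply/funext.
  have ic := is_derive_cos t; have is_ := is_derive_sin t.
  have k := is_derive_cst.
  have h1 := is_deriveB (is_deriveM (k _ _ _ a t (1:R)) ic) (is_deriveM (k _ _ _ b t (1:R)) is_).
  have h2 := is_deriveM (is_deriveB (is_derive_id t (1:R)) (k _ _ _ x t (1:R)))
     (k _ _ _ (- b * cos x - a * sin x) t (1:R)).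
  apply: (is_derive_eq (is_deriveB h1 h2)); rewrite /dg /GRing.scale /= /cst; ring.
have [c ch E] := mvt g dg x (x + h) gdg.
have -> : a * cos (x + h) - b * sin (x + h) - (a * cos x - b * sin x) -
   h * (- b * cos x - a * sin x) = g (x + h) - g x.
  rewrite /g; ring.
have hh : x + h - x = h by rewrite addrC addKr.
rewrite hh in ch.
rewrite E hh normrM -[h ^+ 2]real_normK ?num_real // expr2 mulrA ler_wpM2r //.
rewrite (le_trans (ler_normB _ _)) // !normrM normrN addrC mulrDl.
by apply: lerD; apply: ler_wpM2l => //; apply: le_trans ch; [exact: sin_lip|exact: cos_lip].
Qed.

End Calculus.

(** * Inverse transforms with weighted integrable amplitudes *)

Section Weighted.
Context {R : realType}.
Notation l2 := plane_measure.
Local Notation I2 f := (Rintegral l2 [set: plane R] f).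

Definition wt (xi : plane R) : R := 1 + dot2 xi xi.

Lemma wt_ge1 xi : 1 <= wt xi.
Proof. by rewrite lerDl addr_ge0 // -expr2 sqr_ge0. Qed.

Lemma wt_gt0 xi : 0 < wt xi. Proof. exact: lt_le_trans (wt_ge1 xi). Qed.

Lemma measurable_wt k : measurable_fun [set: plane R] (fun xi => wt xi ^+ k).
Proof.
apply: measurable_funX; apply: measurable_funD => //.
by apply: measurable_funD; apply: measurable_funM.
Qed.

Definition amp (a b : plane R -> R) k xi := wt xi ^+ k * (`|a xi| + `|b xi|).

Lemma amp_ge0 a b k xi : 0 <= amp a b k xi.
Proof. by rewrite mulr_ge0 ?addr_ge0 // exprn_ge0 // ltW // wt_gt0. Qed.

Record weighted k K (a b : plane R -> R) : Prop := {
  wt_ma : measurable_fun [set: plane R] a ;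
  wt_mb : measurable_fun [set: plane R] b ;
  wt_L1 : L1 l2 (amp a b k) ;
  wt_le : I2 (amp a b k) <= K }.

Lemma measurable_amp a b k : measurable_fun [set: plane R] a ->
  measurable_fun [set: plane R] b -> measurable_fun [set: plane R] (amp a b k).
Proof.
move=> ma mb; apply: measurable_funM; first exact: measurable_wt.
by apply: measurable_funD; exact: measurableT_comp.
Qed.

Lemma weighted_le a b a' b' k k' K : weighted k K a b ->
  measurable_fun [set: plane R] a' -> measurable_fun [set: plane R] b' ->
  (forall xi, amp a' b' k' xi <= amp a b k xi) -> weighted k' K a' b'.
Proof.
move=> [ma mb La Ia] ma' mb' H.
have L' : L1 l2 (amp a' b' k').
  apply: (L1_le _ _ _ _ La) => [|xi]; first exact: measurable_amp.
  by rewrite ger0_norm ?amp_ge0.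
by split => //; apply: le_trans Ia; exact: I_le.
Qed.

Lemma weightedW a b k k' K : (k' <= k)%N -> weighted k K a b -> weighted k' K a b.
Proof.
move=> kk' W; case: (W) => ma mb _ _; apply: (weighted_le _ _ _ _ _ _ _ W) => // xi.
by apply: ler_wpM2r; [rewrite addr_ge0|exact: ler_weXn2l (wt_ge1 _) _ _ kk'].
Qed.

(** Each derivative is charged a full power of [wt], of second degree in [xi], which keeps all
    exponents natural numbers and explains the factor 2 in front of [k] in [sobolev_Cb]. *)
Lemma dot_wt v xi : v \in [:: ux; uy] -> `|dot2 v xi| <= wt xi.
Proof.
have q (t : R) : `|t| <= 1 + t ^+ 2.
  rewrite -[t ^+ 2]real_normK ?num_real //; have := sqr_ge0 (`|t| - 1); have := normr_ge0 t.
  by rewrite sqrrB; lra.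
have := q xi.1; have := q xi.2; have := sqr_ge0 xi.1; have := sqr_ge0 xi.2.
rewrite !inE /wt /dot2 -!expr2 => a1 a2 a3 a4 /orP[]/eqP-> /=;
  rewrite ?mul0r ?mul1r ?addr0 ?add0r; apply: (le_trans _); first exact: a4.
- lra.
- exact: a3.
- lra.
Qed.

(** The new pair is the real and imaginary part of i (v.xi)(a + i b), the amplitude of the
    derivative along [v]. *)
Lemma weighted_derive a b k K v : v \in [:: ux; uy] -> weighted k.+1 K a b ->
  weighted k K (fun xi => - dot2 v xi * b xi) (fun xi => dot2 v xi * a xi).
Proof.
move=> vv W; case: (W) => ma mb _ _.
have mv : measurable_fun [set: plane R] (fun xi : plane R => dot2 v xi) := measurable_dot v.
apply: (weighted_le _ _ _ _ _ _ _ W) => [||xi].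
- apply: measurable_funM => //; exact: measurableT_comp.
- exact: measurable_funM.
rewrite /amp !normrM normrN exprSr -mulrA ler_wpM2l ?exprn_ge0 ?(ltW (wt_gt0 _)) //.
by rewrite -mulrDr addrC ler_wpM2r ?addr_ge0 // dot_wt.
Qed.

Definition synth (a b : plane R -> R) (X : plane R) : R := (2 * pi)^-1 * I2 (phase a b X).

Lemma phase_L1 a b X K : weighted 0 K a b -> L1 l2 (phase a b X).
Proof.
move=> [ma mb La _]; apply: (L1_le _ _ _ _ La) => [|xi]; first exact: measurable_phase.
by rewrite /amp expr0 mul1r phase_le.
Qed.

Lemma twopi_inv_le1 : 0 <= (2 * pi : R)^-1 <= 1.
Proof.
have p2 := @pi_ge2 R; have p0 : 0 < 2 * pi :> R by lra.
by rewrite invr_ge0 (ltW p0) /= invf_le1 //; lra.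
Qed.

Lemma synth_le a b X K : weighted 0 K a b -> `|synth a b X| <= K.
Proof.
move=> W; have /andP[p0 p1] := twopi_inv_le1.
rewrite /synth normrM (ger0_norm p0) -[K]mul1r; apply: ler_pM => //.
have LP := phase_L1 _ _ X _ W; case: W => ma mb La; apply: le_trans.
by apply: I_norm_le => // xi; rewrite /amp expr0 mul1r phase_le.
Qed.

(** Although the derivative consumes one power of the weight, two are required, since the remainder
    is quadratic in [v.xi]. *)
Lemma synth_derive a b X K v : v \in [:: ux; uy] -> weighted 2 K a b ->
  is_derive X v (synth a b) (synth (fun xi => - dot2 v xi * b xi) (fun xi => dot2 v xi * a xi) X).
Proof.
move=> vv W; apply: (is_derive_remainder _ _ _ _ K) => h.
have W0 := weightedW _ _ 2 0 _ isT W.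
have W1 := weighted_derive _ _ _ _ _ vv (weightedW _ _ 2 1 _ isT W).
have /andP[p0 p1] := twopi_inv_le1.
have LA := phase_L1 _ _ (h *: v + X) _ W0; have LB := phase_L1 _ _ X _ W0.
have LC := phase_L1 _ _ X _ W1.
rewrite /synth mulrCA -2!mulrBr -IZ // -!IB //; [|exact: L1B|exact: L1Z].
rewrite normrM (ger0_norm p0) -[leRHS]mul1r; apply: ler_pM => //.
case: (W) => ma mb L2 I2K.
apply: (@le_trans _ _ (h ^+ 2 * I2 (amp a b 2))); last by rewrite mulrC ler_wpM2r ?sqr_ge0.
rewrite -IZ //; apply: I_norm_le; [apply: L1B; [exact: L1B|exact: L1Z]|exact: L1Z|].
move=> xi; rewrite /phase.
have -> : dot2 (h *: v + X) xi = dot2 X xi + h * dot2 v xi.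
  by rewrite /dot2 /= /GRing.scale /=; ring.
have := wave_remainder (a xi) (b xi) (dot2 X xi) (h * dot2 v xi).
set A := (X in `|X| <= _) => HA; set B := (X in `|X|).
have -> : B = A by rewrite /A /B; ring.
apply: (le_trans HA); rewrite exprMn mulrCA ler_wpM2l ?sqr_ge0 // /amp mulrC.
rewrite ler_wpM2r ?addr_ge0 // -[X in X <= _]real_normK ?num_real //.
by rewrite ler_pXn2r ?nnegrE ?(ltW (wt_gt0 _)) // dot_wt.
Qed.

(** Continuity is not part of it: below the top order it follows from the bounds on the next
    derivatives, through the Lipschitz estimate [Cb_lip]. *)
Fixpoint Cb k (K : R) (u : plane R -> R) : Prop :=
  (forall X, `|u X| <= K) /\
  if k is k'.+1 then
    forall v, v \in [:: ux; uy] -> (forall X, derivable u X v) /\ Cb k' K ('D_v u)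
  else True.

Lemma synth_Cb k K a b : weighted k.+1 K a b -> Cb k K (synth a b).
Proof.
elim: k a b => [|k IH] a b W.
  by split => // X; apply: synth_le; exact: weightedW W.
split=> [X|v vv]; first by apply: synth_le; exact: weightedW W.
have D X := synth_derive _ _ X _ _ vv (weightedW _ _ k.+2 2 _ isT W).
split=> [X|]; first by case: (D X).
have -> : 'D_v (synth a b) = synth (fun xi => - dot2 v xi * b xi) (fun xi => dot2 v xi * a xi).
  by apply/funext => X; case: (D X).
by apply: IH; exact: weighted_derive.
Qed.

(** Young's inequality splits the amplitude into half the Sobolev density of order [2 * k + 2] and
    the inverse square of the weight, integrable in the plane; the two terms of the constant are
    their integrals. *)
Lemma sobolev_weighted k s (M : R) (v w : plane R -> R) : (2 * k + 2)%:R <= s ->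
  measurable_fun [set: plane R] v -> measurable_fun [set: plane R] w ->
  (\int[leb2]_xi ((1 + dot2 xi xi) `^ s * (v xi ^+ 2 + w xi ^+ 2))%:E <= (M ^+ 2)%:E)%E ->
  weighted k (M ^+ 2 / 2 + (2 * pi) ^+ 2 / 4) v w.
Proof.
move=> ks mv mw H.
have mF : measurable_fun [set: plane R] (fun xi => wt xi `^ s * (v xi ^+ 2 + w xi ^+ 2)).
  apply: measurable_funM; last by apply: measurable_funD; exact: measurable_funX.
  apply: (measurableT_comp (measurable_powR s)).
  by have := measurable_wt 1; apply: eq_measurable_fun => xi _; rewrite expr1.
have LF : L1 l2 (fun xi => wt xi `^ s * (v xi ^+ 2 + w xi ^+ 2)).
  apply: L1_ge0 => //; last exact: le_lt_trans H (ltry _).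
  by move=> xi; rewrite mulr_ge0 ?powR_ge0 // addr_ge0 // sqr_ge0.
have IF : I2 (fun xi => wt xi `^ s * (v xi ^+ 2 + w xi ^+ 2)) <= M ^+ 2 by exact: I_le_of.
have [LP IP] := @poisson_L1 R 1 0 ltr01.
have LF2 := L1Z l2 2^-1 _ LF; have LP2 := L1Z l2 4^-1 _ LP.
have LG := L1D l2 _ _ LF2 LP2.
have key xi : amp v w k xi <= 2^-1 * (wt xi `^ s * (v xi ^+ 2 + w xi ^+ 2)) + 4^-1 * poisson 1 0 xi.
  have w0 := wt_gt0 xi; have w1 := wt_ge1 xi.
  have h1 : wt xi ^+ (2 * k + 2) <= wt xi `^ s.
    by rewrite -powR_mulrn ?(ltW w0) // ler_powR.
  have h2 : (wt xi ^+ 2)^-1 <= 4^-1 * poisson 1 0 xi.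
    rewrite /poisson /= !sub0r !sqrrN expr1n.
    have -> : 4^-1 * (2 * 1 / (1 + xi.1 ^+ 2) * (2 * 1 / (1 + xi.2 ^+ 2))) =
      ((1 + xi.1 ^+ 2) * (1 + xi.2 ^+ 2))^-1.
      by field; rewrite !gt_eqF // ltr_pwDl // sqr_ge0.
    have s1 := sqr_ge0 xi.1; have s2 := sqr_ge0 xi.2.
    rewrite lef_pV2 ?posrE ?exprn_gt0 ?mulr_gt0 ?ltr_pwDl // /wt /dot2 -!expr2.
      have := mulr_ge0 s1 s2; have := sqr_ge0 (xi.1 ^+ 2); have := sqr_ge0 (xi.2 ^+ 2).
      by move: s1 s2; rewrite expr2; nra.
    exact: addr_ge0.
  have aux (t : R) : wt xi ^+ k * `|t| <= 2^-1 * (wt xi ^+ (2 * k + 2) * t ^+ 2 + (wt xi ^+ 2)^-1).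
    have := sqr_ge0 (wt xi ^+ k * wt xi * `|t| - (wt xi)^-1).
    rewrite exprD mul2n -addnn exprD -[t ^+ 2]real_normK ?num_real //.
    have -> : (wt xi ^+ k * wt xi * `|t| - (wt xi)^-1) ^+ 2 =
      (wt xi ^+ k * wt xi ^+ k * wt xi ^+ 2 * `|t| ^+ 2 + (wt xi ^+ 2)^-1) - 2 * (wt xi ^+ k * `|t|).
      by field; rewrite gt_eqF.
    lra.
  have -> : amp v w k xi = wt xi ^+ k * `|v xi| + wt xi ^+ k * `|w xi| by exact: mulrDr.
  have := aux (v xi); have := aux (w xi).
  have := ler_wpM2r (addr_ge0 (sqr_ge0 (v xi)) (sqr_ge0 (w xi))) h1.
  by move: h2; lra.
have LA : L1 l2 (amp v w k).
  apply: (L1_le _ _ _ _ LG) => [|xi]; first exact: measurable_amp.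
  by rewrite ger0_norm ?amp_ge0.
split => //; apply: le_trans (I_le _ _ _ LA LG key) _.
rewrite (ID l2 _ _ LF2 LP2) (IZ l2 _ _ LF) (IZ l2 _ _ LP) IP mulrC [_ / 4]mulrC.
by rewrite lerD2r ler_wpM2r.
Qed.

(** The Sobolev bound only sees [u] up to null sets; continuity makes inversion hold at every point.
    The exponent is that of [sobolev_weighted] at [k.+1], the extra power being the one [synth_Cb]
    needs. *)
Theorem sobolev_Cb k s (M : R) u : (2 * k + 4)%:R <= s -> continuous u ->
  sobolev_ball s M u -> Cb k (M ^+ 2 / 2 + (2 * pi) ^+ 2 / 4) u.
Proof.
move=> ks cu [mu u2 [v [w [Fvw H]]]].
have [mv mw _] := Fvw.
have W : weighted k.+1 (M ^+ 2 / 2 + (2 * pi) ^+ 2 / 4) v w.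
  by apply: sobolev_weighted H => //; rewrite mulnS addnAC [(_ + 2 * k)%N]addnC.
suff -> : u = synth v w by exact: synth_Cb.
apply/funext => Y; apply: fourier_inversion => //.
  have := wt_L1 _ _ _ _ (weightedW _ _ k.+1 0 _ isT W).
  by apply: eq_integrable => // xi _ /=; rewrite /amp expr0 mul1r.
  exact: cu.
have L := wt_L1 _ _ _ _ (weightedW _ _ k.+1 1 _ isT W).
have L' := L1Z l2 2 _ L.
apply: (L1_le _ _ _ _ L') => [|xi].
  by apply: measurable_funM; apply: measurable_funD; exact: measurableT_comp.
rewrite /amp expr1 ger0_norm ?mulr_ge0 ?addr_ge0 // mulrA ler_wpM2r ?addr_ge0 //.
have := dot_wt ux xi ltac:(by rewrite !inE eqxx).
have := dot_wt uy xi ltac:(by rewrite !inE eqxx orbT).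
by rewrite /dot2 /= !mul0r !mul1r addr0 add0r; lra.
Qed.

End Weighted.

(** * Calculus of functions with bounded derivatives *)

Section BoundedDerivatives.
Opaque derive derivable.
Context {R : realType}.
Implicit Types (u w : plane R -> R) (v : plane R).

Definition uxy : seq (plane R) := [:: ux; uy].

Definition D1 u := forall v, v \in uxy -> forall X, derivable u X v.
Definition D2 u := D1 u /\ forall v, v \in uxy -> D1 ('D_v u).

Lemma D1_add u w : D1 u -> D1 w -> D1 (fun X => u X + w X).
Proof. by move=> du dw v vv X; apply: derivableD; [exact: du|exact: dw]. Qed.

Lemma D1_mul u w : D1 u -> D1 w -> D1 (fun X => u X * w X).
Proof. by move=> du dw v vv X; apply: derivableM; [exact: du|exact: dw]. Qed.

Lemma D1_cst (c : R) : D1 (fun=> c).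
Proof. by move=> v vv X; exact: derivable_cst. Qed.

Lemma derive_add u w v : v \in uxy -> D1 u -> D1 w ->
  'D_v (fun X => u X + w X) = fun X => 'D_v u X + 'D_v w X.
Proof.
by move=> vv du dw; apply/funext => X; apply: deriveD; [exact: du|exact: dw].
Qed.

Lemma derive_mul u w v : v \in uxy -> D1 u -> D1 w ->
  'D_v (fun X => u X * w X) = fun X => u X * 'D_v w X + w X * 'D_v u X.
Proof.
by move=> vv du dw; apply/funext => X; apply: deriveM; [exact: du|exact: dw].
Qed.

Lemma derive_scale u c v : v \in uxy -> D1 u ->
  'D_v (fun X => c * u X) = fun X => c * 'D_v u X.
Proof.
by move=> vv du; apply/funext => X; apply: deriveZ; exact: du.
Qed.

Lemma D2_add u w : D2 u -> D2 w -> D2 (fun X => u X + w X).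
Proof.
move=> [du ddu] [dw ddw]; split=> [|v vv]; first exact: D1_add.
by rewrite (derive_add _ _ _ vv du dw); exact: D1_add (ddu _ vv) (ddw _ vv).
Qed.

Lemma D2_scale c u : D2 u -> D2 (fun X => c * u X).
Proof.
move=> [du ddu]; split=> [|v vv]; first exact: D1_mul (D1_cst c) du.
by rewrite (derive_scale _ _ _ vv du); exact: D1_mul (D1_cst c) (ddu _ vv).
Qed.

Lemma uxy_x : ux \in uxy. Proof. by rewrite !inE eqxx. Qed.
Lemma uxy_y : uy \in uxy. Proof. by rewrite !inE eqxx orbT. Qed.

Lemma lap_add u w : D2 u -> D2 w -> lap (fun X => u X + w X) = fun X => lap u X + lap w X.
Proof.
move=> [du ddu] [dw ddw]; apply/funext => X.
have E v (vv : v \in uxy) : 'D_v ('D_v (fun X => u X + w X)) X =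
    'D_v ('D_v u) X + 'D_v ('D_v w) X.
  have := derive_add _ _ _ vv (ddu _ vv) (ddw _ vv).
  by rewrite -(derive_add _ _ _ vv du dw) => /(congr1 (@^~ X)).
exact: (etrans (congr2 +%R (E _ uxy_x) (E _ uxy_y)) (addrACA _ _ _ _)).
Qed.

Lemma lap_scale c u : D2 u -> lap (fun X => c * u X) = fun X => c * lap u X.
Proof.
move=> [du ddu]; apply/funext => X.
have E v (vv : v \in uxy) : 'D_v ('D_v (fun X => c * u X)) X = c * 'D_v ('D_v u) X.
  have := derive_scale _ c _ vv (ddu _ vv).
  by rewrite -(derive_scale _ _ _ vv du) => /(congr1 (@^~ X)).
by rewrite /lap (E _ uxy_x) (E _ uxy_y) mulrDr.
Qed.

Lemma Cb_bound k K u : Cb k K u -> forall X, `|u X| <= K.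
Proof. by case: k => [|k] []. Qed.

Lemma Cb_ge0 k K u : Cb k K u -> 0 <= K.
Proof. by move=> /Cb_bound/(_ 0); exact: le_trans. Qed.

Lemma Cb_D1 k K u : Cb k.+1 K u -> D1 u.
Proof. by move=> [_ H] v vv X; have [] := H v vv. Qed.

Lemma Cb_derive k K u v : v \in uxy -> Cb k.+1 K u -> Cb k K ('D_v u).
Proof. by move=> vv [_ H]; have [] := H v vv. Qed.

Lemma Cb_D2 k K u : Cb k.+2 K u -> D2 u.
Proof.
move=> Cu; split=> [|v vv]; first exact: Cb_D1 Cu.
exact: Cb_D1 (Cb_derive _ _ _ _ vv Cu).
Qed.

Lemma CbS k K u : Cb k.+1 K u -> Cb k K u.
Proof.
elim: k u => [|k IH] u [b H]; first by [].
split=> // v vv; have [d C] := H v vv; split=> //; exact: IH.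
Qed.

Lemma Cb_le k K K' u : K <= K' -> Cb k K u -> Cb k K' u.
Proof.
move=> KK; elim: k u => [|k IH] u [b H].
  by split=> // X; exact: le_trans (b X) KK.
split=> [X|v vv]; first exact: le_trans (b X) KK.
by have [d C] := H v vv; split=> //; exact: IH.
Qed.

Lemma Cb_add k K K' u w : Cb k K u -> Cb k K' w -> Cb k (K + K') (fun X => u X + w X).
Proof.
elim: k u w => [|k IH] u w Cu Cw.
  split=> // X; rewrite (le_trans (ler_normD _ _)) // lerD //; [exact: Cb_bound Cu _|exact: Cb_bound Cw _].
split=> [X|v vv].
  by rewrite (le_trans (ler_normD _ _)) // lerD //; [exact: Cb_bound Cu _|exact: Cb_bound Cw _].
have [du dw] := (Cb_D1 _ _ _ Cu, Cb_D1 _ _ _ Cw).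
split=> [X|]; first exact: D1_add.
by rewrite (derive_add _ _ _ vv du dw); apply: IH; exact: Cb_derive.
Qed.

Lemma Cb_mul k K K' u w : Cb k K u -> Cb k K' w -> Cb k (2 ^+ k * (K * K')) (fun X => u X * w X).
Proof.
elim: k K K' u w => [|k IH] K K' u w Cu Cw.
  split=> // X; rewrite expr0 mul1r normrM ler_pM //; [exact: Cb_bound Cu _|exact: Cb_bound Cw _].
split=> [X|v vv].
  rewrite normrM -[leLHS]mul1r ler_pM ?mulr_ge0 //; first by rewrite exprn_ege1 // ler1n.
  by apply: ler_pM => //; [exact: Cb_bound Cu _|exact: Cb_bound Cw _].
have [du dw] := (Cb_D1 _ _ _ Cu, Cb_D1 _ _ _ Cw).
split=> [X|]; first exact: (D1_mul _ _ du dw).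
rewrite (derive_mul _ _ _ vv du dw).
(* Leibniz turns one product into two, so each order doubles the constant. *)
have -> : 2 ^+ k.+1 * (K * K') = 2 ^+ k * (K * K') + 2 ^+ k * (K' * K) by rewrite exprS; ring.
apply: Cb_add; apply: IH; [exact: CbS Cu|exact: Cb_derive|exact: CbS Cw|exact: Cb_derive].
Qed.

Lemma Cb_cst k (c : R) : Cb k `|c| (fun=> c).
Proof.
suff : Cb k `|c| (fun=> c) /\ Cb k `|c| (fun=> 0) by case.
elim: k => [|k [_ IH]]; first by split; split=> // X; rewrite normr0.
have D (d : R) v : 'D_v (fun=> d) = (fun=> 0) :> (plane R -> R).
  by apply/funext => X; exact: derive_cst.
by split; split=> [X|v vv]; rewrite ?normr0 // D; split=> // X; exact: D1_cst.
Qed.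

Lemma Cb_lap k K u : Cb k.+2 K u -> Cb k (K + K) (lap u).
Proof.
move=> Cu; have [x y] := (uxy_x, uxy_y).
by apply: Cb_add; do 2! apply: Cb_derive => //.
Qed.

(** Moves along one axis, then the other, so partial derivatives along the axes suffice without
    joint differentiability. *)
Lemma D1_lip K u : D1 u -> (forall v, v \in uxy -> forall X, `|'D_v u X| <= K) ->
  forall X Y, `|u X - u Y| <= K * (`|X.1 - Y.1| + `|X.2 - Y.2|).
Proof.
move=> du uK [x1 x2] [y1 y2] /=; have [vx vy] := (uxy_x, uxy_y).
have [c _ E1] := mvt (fun x => u (x, x2)) (fun x => 'D_ux u (x, x2)) y1 x1
  (fun x => is_derive_along u (fun x => (x, x2)) ux x
     (fun k x => esym (line_ux k x x2)) (du _ vx _)).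
have [d _ E2] := mvt (fun x => u (y1, x)) (fun x => 'D_uy u (y1, x)) y2 x2
  (fun x => is_derive_along u (fun x => (y1, x)) uy x
     (fun k x => esym (line_uy k y1 x)) (du _ vy _)).
have -> : u (x1, x2) - u (y1, y2) =
  (u (x1, x2) - u (y1, x2)) + (u (y1, x2) - u (y1, y2)) by ring.
by rewrite E1 E2 (le_trans (ler_normD _ _)) // !normrM mulrDr lerD // ler_wpM2r // uK.
Qed.

Lemma D1_continuous K u : D1 u -> (forall v, v \in uxy -> forall X, `|'D_v u X| <= K) ->
  continuous u.
Proof.
move=> du uK; apply: cont_h (D1_lip _ _ du uK).
exact: le_trans (normr_ge0 _) (uK _ uxy_x 0).
Qed.

Lemma Cb_lip k K u : Cb k.+1 K u ->
  forall X Y, `|u X - u Y| <= K * (`|X.1 - Y.1| + `|X.2 - Y.2|).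
Proof.
move=> Cu; apply: D1_lip (Cb_D1 _ _ _ Cu) _ => v vv X.
exact: Cb_bound (Cb_derive _ _ _ _ vv Cu) X.
Qed.

Lemma Cb_continuous k K u : Cb k.+1 K u -> continuous u.
Proof. by move=> Cu; apply: cont_h (Cb_lip _ _ _ Cu); exact: Cb_ge0 Cu. Qed.

End BoundedDerivatives.

Section Uniform.
Opaque derive derivable.
Context {R : realType} {I : Type}.
Implicit Types (u w : I -> plane R -> R).

(** One constant for the whole family; in the final argument the index is a pair (b, t). *)
Definition CB k u := exists K, forall i, Cb k K (u i).

Lemma CB_add k u w : CB k u -> CB k w -> CB k (fun i X => u i X + w i X).
Proof. by move=> [K Hu] [K' Hw]; exists (K + K') => i; exact: Cb_add. Qed.

Lemma CB_mul k u w : CB k u -> CB k w -> CB k (fun i X => u i X * w i X).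
Proof. by move=> [K Hu] [K' Hw]; eexists => i; exact: Cb_mul. Qed.

Lemma CB_cst k (c : I -> R) (M : R) : (forall i, `|c i| <= M) -> CB k (fun i _ => c i).
Proof. by move=> H; exists M => i; apply: Cb_le (H i) _; exact: Cb_cst. Qed.

Lemma CBS k u : CB k.+1 u -> CB k u.
Proof. by move=> [K H]; exists K => i; exact: CbS. Qed.

Lemma CBW k m u : CB (k + m) u -> CB m u.
Proof. by elim: k => // k IH /CBS. Qed.

Lemma CB_lap k u : CB k.+2 u -> CB k (fun i => lap (u i)).
Proof. by move=> [K H]; eexists => i; exact: Cb_lap. Qed.

End Uniform.

(** * The truncated series *)

Section Quartic.
Opaque derive derivable.
Context {R : realType}.
Implicit Types (u w : plane R -> R) (v : plane R) (q : space3 R).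

Lemma is_derive_hor u v n q : derivable u q.1 v ->
  is_derive q (v, 0) (fun q => u q.1 * q.2 ^+ n) ('D_v u q.1 * q.2 ^+ n).
Proof.
move=> du.
have A (k : R) : (k *: ((v, 0) : space3 R) + q).1 = k *: v + q.1 by [].
have d1 : is_derive q ((v, 0) : space3 R) (fun q => u q.1) ('D_v u q.1).
  by split; [exact: derivable_affine A du|exact: derive_affine A].
have d2 : is_derive q ((v, 0) : space3 R) (fun q => q.2 ^+ n) 0.
  apply: (is_derive_remainder _ _ _ _ 0) => k.
  by rewrite /= scaler0 add0r subrr mulr0 subr0 normr0 mul0r.
apply: (is_derive_eq (is_deriveM d1 d2)).
by rewrite scaler0 add0r [LHS]mulrC.
Qed.

Lemma is_derive_vert u n q :
  is_derive q sz (fun q => u q.1 * q.2 ^+ n.+1) (u q.1 * (n.+1%:R * q.2 ^+ n)).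
Proof.
have A (k : R) : (k *: sz + q).2 = k *: 1 + q.2 by [].
have d1 : is_derive q sz (fun q => u q.1) 0.
  apply: (is_derive_remainder _ _ _ _ 0) => k.
  by rewrite /= scaler0 add0r subrr mulr0 subr0 normr0 mul0r.
have d2 : is_derive q sz (fun q => q.2 ^+ n.+1) (n.+1%:R * q.2 ^+ n).
  have := @is_deriveX R R id n.+1 q.2 1 1 (is_derive_id q.2 (1:R)).
  have -> : (id : R -> R) ^+ n.+1 = fun z => z ^+ n.+1 by rewrite exprfctE.
  move=> [dX eX]; split.
    exact: (derivable_affine (fun z : R => z ^+ n.+1) snd sz (1:R) q A dX).
  by rewrite (derive_affine (fun z : R => z ^+ n.+1) snd sz (1:R) q A) eX [LHS]mulr1.
apply: (is_derive_eq (is_deriveM d1 d2)).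
by rewrite scaler0 addr0.
Qed.

(** The factor [q.2 ^+ 0] lets [is_derive_hor] treat the three terms alike. *)
Definition quartic (w0 w1 w2 : plane R -> R) q :=
  w0 q.1 * q.2 ^+ 0 + w1 q.1 * q.2 ^+ 2 + w2 q.1 * q.2 ^+ 4.

Lemma quarticD a0 a1 a2 c0 c1 c2 q : quartic a0 a1 a2 q + quartic c0 c1 c2 q =
  quartic (fun X => a0 X + c0 X) (fun X => a1 X + c1 X) (fun X => a2 X + c2 X) q.
Proof. by rewrite /quartic; ring. Qed.

Lemma quartic_hor w0 w1 w2 v q : v \in uxy -> D1 w0 -> D1 w1 -> D1 w2 ->
  is_derive q (v, 0) (quartic w0 w1 w2) (quartic ('D_v w0) ('D_v w1) ('D_v w2) q).
Proof.
move=> vv d0 d1 d2.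
have i0 := is_derive_hor w0 v 0 q (d0 _ vv _).
have i1 := is_derive_hor w1 v 2 q (d1 _ vv _).
have i2 := is_derive_hor w2 v 4 q (d2 _ vv _).
exact: is_deriveD (is_deriveD i0 i1) i2.
Qed.

Lemma quartic_vert w0 w1 w2 q :
  is_derive q sz (quartic w0 w1 w2) (w1 q.1 * (2 * q.2 ^+ 1) + w2 q.1 * (4 * q.2 ^+ 3)).
Proof.
have d0 : is_derive q sz (fun q => w0 q.1 * q.2 ^+ 0) 0.
  apply: (is_derive_remainder _ _ _ _ 0) => k.
  by rewrite /= scaler0 add0r !expr0 subrr mulr0 subr0 normr0 mul0r.
have d := is_deriveD (is_deriveD d0 (is_derive_vert w1 1 q)) (is_derive_vert w2 3 q).
by apply: (is_derive_eq d); rewrite add0r.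
Qed.

Lemma quartic_vert2 w1 w2 q :
  is_derive q sz (fun q => w1 q.1 * (2 * q.2 ^+ 1) + w2 q.1 * (4 * q.2 ^+ 3))
    (2 * w1 q.1 + 12 * w2 q.1 * q.2 ^+ 2).
Proof.
have d := is_deriveD (is_derive_vert (fun X => w1 X * 2) 0 q)
  (is_derive_vert (fun X => w2 X * 4) 2 q).
have -> : (fun q : space3 R => w1 q.1 * (2 * q.2 ^+ 1) + w2 q.1 * (4 * q.2 ^+ 3)) =
    (fun q => w1 q.1 * 2 * q.2 ^+ 1) + (fun q => w2 q.1 * 4 * q.2 ^+ 3).
  by apply/funext => p; rewrite fctE !mulrA.
by apply: (is_derive_eq d); ring.
Qed.

Lemma quartic_derives w0 w1 w2 : D2 w0 -> D2 w1 -> D2 w2 ->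
  let W := quartic w0 w1 w2 in
  [/\ forall q (v : space3 R), v \in [:: sx; sy; sz] -> derivable W q v /\ derivable ('D_v W) q v,
      forall q, 'D_sx ('D_sx W) q + 'D_sy ('D_sy W) q = quartic (lap w0) (lap w1) (lap w2) q &
      forall q, 'D_sz ('D_sz W) q = 2 * w1 q.1 + 12 * w2 q.1 * q.2 ^+ 2].
Proof.
move=> [d0 dd0] [d1 dd1] [d2 dd2] W.
have E v (vv : v \in uxy) : 'D_(v, 0) W = quartic ('D_v w0) ('D_v w1) ('D_v w2).
  by apply/funext => q; have [] := quartic_hor _ _ _ _ q vv d0 d1 d2.
have H q v (vv : v \in uxy) := quartic_hor _ _ _ _ q vv (dd0 _ vv) (dd1 _ vv) (dd2 _ vv).
have EE v (vv : v \in uxy) q : 'D_(v, 0) ('D_(v, 0) W) q =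
    quartic ('D_v ('D_v w0)) ('D_v ('D_v w1)) ('D_v ('D_v w2)) q.
  by rewrite (E v vv); case: (H q v vv).
have Ez : 'D_sz W = fun q => w1 q.1 * (2 * q.2 ^+ 1) + w2 q.1 * (4 * q.2 ^+ 3).
  by apply/funext => q; have [] := quartic_vert w0 w1 w2 q.
split.
- have hor q v (vv : v \in uxy) : derivable W q (v, 0) /\ derivable ('D_(v, 0) W) q (v, 0).
    rewrite E //; split; last by have [] := H q v vv.
    by have [] := quartic_hor _ _ _ _ q vv d0 d1 d2.
  move=> q v; rewrite !inE => /or3P[]/eqP->; [exact: hor uxy_x|exact: hor uxy_y|].
  by rewrite Ez; split; [have [] := quartic_vert w0 w1 w2 q|have [] := quartic_vert2 w1 w2 q].
- move=> q; exact: (etrans (congr2 +%R (EE _ uxy_x q) (EE _ uxy_y q)) (quarticD _ _ _ _ _ _ _)).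
- by move=> q; rewrite Ez; have [] := quartic_vert2 w1 w2 q.
Qed.

End Quartic.

(** * The series sorted exactly by powers of [b] *)

Section Expansion.
Opaque derive derivable lap.
Context {R : realType}.
Variables (b : R) (eta psi : plane R -> R).

(** [corr], [corr1] and [corr2] are the exact remainders in f = psi + (b/2) lap psi + b^2 corr, lap
    f = lap psi + b corr1 and lap^2 f = lap^2 psi + b corr2. *)
Definition corr X := 5 / 24 * lap (lap psi) X + eta X * lap psi X.
Definition corr1 X := 2^-1 * lap (lap psi) X + b * lap corr X.
Definition corr2 := lap corr1.

(** What is left of the trace of the series minus [psi], divided by b^3. The nested polynomial, with
    its factor [eta X], is ((1 + b eta)^4 - 1) / b. *)
Definition defect X :=
  - 2^-1 * lap corr X - eta X * corr1 X - 2^-1 * (eta X * eta X) * (lap psi X + b * corr1 X)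
  + 24^-1 * corr2 X
  + 24^-1 * (eta X * (4 + b * eta X * (6 + b * eta X * (4 + b * eta X)))) *
    (lap (lap psi) X + b * corr2 X).

Hypotheses (dpsi : D2 psi) (dlap : D2 (lap psi)) (dlap2 : D2 (lap (lap psi)))
  (dcorr : D2 corr) (dcorr1 : D2 corr1).

Lemma fseriesE : fseries b eta psi = fun X => psi X + (b / 2 * lap psi X + b ^+ 2 * corr X).
Proof. by apply/funext => X; rewrite /fseries /corr; move: (lap (lap psi) X) (lap psi X) => a2 a1; ring. Qed.

Lemma fseries_D2 : D2 (fseries b eta psi).
Proof.
rewrite fseriesE.
exact: D2_add _ _ dpsi (D2_add _ _ (D2_scale _ _ dlap) (D2_scale _ _ dcorr)).
Qed.

Lemma lap_fseries : lap (fseries b eta psi) = fun X => lap psi X + b * corr1 X.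
Proof.
have s1 := D2_scale (b / 2) _ dlap; have s2 := D2_scale (b ^+ 2) _ dcorr.
rewrite fseriesE (lap_add _ _ dpsi (D2_add _ _ s1 s2)) (lap_add _ _ s1 s2).
rewrite (lap_scale _ _ dlap) (lap_scale _ _ dcorr).
apply/funext => X; rewrite /corr1.
by move: (lap psi X) (lap (lap psi) X) (lap corr X) => a1 a2 l; field.
Qed.

Lemma lap2_fseries :
  lap (lap (fseries b eta psi)) = fun X => lap (lap psi) X + b * corr2 X.
Proof.
by rewrite lap_fseries (lap_add _ _ dlap (D2_scale _ _ dcorr1)) (lap_scale _ _ dcorr1).
Qed.

Lemma PseriesE : Pseries b eta psi = quartic (fseries b eta psi)
  (fun X => - (b / 2) * lap (fseries b eta psi) X)
  (fun X => b ^+ 2 / 24 * lap (lap (fseries b eta psi)) X).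
Proof.
apply/funext => q; rewrite /Pseries /quartic /=.
by move: (lap (lap _) _) (lap _ _) (fseries _ _ _ _) => l2 l f; field.
Qed.

(** The coefficients of f are made for this: at order b^2 the terms in lap^2 psi cancel as 5/24 -
    1/4 + 1/24 = 0, and b^2 eta lap psi compensates the expansion of z^2 at the surface. *)
Lemma Pseries_surface X :
  Pseries b eta psi (X, 1 + b * eta X) = psi X + b ^+ 3 * defect X.
Proof.
rewrite /Pseries /= lap2_fseries lap_fseries /fseries /defect /corr1 /corr.
move: (lap psi X) (lap (lap psi) X) (corr2 X) => A1 A2 Q.
by move: (lap _ X) => L; field.
Qed.

End Expansion.

(** * Error of the series in a time slice *)

Section Approximation.
Opaque derive derivable lap.
Context {R : realType}.

Definition depth (b : R) (eta : plane R -> R) (X : plane R) : R := 1 + b * eta X.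

Lemma vertical_mvt h (F : space3 R -> R) X (z1 z2 : R) : {within strip h, continuous F} ->
  (forall q, inside h q -> derivable F q sz) -> 0 <= z1 -> z1 < z2 -> z2 <= h X ->
  exists2 c, z1 < c < z2 & F (X, z2) - F (X, z1) = 'D_sz F (X, c) * (z2 - z1).
Proof.
move=> cF dF z0 z12 zh.
have A (k y : R) : (X, k + y) = k *: sz + (X, y) :> space3 R.
  by rewrite /sz; congr (_, _); rewrite /= ?scaler0 ?add0r // [k *: 1]mulr1.
have dF' y : y \in `]z1, z2[%R -> is_derive y (1:R) (fun y => F (X, y)) ('D_sz F (X, y)).
  move=> /andP[]; rewrite !bnd_simp => zy yh.
  apply: (is_derive_along F (fun y => (X, y)) sz y) => //; apply: dF.
  by rewrite /inside /= (le_lt_trans z0) // (lt_le_trans yh).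
have cF' : {within `[z1, z2], continuous (fun y => F (X, y))}.
  apply: (@within_comp _ _ _ `[z1, z2]%classic (strip h) (fun y => (X, y)) F cF).
  - exact: (continuous_pair _ _ (@cst_continuous _ _ X) (fun y => @cvg_id _ (nbhs y))).
  - move=> y /=; rewrite in_itv /= => /andP[zy yh].
    by rewrite /strip /= (le_trans z0) // (le_trans yh).
have [c /andP[zc cz] E] := MVT z12 dF' cF'; exists c => //.
by move: zc cz; rewrite !bnd_simp => ->.
Qed.

Record potential (b : R) (eta psi : plane R -> R) (F : space3 R -> R) : Prop := {
  po_cont : {within strip (depth b eta), continuous F} ;
  po_derivable : forall q, inside (depth b eta) q -> forall v, v \in [:: sx; sy; sz] ->
    derivable F q v /\ derivable ('D_v F) q v ;
  po_laplace : forall q, inside (depth b eta) q ->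
    b * ('D_sx ('D_sx F) q + 'D_sy ('D_sy F) q) + 'D_sz ('D_sz F) q = 0 ;
  po_top : forall X, F (X, depth b eta X) = psi X ;
  po_bottom : forall X, 'D_sz F (X, r) @[r --> (0:R)^'+] --> (0:R) ;
  po_bounded : exists B, forall q, inside (depth b eta) q -> `|'D_sz F q| <= B }.

(** [F] itself may be unbounded, like [psi]; integrating the bounded vertical derivative down from
    the surface controls the difference only. [W_bounded] makes the same comparison for the
    series. *)
Lemma potential_bounded b eta psi F (Hm : R) : potential b eta psi F ->
  (forall X, 0 < depth b eta X <= Hm) ->
  exists B, forall q, strip (depth b eta) q -> `|F q - psi q.1| <= B.
Proof.
move=> P hpos; have [B HB] := po_bounded _ _ _ _ P; exists (`|B| * Hm) => -[X z] /andP[/= z0 zh].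
have Hm0 : 0 <= Hm by have /andP[h0 hH] := hpos X; exact: le_trans (ltW h0) hH.
have [->|zh'] := eqVneq z (depth b eta X).
  by rewrite (po_top _ _ _ _ P) subrr normr0 mulr_ge0.
have lzh : z < depth b eta X by rewrite lt_neqAle zh' zh.
have dF q (Iq : inside (depth b eta) q) : derivable F q sz.
  by have [] := po_derivable _ _ _ _ P _ Iq sz ltac:(by rewrite !inE eqxx !orbT).
have [c /andP[zc ch] E] := vertical_mvt _ _ _ _ _ (po_cont _ _ _ _ P) dF z0 lzh (lexx _).
rewrite -(po_top _ _ _ _ P) distrC /= E normrM ler_pM //.
  by rewrite (le_trans (HB _ _)) ?ler_norm // /inside /= ch (le_lt_trans z0).
have /andP[h0 hH] := hpos X.
by rewrite ger0_norm ?subr_ge0 //; lra.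
Qed.

Lemma derive_sub (F V : space3 R -> R) p v :
  (\forall q \near p, derivable F q v /\ derivable V q v) ->
  derivable ('D_v F) p v -> derivable ('D_v V) p v ->
  let G := fun q => F q - V q in
  [/\ derivable G p v, 'D_v G p = 'D_v F p - 'D_v V p, derivable ('D_v G) p v &
      'D_v ('D_v G) p = 'D_v ('D_v F) p - 'D_v ('D_v V) p].
Proof.
move=> nd dF dV G.
have e : \forall q \near p, 'D_v F q - 'D_v V q = 'D_v G q.
  by apply: filterS nd => q [d1 d2]; exact: esym (deriveB d1 d2).
have [d1 d2] := nbhs_singleton nd.
have dB := derivableB dF dV.
split; [exact: derivableB|exact: deriveB| |].
  exact: (near_eq_derivable e).
by rewrite -(near_eq_derive _ e); exact: (deriveB dF dV).
Qed.

(** The terms in lap f and lap^2 f cancel identically; what remains is (z^4 / 24) c^3 lap^3 f, with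
    [a3] for lap^3 f, and - c^4 times the Laplacian [de] of the defect. The added 1 makes the
    constant positive. *)
Lemma residual_le (c z a1 a2 a3 de l0 l1 l2 v1 v2 Kd K3 Kh : R) :
  l0 = a1 + (- c ^+ 3) * de -> l1 = - (c / 2) * a2 -> l2 = c ^+ 2 / 24 * a3 ->
  v1 = - (c / 2) * a1 -> v2 = c ^+ 2 / 24 * a2 ->
  0 < c < 1 -> 0 <= z -> z <= Kh -> `|de| <= Kd -> `|a3| <= K3 ->
  `|c * (l0 * z ^+ 0 + l1 * z ^+ 2 + l2 * z ^+ 4) + (2 * v1 + 12 * v2 * z ^+ 2)| <=
  (`|Kd| + Kh ^+ 4 * `|K3| + 1) * c ^+ 3.
Proof.
move=> -> -> -> -> -> /andP[c0 c1] z0 zK hd h3.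
have -> : c * ((a1 + - c ^+ 3 * de) * z ^+ 0 + - (c / 2) * a2 * z ^+ 2 +
    c ^+ 2 / 24 * a3 * z ^+ 4) + (2 * (- (c / 2) * a1) + 12 * (c ^+ 2 / 24 * a2) * z ^+ 2) =
  (- (c * de) + z ^+ 4 * (a3 / 24)) * c ^+ 3 by rewrite expr0; field.
have c0' := ltW c0.
rewrite normrM (ger0_norm (exprn_ge0 3 c0')); apply: ler_wpM2r; first exact: exprn_ge0.
rewrite (le_trans (ler_normD _ _)) // -[leLHS]addr0; apply: lerD => //.
rewrite normrN (normrM c) (normrM (z ^+ 4)) (normrM a3); apply: lerD.
  rewrite (ger0_norm c0') -[leRHS]mul1r; apply: ler_pM => //; first exact: ltW.
  by rewrite (le_trans hd) // ler_norm.
apply: ler_pM => //.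
  by rewrite normrX (ger0_norm z0); apply: lerXn2r => //; rewrite nnegrE // (le_trans z0).
rewrite (@ger0_norm _ 24^-1) ?invr_ge0 //.
by have := normr_ge0 a3; have := ler_norm K3; move: h3; lra.
Qed.

Lemma laplace_sub_le (c N x x' y y' z z' gx gy gz : R) :
  gx = x - x' -> gy = y - y' -> gz = z - z' -> c * (x + y) + z = 0 ->
  `|c * (x' + y') + z'| <= N -> `|c * (gx + gy) + gz| <= N.
Proof.
move=> -> -> -> L; rewrite -normrN; congr (`|_| <= N).
by rewrite -[LHS]add0r -L; ring.
Qed.

Lemma error_hor (c C1 K Kd g x w y e : R) : 0 < c < 1 -> 0 < K -> g = x - w ->
  w = y - c ^+ 3 * e -> `|g| <= C1 * (K * c ^+ 3) / c -> `|e| <= Kd ->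
  `|x - y| <= (`|C1| * K + `|Kd|) * c ^+ 2.
Proof.
move=> /andP[c0 c1] K0 -> -> hg he; have c2 : 0 <= c ^+ 2 by exact: sqr_ge0.
have -> : x - y = (x - (y - c ^+ 3 * e)) - c ^+ 2 * (c * e) by ring.
rewrite mulrDl (le_trans (ler_normB _ _)) //; apply: lerD.
  apply: (le_trans hg).
  have -> : C1 * (K * c ^+ 3) / c = C1 * (K * c ^+ 2) by field; rewrite gt_eqF.
  by rewrite -mulrA ler_wpM2r ?ler_norm // mulr_ge0 // ltW.
rewrite normrM (ger0_norm c2) [leRHS]mulrC; apply: ler_wpM2l => //.
rewrite normrM (gtr0_norm c0) -[leRHS]mul1r; apply: ler_pM => //; [exact: ltW|exact: ltW|].
by rewrite (le_trans he) // ler_norm.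
Qed.

Lemma error_vert (c C1 K Kd g x w y : R) : 0 < c < 1 -> 0 < K -> 0 <= Kd -> g = x - w ->
  w = y -> `|g| <= C1 * (K * c ^+ 3) -> `|x - y| <= (`|C1| * K + `|Kd|) * c ^+ 2.
Proof.
move=> /andP[c0 c1] K0 Kd0 -> -> hg; have c2 : 0 <= c ^+ 2 by exact: sqr_ge0.
apply: (le_trans hg); apply: (@le_trans _ _ (`|C1| * K * c ^+ 2)); last first.
  by apply: ler_wpM2r => //; rewrite lerDl.
apply: (@le_trans _ _ (`|C1| * (K * c ^+ 3))).
  by apply: ler_wpM2r (ler_norm _); rewrite mulr_ge0 ?exprn_ge0 ?ltW.
rewrite -mulrA; apply: ler_wpM2l => //; apply: ler_wpM2l; first exact: ltW.
by apply: ler_wiXn2l => //; exact: ltW.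
Qed.

Context {I : Type}.
Variables (b : I -> R) (eta psi : I -> plane R -> R).
Hypothesis b01 : forall i, 0 < b i < 1.
Hypothesis h_gt0 : forall i X, 0 < depth (b i) (eta i) X.
(** Nine is the exact count for the gradient of [psi]: lap psi keeps 8 derivatives, its Laplacian
    and [corr] 6, [corr1] 4, [corr2] and the defect 2, and the residual takes one more Laplacian. *)
Hypothesis Ceta : CB 9 eta.
Hypothesis dpsi : forall i, D1 (psi i).
Hypothesis Cpsi_x : CB 9 (fun i => 'D_ux (psi i)).
Hypothesis Cpsi_y : CB 9 (fun i => 'D_uy (psi i)).

Let CBb k : CB k (fun i _ => b i).
Proof. by apply: (CB_cst k b 1) => i; have /andP[b0 b1] := b01 i; rewrite ger0_norm ltW. Qed.

Let CBc k c : CB k (fun (_ : I) _ => c : R).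
Proof. exact: (CB_cst k (fun=> c) `|c|). Qed.

Let CA1 : CB 8 (fun i => lap (psi i)).
Proof.
have [K1 H1] := Cpsi_x; have [K2 H2] := Cpsi_y; exists (K1 + K2) => i.
apply: Cb_add; [exact: Cb_derive uxy_x (H1 i)|exact: Cb_derive uxy_y (H2 i)].
Qed.

Let CA2 : CB 6 (fun i => lap (lap (psi i))).
Proof. exact: CB_lap CA1. Qed.

Let Ccorr : CB 6 (fun i => corr (eta i) (psi i)).
Proof.
have Ce := CBW 3 6 _ Ceta; have C1 := CBW 2 6 _ CA1.
exact: CB_add _ _ _ (CB_mul _ _ _ (CBc 6 (5 / 24)) CA2) (CB_mul _ _ _ Ce C1).
Qed.

Let Ccorr1 : CB 4 (fun i => corr1 (b i) (eta i) (psi i)).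
Proof.
exact: CB_add _ _ _ (CB_mul _ _ _ (CBc 4 2^-1) (CBW 2 4 _ CA2))
  (CB_mul _ _ _ (CBb 4) (CB_lap _ _ Ccorr)).
Qed.

Let Ccorr2 : CB 2 (fun i => corr2 (b i) (eta i) (psi i)).
Proof. exact: CB_lap Ccorr1. Qed.

Let Clf : CB 4 (fun i X => lap (psi i) X + b i * corr1 (b i) (eta i) (psi i) X).
Proof. exact: CB_add _ _ _ (CBW 4 4 _ CA1) (CB_mul _ _ _ (CBb 4) Ccorr1). Qed.

Let Clf2 : CB 2 (fun i X => lap (lap (psi i)) X + b i * corr2 (b i) (eta i) (psi i) X).
Proof. exact: CB_add _ _ _ (CBW 4 2 _ CA2) (CB_mul _ _ _ (CBb 2) Ccorr2). Qed.

Let Cdefect : CB 2 (fun i => defect (b i) (eta i) (psi i)).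
Proof.
have Ce := CBW 7 2 _ Ceta.
have neg u : CB 2 u -> CB 2 (fun (i : I) X => - (u i X : R)).
  move=> Cu; have := CB_mul 2 _ _ (CBc 2 (-1)) Cu.
  by congr CB; apply/funext => i; apply/funext => X; rewrite mulN1r.
have M := @CB_mul R I 2; have A := @CB_add R I 2; have c := CBc 2; have be := M _ _ (CBb 2) Ce.
have t1 := M _ _ (c (- 2^-1)) (CBW 2 2 _ (CB_lap _ _ Ccorr)).
have t2 := neg _ (M _ _ Ce (CBW 2 2 _ Ccorr1)).
have t3 := neg _ (M _ _ (M _ _ (c 2^-1) (M _ _ Ce Ce)) (CBW 2 2 _ Clf)).
have t4 := M _ _ (c 24^-1) Ccorr2.
have e1 := A _ _ (c 4) be.
have e2 := A _ _ (c 6) (M _ _ be e1).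
have e3 := A _ _ (c 4) (M _ _ be e2).
have t5 := M _ _ (M _ _ (c 24^-1) (M _ _ Ce e3)) Clf2.
exact: A _ _ (A _ _ (A _ _ (A _ _ t1 t2) t3) t4) t5.
Qed.

Let D2psi i : D2 (psi i).
Proof.
split=> // v; rewrite !inE => /orP[]/eqP->.
- by have [K H] := Cpsi_x; exact: Cb_D1 (H i).
- by have [K H] := Cpsi_y; exact: Cb_D1 (H i).
Qed.

Let CB_D2 k u : CB k.+2 u -> forall i : I, D2 (u i : plane R -> R).
Proof. by move=> [K H] i; exact: Cb_D2 (H i). Qed.

Let CB_depth : CB 2 (fun i => depth (b i) (eta i)).
Proof. exact: CB_add _ _ _ (CBc 2 1) (CB_mul _ _ _ (CBb 2) (CBW 7 2 _ Ceta)). Qed.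

Let fs i := fseries (b i) (eta i) (psi i).

Let fsD2 i : D2 (fs i).
Proof.
exact: fseries_D2 (D2psi i) (CB_D2 _ _ CA1 i) (CB_D2 _ _ Ccorr i).
Qed.

Let lfE i : lap (fs i) = fun X => lap (psi i) X + b i * corr1 (b i) (eta i) (psi i) X.
Proof.
exact: lap_fseries (D2psi i) (CB_D2 _ _ CA1 i) (CB_D2 _ _ Ccorr i).
Qed.

Let lf2E i : lap (lap (fs i)) = fun X => lap (lap (psi i)) X + b i * corr2 (b i) (eta i) (psi i) X.
Proof.
exact: lap2_fseries (D2psi i) (CB_D2 _ _ CA1 i) (CB_D2 _ _ Ccorr i) (CB_D2 _ _ Ccorr1 i).
Qed.

(** The defect goes into the coefficient independent of [z]: the trace of [W] becomes exactly [psi],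
    while its vertical derivative and bottom condition are those of the series. *)
Let w0 i X := fs i X + (- b i ^+ 3) * defect (b i) (eta i) (psi i) X.
Let w1 i X := - (b i / 2) * lap (fs i) X.
Let w2 i X := b i ^+ 2 / 24 * lap (lap (fs i)) X.

Let w0D2 i : D2 (w0 i).
Proof. exact: D2_add (fsD2 i) (D2_scale _ _ (CB_D2 _ _ Cdefect i)). Qed.

Let lfD2 i : D2 (lap (fs i)).
Proof. rewrite lfE; exact: (CB_D2 _ _ Clf i). Qed.

Let lf2D2 i : D2 (lap (lap (fs i))).
Proof. rewrite lf2E; exact: (CB_D2 _ _ Clf2 i). Qed.

Let w1D2 i : D2 (w1 i). Proof. exact: D2_scale. Qed.
Let w2D2 i : D2 (w2 i). Proof. exact: D2_scale. Qed.

Let W i := quartic (w0 i) (w1 i) (w2 i).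

Let WE i q : W i q = Pseries (b i) (eta i) (psi i) q +
  (- b i ^+ 3) * defect (b i) (eta i) (psi i) q.1.
Proof.
rewrite PseriesE -/(fs i) /W /quartic /w0 /w1 /w2 /= !expr0 !mulr1.
by move: (lap (lap (fs i)) q.1) (lap (fs i) q.1) (fs i q.1) (defect _ _ _ _) => l2 l f d; ring.
Qed.

Let WP i q (v : plane R) : v \in uxy ->
  'D_(v, 0) (W i) q = 'D_(v, 0) (Pseries (b i) (eta i) (psi i)) q -
    b i ^+ 3 * 'D_v (defect (b i) (eta i) (psi i)) q.1.
Proof.
move=> vv; rewrite PseriesE.
have d1 i := (lfD2 i).1; have d2 i := (lf2D2 i).1.
have [_ ->] := quartic_hor _ _ _ v q vv (w0D2 i).1 (w1D2 i).1 (w2D2 i).1.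
have [_ ->] := quartic_hor _ _ _ v q vv (fsD2 i).1 (w1D2 i).1 (w2D2 i).1.
have -> : 'D_v (w0 i) = fun X => 'D_v (fs i) X + (- b i ^+ 3) * 'D_v (defect (b i) (eta i) (psi i)) X.
  have Dd := (CB_D2 _ _ Cdefect i).1.
  have E1 := derive_scale _ (- b i ^+ 3) _ vv Dd.
  have E2 := derive_add _ _ _ vv (fsD2 i).1 (D1_mul _ _ (D1_cst (- b i ^+ 3)) Dd).
  apply: (etrans E2); apply/funext => X; congr (_ + _).
  exact: (congr1 (@^~ X) E1).
rewrite /quartic /= !expr0 !mulr1.
have aux (f k d x y : R) : f + (- k) * d + x + y = f + x + y - k * d by ring.
exact: aux.
Qed.

Let WPz i q : 'D_sz (W i) q = 'D_sz (Pseries (b i) (eta i) (psi i)) q.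
Proof.
rewrite PseriesE.
have [_ ->] := quartic_vert (w0 i) (w1 i) (w2 i) q.
by have [_ ->] := quartic_vert (fs i) (w1 i) (w2 i) q.
Qed.

Let psi_continuous i : continuous (psi i).
Proof.
have [K1 H1] := Cpsi_x; have [K2 H2] := Cpsi_y.
apply: (D1_continuous (K1 + K2)) => // v vv X.
have k1 := Cb_ge0 _ _ _ (H1 i); have k2 := Cb_ge0 _ _ _ (H2 i).
move: vv; rewrite !inE => /orP[]/eqP->.
  by rewrite (le_trans (Cb_bound _ _ _ (H1 i) X)) // lerDl.
by rewrite (le_trans (Cb_bound _ _ _ (H2 i) X)) // lerDr.
Qed.

Let CB_continuous k u : CB k.+1 u -> forall i : I, continuous (u i : plane R -> R).
Proof. by move=> [K H] i; exact: Cb_continuous (H i). Qed.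

Let w0E i : w0 i = fun X => psi i X + (b i / 2 * lap (psi i) X +
  b i ^+ 2 * corr (eta i) (psi i) X + (- b i ^+ 3) * defect (b i) (eta i) (psi i) X).
Proof. by apply/funext => X; rewrite /w0 /fs fseriesE !addrA. Qed.

Let Cw0 : CB 2 (fun i X => b i / 2 * lap (psi i) X +
  b i ^+ 2 * corr (eta i) (psi i) X + (- b i ^+ 3) * defect (b i) (eta i) (psi i) X).
Proof.
have bk k : CB 2 (fun i _ => b i ^+ k).
  apply: (CB_cst 2 (fun i => b i ^+ k) 1) => i; have /andP[b0 b1] := b01 i.
  by rewrite ger0_norm ?exprn_ge0 ?exprn_ile1 // ltW.
have h : CB 2 (fun i _ => b i / 2) := CB_mul _ _ _ (CBb 2) (CBc 2 2^-1).
have n : CB 2 (fun i _ => - b i ^+ 3).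
  have := CB_mul _ _ _ (CBc 2 (-1)) (bk 3).
  by congr CB; apply/funext => i; apply/funext => X; rewrite mulN1r.
exact: CB_add _ _ _ (CB_add _ _ _ (CB_mul _ _ _ h (CBW 6 2 _ CA1))
  (CB_mul _ _ _ (bk 2) (CBW 4 2 _ Ccorr))) (CB_mul _ _ _ n Cdefect).
Qed.

Let Cw1 : CB 2 w1.
Proof.
rewrite /w1; under eq_fun => i do under eq_fun => X do rewrite lfE.
apply: CB_mul; last exact: (CBW 2 2 _ Clf).
apply: (CB_cst 2 (fun i => - (b i / 2)) 1) => i; have /andP[b0 b1] := b01 i.
by rewrite normrN ger0_norm; [move: b1|rewrite divr_ge0 // ltW]; lra.
Qed.

Let Cw2 : CB 2 w2.
Proof.
rewrite /w2; under eq_fun => i do under eq_fun => X do rewrite lf2E.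
apply: CB_mul; last exact: Clf2.
apply: (CB_cst 2 (fun i => b i ^+ 2 / 24) 1) => i; have /andP[b0 b1] := b01 i.
rewrite ger0_norm ?divr_ge0 ?exprn_ge0 ?(ltW b0) //.
have : b i ^+ 2 <= 1 by rewrite exprn_ile1 // ltW.
lra.
Qed.

Let W_continuous i : continuous (W i).
Proof.
have c (u : plane R -> R) n : continuous u -> continuous (fun q : space3 R => u q.1 * q.2 ^+ n).
  move=> cu q; apply: cvgM; first by apply: (@cvg_comp _ _ _ fst u); [exact: cvg_fst|exact: cu].
  by apply: (@cvg_comp _ _ _ snd (fun z => z ^+ n)); [exact: cvg_snd|exact: exprn_continuous].
have c0 : continuous (w0 i).
  rewrite w0E => X; apply: cvgD; first exact: psi_continuous.
  exact: (CB_continuous _ _ Cw0 i).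
move=> q; apply: cvgD; first apply: cvgD; apply: c => //.
  exact: CB_continuous Cw1 i.
exact: CB_continuous Cw2 i.
Qed.

Let W_bounded : exists K, forall i q, strip (depth (b i) (eta i)) q -> `|W i q - psi i q.1| <= K.
Proof.
have [K0 H0] := Cw0; have [K1 H1] := Cw1; have [K2 H2] := Cw2; have [Kh Hh] := CB_depth.
exists (K0 + K1 * Kh ^+ 2 + K2 * Kh ^+ 4) => i q /andP[z0 zh].
have aux (p c x y : R) : p + c + x + y - p = c + x + y by ring.
rewrite /W /quartic w0E expr0 mulr1 aux.
have zK : q.2 <= Kh.
  by rewrite (le_trans zh) // (le_trans (ler_norm _)) // (Cb_bound _ _ _ (Hh i)).
have pw n : `|q.2 ^+ n| <= Kh ^+ n.
  by rewrite normrX (ger0_norm z0) lerXn2r // nnegrE // (le_trans z0).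
rewrite (le_trans (ler_normD _ _)) // lerD //; last first.
  by rewrite normrM ler_pM // (Cb_bound _ _ _ (H2 i)).
rewrite (le_trans (ler_normD _ _)) // lerD //; first exact: (Cb_bound _ _ _ (H0 i)).
by rewrite normrM ler_pM // (Cb_bound _ _ _ (H1 i)).
Qed.

Let W_laplace : exists2 K, 0 < K & forall i q, strip (depth (b i) (eta i)) q ->
  `|b i * ('D_sx ('D_sx (W i)) q + 'D_sy ('D_sy (W i)) q) + 'D_sz ('D_sz (W i)) q| <= K * b i ^+ 3.
Proof.
have [Kd Hd] := CB_lap _ _ Cdefect; have [K3 H3] := CB_lap _ _ Clf2; have [Kh Hh] := CB_depth.
exists (`|Kd| + Kh ^+ 4 * `|K3| + 1) => [|i q /andP[z0 zh]].
  have [K0 HK] := (`|Kd|, erefl `|Kd|).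
  by rewrite ltr_wpDl // addr_ge0 // mulr_ge0 // exprn_even_ge0.
have [_ -> ->] := quartic_derives _ _ _ (w0D2 i) (w1D2 i) (w2D2 i).
have Dd := CB_D2 _ _ Cdefect i.
have e0 : lap (w0 i) = fun X => lap (fs i) X + (- b i ^+ 3) * lap (defect (b i) (eta i) (psi i)) X.
  apply: (etrans (lap_add _ _ (fsD2 i) (D2_scale (- b i ^+ 3) _ Dd))).
  apply/funext => X; congr (_ + _).
  exact: (congr1 (@^~ X) (lap_scale (- b i ^+ 3) _ Dd)).
have e1 : lap (w1 i) = fun X => - (b i / 2) * lap (lap (fs i)) X by exact: lap_scale (lfD2 i).
have e2 : lap (w2 i) = fun X => b i ^+ 2 / 24 * lap (lap (lap (fs i))) X by exact: lap_scale (lf2D2 i).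
have d := Cb_bound _ _ _ (Hd i) q.1; have := Cb_bound _ _ _ (H3 i) q.1; rewrite -lf2E => l3.
have zK : q.2 <= Kh.
  by rewrite (le_trans zh) // (le_trans (ler_norm _)) // (Cb_bound _ _ _ (Hh i)).
exact: (residual_le _ _ _ _ _ _ _ _ _ _ _ _ _ _ (congr1 (@^~ q.1) e0) (congr1 (@^~ q.1) e1)
  (congr1 (@^~ q.1) e2) erefl erefl (b01 i) z0 zK d l3).
Qed.

Theorem slice_error : exists C, forall i F, potential (b i) (eta i) (psi i) F ->
  forall q, inside (depth (b i) (eta i)) q -> forall v : space3 R, v \in [:: sx; sy; sz] ->
  `|'D_v F q - 'D_v (Pseries (b i) (eta i) (psi i)) q| <= C * b i ^+ 2.
Proof.
have [K K0 HK] := W_laplace; have [Kw Hw] := W_bounded; have [Kh Hh] := CB_depth.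
have [Kd Hd] := Cdefect.
(* [Kh] bounds the depth and its derivatives up to order two, hence serves as maximal depth and
   Lipschitz constant; the Laplacian is a sum of two of them, and [b <= 1]. *)
pose C1 := gradient_constant (Kh + Kh) Kh Kh.
exists (`|C1| * K + `|Kd|) => i F P q Iq v vv.
have /andP[b0 b1] := b01 i; pose h := depth (b i) (eta i).
have hK X : 0 < h X <= Kh.
  by rewrite h_gt0 (le_trans (ler_norm _)) // (Cb_bound _ _ _ (Hh i)).
have hc : continuous h by exact: Cb_continuous (Hh i).
have td : tame_depth (b i) (Kh + Kh) Kh Kh h.
  split => //.
  - exact: Cb_lip (Hh i).
  - exact: Cb_ge0 (Hh i).
  - by move=> X w ww; have [d dd] := Cb_D2 _ _ _ (Hh i); split; [exact: d|exact: dd].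
  - move=> X; rewrite normrM (gtr0_norm b0) -[leRHS]mul1r ler_pM ?(ltW b0) ?(ltW b1) //.
    exact: Cb_bound (Cb_lap _ _ _ (Hh i)) X.
pose G := fun q => F q - W i q.
have [dW _ _] := quartic_derives _ _ _ (w0D2 i) (w1D2 i) (w2D2 i).
have sub p w : inside h p -> w \in [:: sx; sy; sz] ->
    [/\ derivable G p w, 'D_w G p = 'D_w F p - 'D_w (W i) p, derivable ('D_w G) p w &
      'D_w ('D_w G) p = 'D_w ('D_w F) p - 'D_w ('D_w (W i)) p].
  move=> Ip ww; apply: derive_sub.
  - apply: filterS (near_inside _ hc _ Ip) => p' Ip'.
    by split; [have [] := po_derivable _ _ _ _ P _ Ip' _ ww|have [] := dW p' _ ww].
  - by have [] := po_derivable _ _ _ _ P _ Ip _ ww.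
  - by have [] := dW p _ ww.
have xs : sx \in [:: sx; sy; sz :> space3 R] by rewrite !inE eqxx.
have ys : sy \in [:: sx; sy; sz :> space3 R] by rewrite !inE eqxx orbT.
have zs : sz \in [:: sx; sy; sz :> space3 R] by rewrite !inE eqxx !orbT.
have sG : strip_solution (b i) (K * b i ^+ 3) h G.
  split.
  - have /subspace_continuousP cF := po_cont _ _ _ _ P.
    apply/subspace_continuousP => p Sp; apply: cvgB; first exact: cF.
    by apply: cvg_within_filter; exact: W_continuous.
  - by move=> p Ip w ww; have [] := sub _ _ Ip ww.
  - move=> p Ip; have [_ _ _ ex] := sub _ _ Ip xs; have [_ _ _ ey] := sub _ _ Ip ys.
    have [_ _ _ ez] := sub _ _ Ip zs; have L := po_laplace _ _ _ _ P _ Ip.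
    have Sp : strip h p by move: Ip => /andP[p0 ph]; rewrite /strip /= !ltW.
    exact: (laplace_sub_le _ _ _ _ _ _ _ _ _ _ _ ex ey ez L (HK i p Sp)).
  - move=> X; have E1 := po_top _ _ _ _ P X; have E2 := WE i (X, h X).
    have E3 := Pseries_surface _ _ _ (D2psi i) (CB_D2 _ _ CA1 i) (CB_D2 _ _ Ccorr i)
      (CB_D2 _ _ Ccorr1 i) X.
    have aux (f w d p s e : R) : f = s -> w = p + (- d) * e -> p = s + d * e -> f - w = 0.
      by move=> -> -> ->; ring.
    exact: aux _ _ _ _ _ _ E1 E2 E3.
  - move=> X; have /andP[hX _] := hK X.
    have L : 'D_sz F (X, r) - (w1 i X * (2 * r ^+ 1) + w2 i X * (4 * r ^+ 3))
        @[r --> (0:R)^'+] --> (0:R).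
      rewrite -[Y in _ --> Y](subr0 0); apply: cvgB; first exact: po_bottom P X.
      have L2 : w1 i X * (2 * r ^+ 1) + w2 i X * (4 * r ^+ 3) @[r --> (0:R)] -->
          w1 i X * (2 * (0:R) ^+ 1) + w2 i X * (4 * (0:R) ^+ 3).
        apply: cvgD; apply: cvgM (cvg_cst _) _; apply: cvgM (cvg_cst _) _.
          exact: (@exprn_continuous R 1 0).
        exact: (@exprn_continuous R 3 0).
      have z (x y : R) : x * (2 * 0 ^+ 1) + y * (4 * 0 ^+ 3) = 0.
        by rewrite !expr0n /= !mulr0 addr0.
      by rewrite z in L2; exact: cvg_at_right_filter L2.
    apply: cvg_trans L; apply: near_eq_cvg; near=> r.
    have Ir : inside h (X, r).
      have r0 : 0 < r by near: r; exact: nbhs_right_gt.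
      have rh : r < h X by near: r; exact: nbhs_right_lt.
      exact/andP.
    have [_ -> _ _] := sub _ _ Ir zs.
    by have [_ ->] := quartic_vert (w0 i) (w1 i) (w2 i) (X, r).
  - have [B HB] := potential_bounded _ _ _ _ _ P hK.
    exists (B + Kw) => p Sp; have b1' := HB p Sp; have b2' := Hw i p Sp.
    have -> : G p = (F p - psi i p.1) - (W i p - psi i p.1) by rewrite /G; ring.
    by rewrite (le_trans (ler_normB _ _)) // lerD.
have N0 : 0 < K * b i ^+ 3 by rewrite mulr_gt0 // exprn_gt0.
have C00 : 0 <= Kh + Kh by rewrite addr_ge0 // (Cb_ge0 _ _ _ (Hh i)).
have [gx gy gz] := strip_gradient _ _ _ _ _ _ (b01 i) N0 C00 td _ _ sG Iq.
have [_ sx' _ _] := sub _ _ Iq xs; have [_ sy' _ _] := sub _ _ Iq ys.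
have [_ sz' _ _] := sub _ _ Iq zs.
have Kd0 : 0 <= Kd := Cb_ge0 _ _ _ (Hd i).
move: vv; rewrite !inE => /or3P[]/eqP->.
- exact: error_hor (b01 i) K0 sx' (WP i q _ uxy_x) gx (Cb_bound _ _ _ (Cb_derive _ _ _ _ uxy_x (Hd i)) q.1).
- exact: error_hor (b01 i) K0 sy' (WP i q _ uxy_y) gy (Cb_bound _ _ _ (Cb_derive _ _ _ _ uxy_y (Hd i)) q.1).
- exact: error_vert (b01 i) K0 Kd0 sz' (WPz i q) gz.
Unshelve. all: by end_near.
Qed.

Lemma Pseries_derive_continuous i X (v : space3 R) : v \in [:: sx; sy; sz] ->
  continuous (fun z : R => 'D_v (Pseries (b i) (eta i) (psi i)) (X, z)).
Proof.
have c n (k : R) : continuous (fun z : R => k * z ^+ n).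
  by move=> z; apply: cvgM (cvg_cst _) _; exact: (@exprn_continuous R n).
have q (u0 u1 u2 : plane R -> R) : continuous (fun z : R => quartic u0 u1 u2 (X, z)).
  by move=> z; apply: cvgD; [apply: cvgD|]; exact: c.
have hor (w : plane R) : w \in uxy ->
    continuous (fun z : R => 'D_(w, 0) (Pseries (b i) (eta i) (psi i)) (X, z)).
  move=> ww; rewrite PseriesE.
  under eq_fun => z do have [_ ->] := quartic_hor _ _ _ w (X, z) ww (fsD2 i).1 (w1D2 i).1 (w2D2 i).1.
  exact: q.
rewrite !inE => /or3P[]/eqP->; [exact: hor uxy_x|exact: hor uxy_y|].
rewrite PseriesE.
under eq_fun => z do have [_ ->] := quartic_vert (fs i) (w1 i) (w2 i) (X, z).
move=> z; apply: cvgD; first exact: cvgM (cvg_cst _) (c 1 2 z).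
exact: cvgM (cvg_cst _) (c 3 4 z).
Qed.

End Approximation.

(** * The trace on the surface *)

Section FirstOrder.
Opaque derive derivable.
Context {R : realType} {V : normedModType R}.

Lemma is_derive_first_order (f : V -> R) X v (d M : R) :
  (forall e, 0 < e -> \forall s \near (0:R), `|f (s *: v + X) - f X - s * d| <= e * M * `|s|) ->
  is_derive X v f d.
Proof.
move=> H.
suff L : (k : R)^-1 *: ((f \o shift X) (k *: v) - f X) @[k --> (0:R)^'] --> d.
  by split; [apply/cvg_ex; exists d|exact: cvg_lim].
apply/cvgrPdist_le => e e0.
have c0 : 0 < e / (`|M| + 1) by rewrite divr_gt0 // ltr_wpDl.
have Hn := H _ c0.
near=> k.
have k0 : k != 0 by near: k; exact: nbhs_dnbhs_neq.
have Hk : `|f (k *: v + X) - f X - k * d| <= e / (`|M| + 1) * M * `|k|.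
  by near: k; apply: nbhs_dnbhs; exact: Hn.
have -> : d - k^-1 *: ((f \o shift X) (k *: v) - f X) = - (k^-1 * (f (k *: v + X) - f X - k * d)).
  by rewrite mulrBr mulKf // opprB.
rewrite normrN normrM normfV ler_pdivrMl ?normr_gt0 // [leRHS]mulrC.
apply: (le_trans Hk); apply: ler_wpM2r => //.
apply: (@le_trans _ _ (e / (`|M| + 1) * `|M|)); first by rewrite ler_wpM2l ?ler_norm // ltW.
rewrite mulrAC ler_pdivrMr ?ltr_wpDl // ler_wpM2l ?lerDl //; exact: ltW.
Unshelve. all: by end_near. Qed.

Lemma derivable_first_order (f : V -> R) X v e : derivable f X v -> 0 < e ->
  \forall s \near (0:R), `|f (s *: v + X) - f X - s * 'D_v f X| <= e * `|s|.
Proof.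
move=> df e0.
have L : (k : R)^-1 *: ((f \o shift X) (k *: v) - f X) @[k --> (0:R)^'] --> 'D_v f X := df.
move/cvgrPdist_le : L => /(_ _ e0) L.
have L' : \forall s \near (0:R), s != 0 ->
  `|'D_v f X - s^-1 *: ((f \o shift X) (s *: v) - f X)| <= e by exact: L.
apply: filterS L' => s Hs.
have [->|s0] := eqVneq s 0; first by rewrite scale0r add0r subrr mul0r subrr normr0 mulr0.
have -> : f (s *: v + X) - f X - s * 'D_v f X =
    - (s * ('D_v f X - s^-1 *: ((f \o shift X) (s *: v) - f X))).
  by rewrite mulrBr mulVKf // opprB.
by rewrite normrN normrM mulrC ler_wpM2r // Hs.
Qed.

End FirstOrder.

(** Asks for derivatives only on the interval [|y| <= |s|], over which the horizontal segment in
    [trace_derive] stays inside the strip. *)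
Lemma mvt_sym {R : realType} (f df : R -> R) (s : R) :
  (forall y, `|y| <= `|s| -> is_derive y (1:R) f (df y)) ->
  exists2 c, `|c| <= `|s| & f s - f 0 = df c * s.
Proof.
move=> fdf.
have D a c : (forall y, a <= y <= c -> `|y| <= `|s|) -> a < c ->
    exists2 y, `|y| <= `|s| & f c - f a = df y * (c - a).
  move=> H ac.
  have fc : {within `[a, c], continuous f}.
    apply: derivable_within_continuous => z; rewrite in_itv /= => zac.
    by case: (fdf _ (H _ zac)).
  have fd x : x \in `]a, c[%R -> is_derive x (1:R) f (df x).
    move=> /andP[]; rewrite !bnd_simp => ax xc; apply: fdf; apply: H.
    by rewrite !ltW.
  have [y /andP[]] := MVT ac fd fc; rewrite !bnd_simp => ay yc E.
  by exists y => //; apply: H; rewrite !ltW.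
case: (ltgtP s 0) => s0.
- have [y|y ys E] := D s 0 _ s0.
    by move=> /andP[sy y0]; rewrite !ler0_norm ?lerN2 // ltW.
  by exists y => //; rewrite -[LHS]opprB E sub0r mulrN opprK.
- have [y|y ys E] := D 0 s _ s0.
    by move=> /andP[sy y0]; rewrite !ger0_norm // ltW.
  by exists y => //; rewrite E subr0.
- by exists 0; rewrite ?normr0 // s0 subrr mulr0.
Qed.

Section Trace.
Opaque derive derivable.
Context {R : realType}.
Variables (h : plane R -> R) (F : space3 R -> R) (L : space3 R -> space3 R -> R) (Lp : R).
Hypothesis Lp_ge0 : 0 <= Lp.
Hypothesis h_gt0 : forall X, 0 < h X.
Hypothesis h_lip : forall X Y, `|h X - h Y| <= Lp * (`|X.1 - Y.1| + `|X.2 - Y.2|).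
Hypothesis h_D1 : D1 h.
Hypothesis F_cont : {within strip h, continuous F}.
Hypothesis F_derivable : forall q, inside h q -> forall v, v \in [:: sx; sy; sz] -> derivable F q v.
Hypothesis F_lim : forall q, strip h q -> forall v, v \in [:: sx; sy; sz] ->
  'D_v F p @[p --> within (inside h) (nbhs q)] --> L v q.

(** Moving vertically towards mid-depth enters the interior from any point of the closed strip, both
    boundaries included. *)
Lemma strip_curve q : strip h q ->
  (q.1, q.2 + d * (h q.1 / 2 - q.2)) @[d --> (0:R)^'+] --> within (inside h) (nbhs q).
Proof.
case: q => X z /andP[/= q0 qh] A; rewrite /within /= => nA.
have c : ((X, z + d * (h X / 2 - z)) : space3 R) @[d --> (0:R)] --> (X, z).
  have cz : continuous (fun d : R => z + d * (h X / 2 - z)).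
    move=> d; apply: cvgD; first exact: cvg_cst.
    by apply: cvgM; [exact: cvg_id|exact: cvg_cst].
  have := continuous_pair _ _ (@cst_continuous _ _ X) cz (0:R).
  by rewrite /continuous_at mul0r addr0.
have nA' : \forall d \near (0:R), inside h (X, z + d * (h X / 2 - z)) ->
    A (X, z + d * (h X / 2 - z)) by exact: c _ nA.
have nA2 : \forall d \near (0:R)^'+, inside h (X, z + d * (h X / 2 - z)) ->
    A (X, z + d * (h X / 2 - z)) by exact: cvg_within nA'.
rewrite /nbhs /=; near=> d.
have Ad : inside h (X, z + d * (h X / 2 - z)) -> A (X, z + d * (h X / 2 - z)).
  by near: d.
apply: Ad; have d0 : 0 < d by near: d; exact: nbhs_right_gt.
have d1 : d < 1 by near: d; exact: nbhs_right_lt.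
have hq := h_gt0 X; have := mulr_gt0 d0 hq.
by move=> dh; apply/andP; split => /=; nra.
Unshelve. all: by end_near. Qed.

Lemma limit_continuous q v : strip h q -> v \in [:: sx; sy; sz] ->
  L v p @[p --> within (strip h) (nbhs q)] --> L v q.
Proof.
move=> Sq vv; apply/cvgrPdist_le => e e0.
have /cvgrPdist_le/(_ _ e0) nD := F_lim _ Sq _ vv.
(* The closeness at [q] holds on an open set, hence also near each neighbouring [p]; this lets the
   limit at [p] be taken with the same bound. *)
have nD2 : \forall p \near q, \forall p' \near p, inside h p' -> `|L v q - 'D_v F p'| <= e.
  by apply: nbhs_interior; exact: nD.
apply: filterS nD2 => p np Sp.
have l1 := cvg_comp _ _ (strip_curve _ Sp) (F_lim _ Sp _ vv).
have l2 : `|L v q - 'D_v F (p.1, p.2 + d * (h p.1 / 2 - p.2))| @[d --> (0:R)^'+] -->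
    `|L v q - L v p| by apply: cvg_norm; apply: cvgB; [exact: cvg_cst|exact: l1].
have l3 : (fun=> e) @ (0:R)^'+ --> e by exact: cvg_cst.
by apply: (ler_cvg_to l2 l3); exact: (strip_curve _ Sp _ np).
Qed.

Lemma trace_limit_continuous v : v \in [:: sx; sy; sz] ->
  continuous (fun X => L v (X, h X)).
Proof.
move=> vv X.
have hc : continuous h := cont_h _ _ Lp_ge0 h_lip.
have S Y : strip h (Y, h Y) by rewrite /strip /= lexx andbT ltW.
have c : (Y, h Y) @[Y --> X] --> within (strip h) (nbhs (X, h X)).
  move=> A; rewrite /within /= => nA.
  have c1 : (Y, h Y) @[Y --> X] --> (X, h X).
    exact: (continuous_pair id h (fun Y => @cvg_id _ (nbhs Y)) hc X).
  have nA2 : \forall Y \near X, strip h (Y, h Y) -> A (Y, h Y) by exact: c1 _ nA.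
  by apply: filterS nA2 => Y H; exact: H (S Y).
exact: cvg_comp _ _ c (limit_continuous _ _ (S X) vv).
Qed.

Lemma lip_dir X v (s : R) : v \in uxy -> `|h (s *: v + X) - h X| <= Lp * `|s|.
Proof.
move=> vv; have := h_lip (s *: v + X) X; rewrite /= !addrK.
move: vv; rewrite !inE => /orP[]/eqP-> /=.
  by rewrite [s *: 1]mulr1 scaler0 normr0 addr0.
by rewrite [s *: 1]mulr1 scaler0 normr0 add0r.
Qed.

Lemma trace_le (lx lz a1 a2 a3 dh e s k r h0 hs zs Lq : R) : 0 <= e -> r = `|s| -> 0 <= k -> 0 <= Lq ->
  `|lz - a1| <= e -> `|lx - a2| <= e -> `|lz - a3| <= e ->
  zs = h0 - k * r -> `|hs - h0| <= Lq * r -> `|hs - h0 - s * dh| <= e * r ->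
  `|a1 * (hs - zs) + a2 * s - a3 * (h0 - zs) - s * (lx + dh * lz)| <=
  e * (2 * k + Lq + 1 + `|lz|) * r.
Proof.
move=> e0 rE k0 L0 h1 h2 h3 zE hh hd; have r0 : 0 <= r by rewrite rE.
have -> : a1 * (hs - zs) + a2 * s - a3 * (h0 - zs) - s * (lx + dh * lz) =
  - (lz - a1) * (hs - zs) - (lx - a2) * s + (lz - a3) * (h0 - zs) + lz * (hs - h0 - s * dh) by ring.
have -> : e * (2 * k + Lq + 1 + `|lz|) * r =
  e * ((Lq + k) * r) + e * r + e * (k * r) + `|lz| * (e * r) by ring.
have m1 : `|- (lz - a1) * (hs - zs)| <= e * ((Lq + k) * r).
  rewrite normrM normrN; apply: ler_pM => //.
  have -> : hs - zs = (hs - h0) + k * r by rewrite zE; ring.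
  by rewrite (le_trans (ler_normD _ _)) // mulrDl lerD // ger0_norm // mulr_ge0.
have m2 : `|(lx - a2) * s| <= e * r by rewrite normrM -rE; apply: ler_wpM2r.
have m3 : `|(lz - a3) * (h0 - zs)| <= e * (k * r).
  rewrite normrM; apply: ler_pM => //.
  by rewrite zE opprB addrCA subrr addr0 ger0_norm // mulr_ge0.
have m4 : `|lz * (hs - h0 - s * dh)| <= `|lz| * (e * r) by rewrite normrM; apply: ler_wpM2l.
apply: (le_trans (ler_normD _ _)); apply: lerD => //.
apply: (le_trans (ler_normD _ _)); apply: lerD => //.
by apply: (le_trans (ler_normB _ _)); apply: lerD.
Qed.

(* [F] need not extend beyond the surface: the increment of the trace is
   followed down to the level [z = h X - k |s|], which stays inside the strip over
   the whole horizontal segment, across, and up again. *)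
Lemma trace_derive X v : v \in uxy ->
  is_derive X v (fun X => F (X, h X)) (L (v, 0) (X, h X) + 'D_v h X * L sz (X, h X)).
Proof.
(* With slope [Lp + 1], one more than the Lipschitz constant, the level [h X - k * |s|] stays at
   least [|s|] below the surface along the segment. *)
move=> vv; pose k := Lp + 1; have k0 : 0 < k by rewrite ltr_wpDl.
have vs : (v, 0) \in [:: sx; sy; sz :> space3 R].
  by move: vv; rewrite !inE => /orP[]/eqP->; rewrite eqxx // orbT.
have zs : sz \in [:: sx; sy; sz :> space3 R] by rewrite !inE eqxx !orbT.
have Dz q Iq := F_derivable q Iq _ zs.
apply: (is_derive_first_order _ _ _ _ (2 * k + Lp + 1 + `|L sz (X, h X)|)) => e e0.
set lx := L (v, 0) _; set lz := L sz _.
have St : strip h (X, h X) by rewrite /strip /= lexx andbT ltW.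
have /cvgrPdist_le/(_ _ e0) nx := F_lim _ St _ vs.
have /cvgrPdist_le/(_ _ e0) nz := F_lim _ St _ zs.
have nxz : \forall q \near (X, h X), inside h q ->
    `|lx - 'D_(v, 0) F q| <= e /\ `|lz - 'D_sz F q| <= e.
  have nx' : \forall q \near (X, h X), inside h q -> `|lx - 'D_(v, 0) F q| <= e by exact: nx.
  have nz' : \forall q \near (X, h X), inside h q -> `|lz - 'D_sz F q| <= e by exact: nz.
  by apply: filterS2 nx' nz' => q H1 H2 Iq; split; [exact: H1|exact: H2].
have cg : ((p.1 *: v + X, p.2 + h X) : space3 R) @[p --> ((0, 0) : R * R)] --> (X, h X).
  have cx : continuous (fun p : R * R => p.1 *: v + X).
    by move=> p; apply: cvgD; [apply: cvgZr_tmp; exact: cvg_fst|exact: cvg_cst].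
  have cz : continuous (fun p : R * R => p.2 + h X).
    by move=> p; apply: cvgD; [exact: cvg_snd|exact: cvg_cst].
  have := continuous_pair _ _ cx cz (0, 0).
  by rewrite /continuous_at /= scale0r !add0r.
have /nbhs_ballP[d /= d0 Hd] := cg _ nxz.
have near_xz (s z : R) : `|s| < d -> `|z| < d -> inside h (s *: v + X, z + h X) ->
    `|lx - 'D_(v, 0) F (s *: v + X, z + h X)| <= e /\
    `|lz - 'D_sz F (s *: v + X, z + h X)| <= e.
  by move=> hs hz; apply: (Hd (s, z)); split; rewrite /ball /= sub0r normrN.
have nh := derivable_first_order _ _ _ _ (h_D1 _ vv X) e0.
near=> s.
(* Makes the whole three-leg path stay within [d] of the surface point, where the derivatives are
   [e]-close to their limits; the next bound keeps the level above the bottom. *)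
have sd : `|s| < d / (k + 1).
  by near: s; apply: near0_norm; rewrite divr_gt0 // ltr_wpDl // ltW.
have sh : `|s| < h X / k by near: s; apply: near0_norm; rewrite divr_gt0.
have hd : `|h (s *: v + X) - h X - s * 'D_v h X| <= e * `|s| by near: s.
have [->|s0] := eqVneq s 0.
  by rewrite scale0r add0r subrr mul0r subrr !normr0 mulr0.
have r0 : 0 < `|s| by rewrite normr_gt0.
rewrite ltr_pdivlMr // in sh; have k1 : 0 < k + 1 by rewrite ltr_wpDl // ltW.
rewrite ltr_pdivlMr // in sd.
pose z := h X - k * `|s|.
have z0 : 0 < z by rewrite subr_gt0 mulrC.
have zh y : `|y| <= `|s| -> z < h (y *: v + X).
  move=> ys; have := lip_dir X v y vv; rewrite ler_norml => /andP[+ _].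
  have : Lp * `|y| <= Lp * `|s| by rewrite ler_wpM2l.
  by rewrite /z /k; move: r0; lra.
have zX : z < h X by rewrite gtrBl mulr_gt0.
have near_le c y : `|y| <= `|s| -> z <= c -> c < h (y *: v + X) ->
    `|lx - 'D_(v, 0) F (y *: v + X, c)| <= e /\ `|lz - 'D_sz F (y *: v + X, c)| <= e.
  move=> ys zc ch; rewrite -[c](subrK (h X)).
  apply: near_xz.
  - by rewrite (le_lt_trans ys) // (le_lt_trans _ sd) // ler_peMr // lerDr ltW.
  - rewrite (le_lt_trans _ sd) // ler_norml.
    have := lip_dir X v y vv; rewrite ler_norml => /andP[_ ].
    have : Lp * `|y| <= Lp * `|s| by rewrite ler_wpM2l.
    by move: zc ch r0; rewrite /z /k => zc ch r0 l1 l2; apply/andP; split; nra.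
  - by rewrite subrK /inside /= ch andbT (lt_le_trans z0).
have ss : `|s| <= `|s| by [].
have s00 : `|0 : R| <= `|s| by rewrite normr0.
have [c1 /andP[zc1 c1h] E1] := vertical_mvt _ _ (s *: v + X) _ _ F_cont Dz (ltW z0) (zh _ ss) (lexx _).
have [c3 /andP[zc3 c3h] E3] := vertical_mvt _ _ X _ _ F_cont Dz (ltW z0) zX (lexx _).
have [c2 c2s E2] := mvt_sym (fun y => F (y *: v + X, z)) (fun y => 'D_(v, 0) F (y *: v + X, z)) s
  ltac:(move=> y ys; apply: (is_derive_along F (fun y => (y *: v + X, z)) (v, 0) y);
    [by move=> k' y'; congr (_, _); rewrite /= ?scaler0 ?add0r // scalerDl addrA
    |by apply: F_derivable vs; rewrite /inside /= z0 zh]).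
have [_ b1] := near_le c1 s ss (ltW zc1) c1h.
have [b2 _] := near_le z c2 c2s (lexx _) (zh _ c2s).
have [_ b3] : `|lx - 'D_(v, 0) F (0 *: v + X, c3)| <= e /\ `|lz - 'D_sz F (0 *: v + X, c3)| <= e.
  by apply: near_le => //; [exact: ltW|rewrite scale0r add0r].
rewrite scale0r add0r in b3 E2.
have := trace_le _ _ _ _ _ _ _ _ _ _ _ _ _ _ (ltW e0) erefl (ltW k0) Lp_ge0 b1 b2 b3
  (erefl z) (lip_dir X v s vv) hd.
rewrite -E1 -E2 -E3.
set A := F (_, h (_ + _)); set B := F (s *: v + X, z); set C := F (X, z); set D := F (X, h X).
by have -> : A - B + (B - C) - (D - C) = A - D by ring.
Unshelve. all: by end_near. Qed.

End Trace.

(** * Euler solutions at a fixed time *)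

Section Slice.
Opaque derive derivable lap.
Context {R : realType}.
Variables (b tau t : R) (eta : tplane R -> R) (Phi : spacetime R -> R).
Hypothesis t_int : 0 < t < tau.
Hypothesis sol : euler_solution b tau eta Phi.
Hypothesis h_gt0 : forall X, 0 < depth b (fun X => eta (t, X)) X.

Let h := depth b (fun X => eta (t, X)).
Let at_t (q : space3 R) : spacetime R := ((t, q.1), q.2).

Definition slice (q : space3 R) : R := Phi ((t, q.1), q.2).

Let at_t_continuous : continuous at_t.
Proof.
apply: continuous_pair; last by move=> q; exact: cvg_snd.
by apply: continuous_pair => q; [exact: cvg_cst|exact: cvg_fst].
Qed.

Let t_slab : 0 <= t <= tau. Proof. by move: t_int => /andP[t0 t1]; rewrite !ltW. Qed.

Lemma eta_slice_continuous : continuous (fun X => eta (t, X)).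
Proof.
have [/subspace_continuousP ce _] := eta_C1 sol.
move=> X.
have c : (t, Y) @[Y --> X] --> within (slab tau) (nbhs (t, X)).
  move=> A; rewrite /within /= => nA.
  have c1 : (t, Y) @[Y --> X] --> (t, X).
    exact: (continuous_pair (fun=> t) id (@cst_continuous _ _ t) (fun Y => @cvg_id _ (nbhs Y)) X).
  have nA2 : \forall Y \near X, slab tau (t, Y) -> A (t, Y) by exact: c1 _ nA.
  by apply: filterS nA2 => Y H; exact: H.
exact: cvg_comp _ _ c (ce (t, X) t_slab).
Qed.

Let strip_fluid q : strip h q -> fluid b tau eta (at_t q).
Proof. by move=> /andP[q0 qh]; split; rewrite /slab //= q0. Qed.

(** Since [t] is strictly between 0 and [tau], the slab is a neighbourhood of (t, X), and continuity
    within it is plain continuity. *)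
Lemma eta_continuous X : {for (t, X), continuous eta}.
Proof.
have [/subspace_continuousP ce _] := eta_C1 sol.
move=> A nA; have nA' := ce (t, X) t_slab _ nA.
have ns : \forall q \near (t, X), slab tau q.
  move: t_int => /andP[t0 t1].
  have c1 : (fun q : tplane R => q.1) @ (t, X) --> t by exact: cvg_fst.
  near=> q; apply/andP; split; apply: ltW; near: q.
    exact: (cvgr_gt _ c1 _ t0).
  exact: (cvgr_lt _ c1 _ t1).
by apply: filterS2 ns nA' => q sq; exact.
Unshelve. all: by end_near. Qed.

Let inside_interior q : inside h q -> (fluid b tau eta)° (at_t q).
Proof.
move=> /andP[q0 qh]; move: (t_int) => /andP[t0 t1].
have c1 : (fun p : spacetime R => p.1.1) @ at_t q --> t.
  by apply: (@cvg_comp _ _ _ fst fst); exact: cvg_fst.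
have c2 : (fun p : spacetime R => p.2) @ at_t q --> q.2 by exact: cvg_snd.
have c3 : (fun p : spacetime R => 1 + b * eta p.1 - p.2) @ at_t q --> h q.1 - q.2.
  apply: cvgB => //; apply: cvgD; first exact: cvg_cst.
  apply: cvgM; first exact: cvg_cst.
  by apply: (@cvg_comp _ _ _ fst eta); [exact: cvg_fst|exact: eta_continuous].
rewrite -subr_gt0 in qh.
have n1 : \forall p \near at_t q, 0 < p.1.1 by exact: (cvgr_gt _ c1 _ t0).
have n2 : \forall p \near at_t q, p.1.1 < tau by exact: (cvgr_lt _ c1 _ t1).
have n3 : \forall p \near at_t q, 0 < p.2 by exact: (cvgr_gt _ c2 _ q0).
have n4 : \forall p \near at_t q, 0 < 1 + b * eta p.1 - p.2 by exact: (cvgr_gt _ c3 _ qh).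
rewrite /interior /=; near=> p.
have p1 : 0 < p.1.1 by near: p. have p2 : p.1.1 < tau by near: p.
have p3 : 0 < p.2 by near: p. have p4 : 0 < 1 + b * eta p.1 - p.2 by near: p.
split; apply/andP; split; [exact: ltW|exact: ltW|exact: ltW|].
by rewrite -subr_ge0 ltW.
Unshelve. all: by end_near. Qed.

Let at_t_line (v : space3 R) q (k : R) : at_t (k *: v + q) = k *: st v + at_t q.
Proof. by rewrite /at_t /st; congr (_, _, _); rewrite /= scaler0 add0r. Qed.

Let derive_slice v : 'D_v slice = fun q => 'D_(st v) Phi (at_t q).
Proof.
by apply/funext => q; exact: (derive_affine Phi at_t v (st v) q (at_t_line v q)).
Qed.

Let derive2_slice v w : 'D_w ('D_v slice) = fun q => 'D_(st w) ('D_(st v) Phi) (at_t q).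
Proof.
rewrite derive_slice; apply/funext => q.
exact: (derive_affine ('D_(st v) Phi) at_t w (st w) q (at_t_line w q)).
Qed.

Definition velocity v (q : space3 R) := dPhi b tau eta Phi v ((t, q.1), q.2).

Lemma slice_limit q v : strip h q ->
  'D_v slice p @[p --> within (inside h) (nbhs q)] --> velocity v q.
Proof.
move=> Sq; have [_ /(_ (st v))[_ cP]] := Phi_C1 sol.
have := cP _ (strip_fluid _ Sq); rewrite derive_slice => L.
have c : at_t p @[p --> within (inside h) (nbhs q)] -->
    within (fluid b tau eta)° (nbhs (at_t q)).
  move=> A; rewrite /within /= => nA.
  have nA2 : \forall p \near q, (fluid b tau eta)° (at_t p) -> A (at_t p).
    exact: at_t_continuous _ _ nA.
  by apply: filterS nA2 => p H Ip; apply: H; exact: inside_interior.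
exact: cvg_comp _ _ c L.
Qed.

Lemma slice_continuous : {within strip h, continuous slice}.
Proof.
have [cP _] := Phi_C1 sol.
exact: (@within_comp _ _ _ (strip h) (fluid b tau eta) at_t Phi cP at_t_continuous strip_fluid).
Qed.

Lemma slice_derivable q v : inside h q -> derivable slice q v.
Proof.
move=> Iq; have [_ /(_ (st v))[dP _]] := Phi_C1 sol.
apply: (derivable_affine Phi at_t v (st v) q (at_t_line v q)).
exact/dP/inside_interior.
Qed.

Lemma slice_potential : bounded_velocity b tau eta Phi ->
  potential b (fun X => eta (t, X)) (trace b eta Phi t) slice.
Proof.
move=> bv; split.
- exact: slice_continuous.
- move=> q Iq v vv; split; first exact: slice_derivable.
  rewrite derive_slice.
  apply: (derivable_affine ('D_(st v) Phi) at_t v (st v) q (at_t_line v q)).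
  by have [] := Phi_C2 sol v v (inside_interior _ Iq).
- move=> q Iq; have E v := congr1 (@^~ q) (derive2_slice v v).
  have aux (x y z x' y' z' : R) : x = x' -> y = y' -> z = z' ->
    b * (x' + y') + z' = 0 -> b * (x + y) + z = 0 by move=> -> -> ->.
  exact: aux (E sx) (E sy) (E sz) (euler_laplace sol (inside_interior _ Iq)).
- by [].
- move=> X; have EB := euler_bottom sol (q := (t, X)) t_slab.
  have S0 : strip h (X, 0) by rewrite /strip /= lexx ltW.
  have L := slice_limit _ sz S0.
  have c : ((X, r) : space3 R) @[r --> (0:R)^'+] --> within (inside h) (nbhs (X, (0:R))).
    move=> A; rewrite /within /= => nA.
    have c1 : (X, r) @[r --> (0:R)] --> (X, (0:R)).
      exact: (continuous_pair (fun=> X) id (@cst_continuous _ _ X) (fun r => @cvg_id _ (nbhs r)) 0).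
    have nA1 : \forall r \near (0:R), inside h (X, r) -> A (X, r) by exact: c1 _ nA.
    have nA2 : \forall r \near (0:R)^'+, inside h (X, r) -> A (X, r) by exact: cvg_within nA1.
    rewrite /nbhs /=; near=> r.
    have AH : inside h (X, r) -> A (X, r) by near: r.
    apply: AH; apply/andP; split; near: r; first exact: nbhs_right_gt.
    exact: (nbhs_right_lt (h_gt0 X)).
  have L' : 'D_sz slice (X, r) @[r --> (0:R)^'+] --> velocity sz (X, 0) := cvg_comp _ _ c L.
  by rewrite /velocity /= EB in L'.
- have [B HB] := bv t t_int; exists (B + 1) => q Iq.
  have Sq : strip h q by move: Iq => /andP[q0 qh]; rewrite /strip /= !ltW.
  have Hq : `|velocity sz q| <= B by apply: HB => //; rewrite !inE eqxx !orbT.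
  (* The neighbourhoods are not punctured, so closeness to the limit holds at [q] itself and the
     bound on the extended velocity passes to the classical derivative, at the price of 1. *)
  have /cvgrPdist_le/(_ _ ltr01) n := slice_limit _ sz Sq.
  have : inside h q -> `|velocity sz q - 'D_sz slice q| <= 1 := nbhs_singleton n.
  move=> /(_ Iq) Hd.
  rewrite -['D_sz slice q](subKr (velocity sz q)) (le_trans (ler_normB _ _)) //.
  exact: lerD.
Unshelve. all: by end_near. Qed.

(** Supplies the continuity of the derivatives of the trace that [sobolev_Cb] requires; the Sobolev
    hypothesis alone cannot give it pointwise. *)
Lemma trace_C1 K : Cb 2 K (fun X => eta (t, X)) -> 0 < b ->
  D1 (trace b eta Phi t) /\ forall v, v \in uxy -> continuous ('D_v (trace b eta Phi t)).
Proof.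
move=> Ce b0.
have Ch : Cb 2 (1 + 2 ^+ 2 * (b * K)) h.
  apply: Cb_add; first by have := Cb_cst 2 (1:R); rewrite normr1.
  by apply: Cb_mul => //; have := Cb_cst 2 b; rewrite gtr0_norm.
have D v (vv : v \in uxy) X := trace_derive h slice velocity _ (Cb_ge0 _ _ _ Ch) h_gt0
  (Cb_lip _ _ _ Ch) (Cb_D1 _ _ _ Ch) slice_continuous (fun q Iq w _ => slice_derivable q w Iq)
  (fun q Sq w _ => slice_limit q w Sq) X v vv.
split=> v vv; first by move=> X; have [] := D v vv X.
have -> : 'D_v (trace b eta Phi t) = fun X =>
    velocity (v, 0) (X, h X) + 'D_v h X * velocity sz (X, h X).
  by apply/funext => X; have [_ E] := D v vv X; exact: E.
have cL w : w \in [:: sx; sy; sz] -> continuous (fun X => velocity w (X, h X)).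
  exact: (trace_limit_continuous h slice velocity _ (Cb_ge0 _ _ _ Ch) h_gt0
    (Cb_lip _ _ _ Ch) (fun q Sq w _ => slice_limit q w Sq)).
move=> X; apply: cvgD; last apply: cvgM.
- apply: cL; move: vv; rewrite !inE => /orP[]/eqP->; first by rewrite eqxx.
  by rewrite eqxx orbT.
- exact: Cb_continuous (Cb_derive _ _ _ _ vv Ch) X.
- by apply: cL; rewrite !inE eqxx !orbT.
Qed.

End Slice.

(** * From interior bounds to the closed fluid domain *)

Section Norm.
Opaque derive derivable lap.
Context {R : realType}.

Lemma Linfty_norm_le (A : set (space3 R)) (g : space3 R -> R) (M : R) :
  0 <= M -> (forall q, A q -> `|g q| <= M) -> (Linfty_norm A g <= M%:E)%E.
Proof.
move=> M0 H; rewrite /Linfty_norm unlock /=; case: ifPn => // _.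
apply/ess_supP; apply: nearW => q /=; rewrite lee_fin indicE normrM.
have [qA|qA] := boolP (q \in A); last by rewrite normr0 mul0r.
by rewrite normr1 mul1r; apply: H; rewrite inE in qA.
Qed.

End Norm.

(** The velocity on the boundary is defined as a limit from the interior, so the interior bound
    passes to it along [strip_curve]; continuity of the series in [z] alone is enough, that curve
    being vertical. *)
Lemma error_closure (R : realType) (h : plane R -> R) (F P L : space3 R -> R) v (c : R) :
  (forall X, 0 < h X) ->
  (forall q, strip h q -> 'D_v F p @[p --> within (inside h) (nbhs q)] --> L q) ->
  (forall X, continuous (fun z : R => 'D_v P (X, z))) ->
  (forall q, inside h q -> `|'D_v F q - 'D_v P q| <= c) ->
  forall q, strip h q -> `|L q - 'D_v P q| <= c.
Proof.
move=> h0 FL Pc H q Sq; have sc := strip_curve h h0 q Sq.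
have l1 : 'D_v F (q.1, q.2 + d * (h q.1 / 2 - q.2)) @[d --> (0:R)^'+] --> L q.
  exact: cvg_comp _ _ sc (FL _ Sq).
have l2 : 'D_v P (q.1, q.2 + d * (h q.1 / 2 - q.2)) @[d --> (0:R)^'+] --> 'D_v P q.
  have c0 : q.2 + d * (h q.1 / 2 - q.2) @[d --> (0:R)] --> q.2.
    rewrite -[Y in _ --> Y]addr0 -[Y in _ --> _ + Y](mul0r (h q.1 / 2 - q.2)).
    by apply: cvgD; [exact: cvg_cst|apply: cvgM; [exact: cvg_id|exact: cvg_cst]].
  have := cvg_comp _ _ (cvg_at_right_filter c0) (Pc q.1 q.2).
  by rewrite -surjective_pairing.
have l3 : `|'D_v F (q.1, q.2 + d * (h q.1 / 2 - q.2)) -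
    'D_v P (q.1, q.2 + d * (h q.1 / 2 - q.2))| @[d --> (0:R)^'+] --> `|L q - 'D_v P q|.
  by apply: cvg_norm; apply: cvgB.
have l4 : (fun=> c) @ (0:R)^'+ --> c by exact: cvg_cst.
apply: (ler_cvg_to l3 l4); apply: (sc (fun p => `|'D_v F p - 'D_v P p| <= c)).
by rewrite /within /=; apply: nearW.
Qed.

Theorem corollary1 (R : realType) :
  exists2 s0 : R, 0 < s0 &
  forall (s T : R), s0 <= s -> 0 < T ->
  forall (eta : R -> tplane R -> R) (Phi : R -> spacetime R -> R),
  (forall b : R, 0 < b < 1 -> euler_solution b (T / b) (eta b) (Phi b)) ->
  (forall b : R, 0 < b < 1 -> bounded_velocity b (T / b) (eta b) (Phi b)) ->
  (exists2 M : R, 0 <= M & forall b t : R, 0 < b < 1 -> 0 <= t <= T / b ->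
     let psi := trace b (eta b) (Phi b) t in
     [/\ sobolev_ball s M (fun X => eta b (t, X)),
         sobolev_ball s M ('D_ux psi) &
         sobolev_ball s M ('D_uy psi)]) ->
  (exists2 hmin : R, 0 < hmin & forall b t : R, 0 < b < 1 -> 0 <= t <= T / b ->
     forall X, hmin <= 1 + b * eta b (t, X)) ->
  exists C : R, forall b t : R, 0 < b < 1 -> 0 < t < T / b ->
    let P := Pseries b (fun X => eta b (t, X)) (trace b (eta b) (Phi b) t) in
    let err v := fun q : space3 R =>
      dPhi b (T / b) (eta b) (Phi b) v ((t, q.1), q.2) - 'D_v P q in
    [/\ (Linfty_norm (Omega b (eta b) t) (err sx) <= (C * b ^+ 2)%:E)%E,
        (Linfty_norm (Omega b (eta b) t) (err sy) <= (C * b ^+ 2)%:E)%E &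
        (Linfty_norm (Omega b (eta b) t) (err sz) <= (C * b ^+ 2)%:E)%E].
Proof.
(* The exponent is [2 * 9 + 4], that is, [sobolev_Cb] for nine bounded derivatives. *)
exists 22%:R => // s T s22 T0 eta Phi sol bv [M M0 sob] [hmin hmin0 deep].
pose I := {p : R * R | 0 < p.1 < 1 /\ 0 < p.2 < T / p.1}.
pose beta (i : I) := (sval i).1; pose time (i : I) := (sval i).2.
have b01 i : 0 < beta i < 1 by case: (svalP i).
have tint i : 0 < time i < T / beta i by case: (svalP i).
have tint' i : 0 <= time i <= T / beta i by have /andP[t0 t1] := tint i; rewrite !ltW.
pose e (i : I) X := eta (beta i) (time i, X).
pose p (i : I) := trace (beta i) (eta (beta i)) (Phi (beta i)) (time i).
have h_gt0 i X : 0 < depth (beta i) (e i) X.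
  exact: lt_le_trans hmin0 (deep _ _ (b01 i) (tint' i) X).
pose K := M ^+ 2 / 2 + (2 * pi) ^+ 2 / 4.
have Ce i : Cb 9 K (e i).
  have [S _ _] := sob _ _ (b01 i) (tint' i).
  apply: (sobolev_Cb 9 s M (e i) s22 _ S).
  exact: eta_slice_continuous (tint i) (sol _ (b01 i)).
(* The surface comes first: the chain rule for the trace needs the bounds on [eta] just obtained. *)
have Cp i : D1 (p i) /\ forall v, v \in uxy -> continuous ('D_v (p i)).
  have [K2 HK] := CBW 7 2 _ (ex_intro (fun K => forall i, Cb 9 K (e i)) K Ce).
  have /andP[b0 _] := b01 i.
  exact: trace_C1 (tint i) (sol _ (b01 i)) (h_gt0 i) K2 (HK i) b0.
have Cx i : Cb 9 K ('D_ux (p i)).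
  have [_ S _] := sob _ _ (b01 i) (tint' i).
  exact: (sobolev_Cb 9 s M _ s22 ((Cp i).2 _ uxy_x) S).
have Cy i : Cb 9 K ('D_uy (p i)).
  have [_ _ S] := sob _ _ (b01 i) (tint' i).
  exact: (sobolev_Cb 9 s M _ s22 ((Cp i).2 _ uxy_y) S).
have CBe : CB 9 e by exists K.
have CBx : CB 9 (fun i => 'D_ux (p i)) by exists K.
have CBy : CB 9 (fun i => 'D_uy (p i)) by exists K.
have [C HC] := slice_error beta e p b01 h_gt0 CBe (fun i => (Cp i).1) CBx CBy.
have Pc := Pseries_derive_continuous beta e p b01 CBe (fun i => (Cp i).1) CBx CBy.
exists C => b t hb ht P err.
pose i : I := exist _ (b, t) (conj hb ht).
have pot := slice_potential _ _ _ _ _ (tint i) (sol _ (b01 i)) (h_gt0 i) (bv _ (b01 i)).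
have E := HC i _ pot.
have bound v : v \in [:: sx; sy; sz] -> (Linfty_norm (Omega b (eta b) t) (err v) <= (C * b ^+ 2)%:E)%E.
  move=> vv; apply: Linfty_norm_le.
    (* The sign of [C] is not recorded; the estimate at one interior point shows that the bound is
       nonnegative. *)
    have Iq : inside (depth (beta i) (e i)) (0, depth (beta i) (e i) 0 / 2).
      by have := h_gt0 i 0; rewrite /inside /= => h0; apply/andP; split; lra.
    exact: le_trans (normr_ge0 _) (E _ Iq v vv).
  apply: (error_closure R (depth b (e i)) (slice t (Phi b)) P
    (velocity b (T / b) t (eta b) (Phi b) v) v _ (h_gt0 i)).
  - by move=> q Sq; exact: (slice_limit b (T / b) t (eta b) (Phi b) (tint i) (sol _ hb) q v Sq).
  - by move=> X; exact: (Pc i X v vv).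
  - by move=> q Iq; exact: (E q Iq v vv).
by split; apply: bound; rewrite !inE eqxx ?orbT.
Qed.
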